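(* Let $(s,t)\in\mathbb{C}\times\mathbb{C}$ with $|s|>|t|$ and let $0<p\le\infty$. Then: (a) $T^{(s,t)}$ is bounded on $F^p$ if and only if $|s|^2\ge|t|^2+1$; (b) $T^{(s,t)}$ is compact on $F^p$ (in the sense defined in the context) if and only if $|s|^2>|t|^2+1$.
   Context: Let $dA$ be area measure on $\mathbb{C}$ and $d\lambda(z)=\frac1\pi e^{-|z|^2}\,dA(z)$. For $0<p\le\infty$ the Fock space $F^p$ consists of all entire functions $f$ on $\mathbb{C}$ such that $f(z)e^{-|z|^2/2}\in L^p(\mathbb{C},dA)$, with $$\|f\|_p^p=\frac{p}{2\pi}\int_{\mathbb{C}}\left|f(z)e^{-|z|^2/2}\right|^p dA(z)\ (0<p<\infty),\qquad \|f\|_\infty=\sup_{z\in\mathbb{C}}|f(z)|e^{-|z|^2/2}.$$ For $(s,t)\in\mathbb{C}^2$ with $s\neq0$, $$K^{(s,t)}(z,w)=\frac1{\sqrt s}\exp\left[\frac{tz^2-\overline{tw^2}+2z\overline w}{2s}\right],\qquad T^{(s,t)}f(z)=\int_{\mathbb{C}}K^{(s,t)}(z,w)f(w)\,d\lambda(w),$$ with principal square root ($\arg\in(-\pi,\pi]$). When $|s|>|t|$, this integral converges for every $z\in\mathbb{C}$ and defines an entire function $T^{(s,t)}f$ for every $f\in F^\infty$, hence for every $f\in F^p$ (since $F^p\subset F^\infty$). ''Bounded on $F^p$'' means that $T^{(s,t)}$ maps $F^p$ into $F^p$ and there is a constant $M$ with $\|T^{(s,t)}f\|_p\le M\|f\|_p$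 for all $f\in F^p$. A bounded linear operator $T:F^p\to F^p$ ($0<p\le\infty$) is called compact if $\|Tf_n\|_p\to0$ for every bounded sequence $\{f_n\}\subset F^p$ that converges to $0$ uniformly on compact subsets of $\mathbb{C}$. *)

(* Defs.v *)
From HB Require Import structures.
From mathcomp Require Import all_boot all_order all_algebra.
From mathcomp Require Import all_classical all_reals all_analysis.
From mathcomp Require Import complex.

Set Implicit Arguments.
Unset Strict Implicit.
Unset Printing Implicit Defensive.

Import Order.TTheory GRing.Theory Num.Theory.
Import numFieldNormedType.Exports.

Local Open Scope classical_set_scope.
Local Open Scope ring_scope.
Local Open Scope complex_scope.

Section Fock.
Variable R : realType.
Local Notation C := R[i].
Implicit Types (z w s t : C) (f g : C -> C) (T : (C -> C) -> C -> C).
Implicit Types (p : \bar R).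

(* The modulus as an element of R: on R[i] the generic norm takes its values
   in R[i] itself. *)
Definition modc z : R := Normc.normc z.

Definition expc z : C :=
  (expR (complex.Re z))%:C * (cos (complex.Im z) +i* sin (complex.Im z)).

(* R[i]^o is R[i] as a normed space over itself, so that this is
   differentiability with respect to the complex variable. *)
Definition entire f : Prop :=
  forall z, derivable (f : C^o -> C^o) z 1.

(* Points of the plane are pairs of reals on the measure-theoretic side. *)
Definition C_of (xy : R * R) : C := xy.1 +i* xy.2.

Definition dA : {measure set (measurableTypeR R * measurableTypeR R)%type
    -> \bar R} :=
  (@lebesgue_measure R \x @lebesgue_measure R)%E.

Definition integralC g : C :=
  (\int[dA]_xy complex.Re (g (C_of xy))) +i*
  (\int[dA]_xy complex.Im (g (C_of xy))).

(* Density of d lambda with respect to dA. *)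
Definition gauss_weight z : C := (pi^-1 * expR (- modc z ^+ 2))%:C.

Definition memLp p g : Prop :=
  [/\ measurable_fun [set: measurableTypeR R * measurableTypeR R]
        (fun xy => complex.Re (g (C_of xy))),
      measurable_fun [set: measurableTypeR R * measurableTypeR R]
        (fun xy => complex.Im (g (C_of xy))) &
      finite_norm dA p (fun xy => modc (g (C_of xy)))].

Definition fock p f : Prop :=
  entire f /\ memLp p (fun z => f z * (expR (- modc z ^+ 2 / 2))%:C).

(* The value for p = -oo is irrelevant: only p > 0 is considered. *)
Definition fock_norm p f : \bar R :=
  match p with
  | r%:E =>
      ((r / (2 * pi))%:E *
       \int[dA]_xy
         ((modc (f (C_of xy)) * expR (- modc (C_of xy) ^+ 2 / 2)) `^ r)%:E)
      `^ r^-1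
  | +oo => ereal_sup [set (modc (f z) * expR (- modc z ^+ 2 / 2))%:E
                     | z in [set: C]]
  | -oo => 0
  end%E.

(* [sqrtc] is the principal root: its value has nonnegative real part, and
   nonnegative imaginary part on the negative real axis. The root [sqrtC] of
   numClosedFieldType, with values in the upper half-plane, is not. *)
Definition K s t z w : C :=
  (sqrtc s)^-1 *
  expc ((t * z ^+ 2 - (t * w ^+ 2)^* + 2 * z * w^*) / (2 * s)).

Definition Top s t f z : C :=
  integralC (fun w => K s t z w * f w * gauss_weight w).

Definition linear_on p T : Prop :=
  forall (a : C) f g, fock p f -> fock p g ->
    T (fun z => a * f z + g z) = (fun z => a * T f z + T g z).

Definition bounded_on p T : Prop :=
  (forall f, fock p f -> fock p (T f)) /\
  exists M : R, forall f, fock p f ->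
    (fock_norm p (T f) <= M%:E * fock_norm p f)%E.

Definition compact_on p T : Prop :=
  [/\ linear_on p T, bounded_on p T &
      forall f_ : nat -> C -> C,
        (forall n, fock p (f_ n)) ->
        (exists M : R, forall n, (fock_norm p (f_ n) <= M%:E)%E) ->
        (forall A : set C^o, compact A ->
          {uniform A, (f_ : nat -> C^o -> C^o) @ \oo --> (cst 0 : C^o -> C^o)}) ->
        fock_norm p (T (f_ n)) @[n --> \oo] --> 0%E].

End Fock.

(* Main.v *)
(* Put n = |s| and m = sqrt (|t|^2 + 1). After both Gaussian weights are absorbed,
   the modulus of the kernel is, up to a constant, exp (- Q(z,w) / 2) for a real
   quadratic form Q, and completing squares gives
     n Q(z,w) = (n - m) (|z|^2 + |w|^2) + (|A|^2 + |B|^2) / (2 m n^2),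
     A = n m z - s (conj (t z) + w),   B = n m w - conj s (z - conj (t w)).

   If m <= n, the kernel is dominated by a Gaussian in w centred at a point
   depending on z, and by a Gaussian in z centred at a point depending on w. For
   every finite p, the weighted mean value inequality, applied to the holomorphic
   function w |-> f w * conj (K(z,w))^(1/2), bounds its weighted modulus by its
   p-norm; integrating in z gives boundedness without any duality, hence also
   for p < 1. If m < n, the extra factor exp (- c (|z|^2 + |w|^2)) and dominated
   convergence give compactness.

   Conversely T maps the normalized reproducing kernel at w to a multiple of
   K(.,w), and for each w there is a z with A = B = 0. There the weighted modulus
   is a constant times exp ((m - n) (|z|^2 + |w|^2) / (2 n)), which is unbounded
   if m > n, and constant along a sequence of normalized kernels tending to 0
   if m = n. *)

Require Import Defs.
From HB Require Import structures.
From mathcomp Require Import all_boot all_order all_algebra.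
From mathcomp Require Import all_classical all_reals all_analysis.
From mathcomp Require Import measurable_realfun ess_sup_inf.
From mathcomp Require Import complex ring lra.

Set Implicit Arguments.
Unset Strict Implicit.
Unset Printing Implicit Defensive.

Import Order.TTheory GRing.Theory Num.Theory.
Import numFieldNormedType.Exports.

Local Open Scope classical_set_scope.
Local Open Scope ring_scope.
Local Open Scope complex_scope.

(** * The modulus and the exponential *)

Section Modulus.
Variable R : realType.
Local Notation C := R[i].
Implicit Types z w : C.

(** The threshold [m] comes from linear algebra. In [v = (z, conj w)] the numerator of the kernel
    exponent is [v^T M v], where [M] is the symmetric matrix of rows [(t, 1)] and [(1, - conj t)],
    and [M] is [m] times a unitary matrix. Hence the real part of the exponent is at most
    [m / (2 n) |v|^2], and over each w this bound is attained at some z. One stays next to f, where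
    a mean value estimate bounds the product pointwise by its own p-th power integral; the other is
    integrated in w. The power p/2 of the kernel left in that integral is still dominated by a
    Gaussian in z, and Tonelli concludes. The function theory rests on the mean value property, and
    an entire function is only assumed differentiable at each point. Hence the path through
    Goursat's argument, circle means and averages over rotations to a bound of |f a|^p by an
    integral over a disc, for every p > 0. Constants are not sharp: real and imaginary parts are
    estimated separately, and discs are compared with squares. *)

Lemma modcE z : `|z| = (modc z)%:C.
Proof. by []. Qed.

Lemma modc_sqrE z : modc z ^+ 2 = complex.Re z ^+ 2 + complex.Im z ^+ 2.
Proof. by case: z => a b; rewrite /modc/= sqr_sqrtr// addr_ge0// sqr_ge0. Qed.

Lemma modc_ge0 z : 0 <= modc z.
Proof. by case: z => a b; rewrite /modc/= sqrtr_ge0. Qed.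

Lemma modc0 : modc (0 : C) = 0. Proof. exact: Normc.normc0. Qed.
Lemma modc1 : modc (1 : C) = 1. Proof. exact: Normc.normc1. Qed.

Lemma modcM z w : modc (z * w) = modc z * modc w.
Proof. exact: Normc.normcM. Qed.

Lemma modcV z : modc z^-1 = (modc z)^-1.
Proof. exact: Normc.normcV. Qed.

Lemma modcX z n : modc (z ^+ n) = modc z ^+ n.
Proof. by elim: n => [|n IH]; rewrite ?modc1// !exprS modcM IH. Qed.

Lemma modcD z w : modc (z + w) <= modc z + modc w.
Proof. by have := ler_normD z w; rewrite !modcE -rmorphD lecR. Qed.

Lemma modcN z : modc (- z) = modc z.
Proof. by case: z => a b; rewrite /modc/= !sqrrN. Qed.

Lemma modc_distC z w : modc (z - w) = modc (w - z).
Proof. by rewrite -modcN opprB. Qed.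

Lemma modcJ z : modc z^* = modc z.
Proof. by case: z => a b; rewrite /modc/= sqrrN. Qed.

Lemma modcR (a : R) : modc a%:C = `|a|.
Proof. by rewrite /modc/= expr0n/= addr0 sqrtr_sqr. Qed.

Lemma modc_eq0 z : (modc z == 0) = (z == 0).
Proof.
apply/eqP/eqP => [|->]; last exact: modc0.
exact: Normc.eq0_normc.
Qed.

Lemma modc_gt0 z : (0 < modc z) = (z != 0).
Proof. by rewrite lt_def modc_ge0 andbT modc_eq0. Qed.

Lemma ler_Re_modc z : `|complex.Re z| <= modc z.
Proof.
by rewrite -(@ler_pXn2r _ 2)// ?nnegrE ?modc_ge0// modc_sqrE real_normK ?num_real//
  lerDl sqr_ge0.
Qed.

Lemma ler_Im_modc z : `|complex.Im z| <= modc z.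
Proof.
by rewrite -(@ler_pXn2r _ 2)// ?nnegrE ?modc_ge0// modc_sqrE real_normK ?num_real//
  lerDr sqr_ge0.
Qed.

Lemma modc_ler_ReIm z : modc z <= `|complex.Re z| + `|complex.Im z|.
Proof.
rewrite -(@ler_pXn2r _ 2)// ?nnegrE ?modc_ge0 ?addr_ge0// modc_sqrE.
rewrite -(real_normK (num_real (complex.Re z))) -(real_normK (num_real (complex.Im z))).
by rewrite sqrrD lerD2r lerDl mulrn_wge0// mulr_ge0.
Qed.

End Modulus.

Section ExpC.
Variable R : realType.
Local Notation C := R[i].
Implicit Types z w : C.

Lemma expcD z w : expc (z + w) = expc z * expc w.
Proof.
case: z w => a b [c d]; rewrite /expc/= expRD cosD sinD; apply/eqP.
by rewrite eq_complex/=; apply/andP; split; apply/eqP; ring.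
Qed.

Lemma modc_expc z : modc (expc z) = expR (complex.Re z).
Proof.
rewrite /expc modcM modcR ger0_norm ?expR_ge0//.
by rewrite [modc (_ +i* _)]/modc/= cos2Dsin2 sqrtr1 mulr1.
Qed.

Lemma conjc_expc z : (expc z)^* = expc z^*.
Proof.
case: z => a b; rewrite /expc/= cosN sinN; apply/eqP.
by rewrite eq_complex/=; apply/andP; split; apply/eqP; ring.
Qed.

Lemma ler_norm_sin (y : R) : `|sin y| <= `|y|.
Proof.
wlog y0 : y / 0 <= y => [hw|].
  have [/hw//|/ltW y0] := leP 0 y.
  by have := hw (- y); rewrite sinN !normrN; apply; rewrite oppr_ge0.
have dsin x : x \in `]0, y[ -> is_derive x 1 (@sin R) (cos x).
  by move=> _; exact: is_derive_sin.
have csin : {within `[0, y], continuous (@sin R)}.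
  by apply: continuous_subspaceT => x; exact: continuous_sin.
have [c _] := MVT_segment y0 dsin csin; rewrite sin0 !subr0 => ->.
by rewrite normrM ler_piMl// cos_max.
Qed.

Lemma ler_norm_cosB1_sqr (y : R) : `|cos y - 1| <= y ^+ 2 / 2.
Proof.
(* Half-angle substitution: [cos (2 u) - 1 = - 2 sin^2 u]. *)
have [u ->] : exists u, y = u + u by exists (y / 2); field.
have -> : cos (u + u) - 1 = - (sin u ^+ 2 *+ 2).
  by rewrite cosD; have := cos2Dsin2 u => h; rewrite mulr2n; nra.
rewrite normrN normrMn normrX.
have : `|sin u| ^+ 2 <= `|u| ^+ 2 by rewrite ler_pXn2r ?nnegrE//; exact: ler_norm_sin.
by rewrite [leRHS]real_normK ?num_real// mulr2n; nra.
Qed.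

Lemma ler_norm_cosB1 (y : R) : `|cos y - 1| <= `|y|.
Proof.
have [y2|y2] := leP `|y| 2.
  apply: le_trans (ler_norm_cosB1_sqr y) _.
  by rewrite -(real_normK (num_real y)); have := normr_ge0 y; nra.
have := cos_max y; rewrite !ler_norml => /andP[? ?].
by apply/andP; split; lra.
Qed.

Lemma ler_norm_sinB (y : R) : `|sin y - y| <= y ^+ 2.
Proof.
wlog y0 : y / 0 <= y => [hw|].
  have [/hw//|/ltW y0] := leP 0 y.
  have := hw (- y); rewrite oppr_ge0 => /(_ y0).
  by rewrite sinN -opprD normrN sqrrN.
have df x : x \in `]0, y[ -> is_derive x 1 (fun x => sin x - x) (cos x - 1).
  by move=> _; apply: is_deriveB.
have cf : {within `[0, y], continuous (fun x => sin x - x)}.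
  apply: continuous_subspaceT => x; apply: cvgB; [exact: continuous_sin|exact: cvg_id].
have [c] := MVT_segment y0 df cf; rewrite in_itv/= => /andP[c0 cy].
rewrite sin0 !subr0 => ->.
rewrite normrM (ger0_norm y0) expr2 ler_wpM2r//.
by apply: le_trans (ler_norm_cosB1 c) _; rewrite ger0_norm.
Qed.

(** Everything follows from [1 + y <= expR y] at [y = x] and at [y = - x]; the latter reads
    [(1 - x) * expR x <= 1]. *)
Lemma expR_taylor1 (x : R) : 0 <= expR x - 1 - x <= x ^+ 2 * expR `|x|.
Proof.
have h1 := expR_ge1Dx x; have := expR_ge1Dx (- x).
rewrite expRN => h2; have e0 := expR_gt0 x.
have h3 : (1 - x) * expR x <= 1.
  by rewrite -ler_pdivlMr// mul1r.
apply/andP; split; first by lra.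
have [x0|x0] := leP 0 x.
  rewrite (ger0_norm x0); have : 0 <= x * (1 - (1 - x) * expR x) by rewrite mulr_ge0// subr_ge0.
  by nra.
rewrite (ltr0_norm x0).
have : 1 <= expR (- x) by rewrite -expR0 ler_expR; lra.
by nra.
Qed.

Lemma expRB1_ub (x : R) : `|expR x - 1| <= `|x| * expR `|x|.
Proof.
have h1 := expR_ge1Dx x; have := expR_ge1Dx (- x).
rewrite expRN => h2; have e0 := expR_gt0 x.
have h3 : (1 - x) * expR x <= 1.
  by rewrite -ler_pdivlMr// mul1r.
have [x0|x0] := leP 0 x.
  by rewrite (ger0_norm x0) ger0_norm; lra.
rewrite (ltr0_norm x0); have : 1 <= expR (- x) by rewrite -expR0 ler_expR; lra.
have : expR x <= 1 by rewrite -[leRHS]expR0 ler_expR ltW.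
by move=> e1 e2; rewrite ler0_norm; nra.
Qed.

(** The bound is global, with an explicit growth factor: it serves at small arguments for the
    derivative of [expc], and at unbounded ones when differentiating under an integral. *)
Lemma expc_taylor1 z : modc (expc z - 1 - z) <= 4 * modc z ^+ 2 * expR (modc z).
Proof.
have Rez := ler_Re_modc z; have Imz := ler_Im_modc z.
apply: le_trans (modc_ler_ReIm _) _.
set n := modc z in Rez Imz *; set E := expR n.
have n0 : 0 <= n by exact: modc_ge0.
have E0 : 0 < E by exact: expR_gt0.
case: z @n @E Rez Imz n0 E0 => x y n E /= Rez Imz n0 E0.
rewrite /= !mul0r !(subr0, addr0).
have eE : expR `|x| <= E by rewrite ler_expR.
have eE' : expR x <= E by rewrite ler_expR (le_trans (ler_norm _)).
have e0 := expR_gt0 x; have e0' := expR_gt0 `|x|.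
have xx : x ^+ 2 <= n ^+ 2 by rewrite -(real_normK (num_real x)) ler_pXn2r ?nnegrE.
have yy : y ^+ 2 <= n ^+ 2 by rewrite -(real_normK (num_real y)) ler_pXn2r ?nnegrE.
have n2 : 0 <= n ^+ 2 by rewrite sqr_ge0.
have hR : `|expR x * cos y - 1 - x| <= n ^+ 2 * E + E * (n ^+ 2 / 2).
  rewrite (_ : _ - x = (expR x - 1 - x) + expR x * (cos y - 1)); last by ring.
  apply: le_trans (ler_normD _ _) _; apply: lerD.
    have /andP[h1 h2] := expR_taylor1 x.
    rewrite ger0_norm//; apply: le_trans h2 _; apply: ler_pM; rewrite ?sqr_ge0 ?expR_ge0//.
  rewrite normrM (ger0_norm (ltW e0)); apply: ler_pM; rewrite ?expR_ge0//.
  apply: le_trans (ler_norm_cosB1_sqr y) _; lra.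
have hI : `|expR x * sin y - y| <= E * n ^+ 2 + n * E * n.
  rewrite (_ : _ - y = expR x * (sin y - y) + (expR x - 1) * y); last by ring.
  apply: le_trans (ler_normD _ _) _; apply: lerD.
    rewrite normrM (ger0_norm (ltW e0)); apply: ler_pM; rewrite ?expR_ge0//.
    exact: le_trans (ler_norm_sinB y) _.
  rewrite normrM; apply: ler_pM => //.
  apply: le_trans (expRB1_ub x) _; apply: ler_pM; rewrite ?mulr_ge0 ?expR_ge0//.
apply: le_trans (lerD hR hI) _.
have nE : 0 <= n ^+ 2 * E by exact: (mulr_ge0 n2 (ltW E0)).
lra.
Qed.

End ExpC.

Section ComplexDerivative.
Variable R : realType.
Local Notation C := R[i].
Implicit Types (z w d : C) (f g : C -> C).

(** The norm of [C^o] takes its values in [R[i]]; this form of [f'(z) = d] keeps every epsilon in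
    [R], and h = 0 is harmless because no quotient appears. *)
Definition cdiff f z d := forall e : R, 0 < e -> exists2 k : R, 0 < k &
  forall h, modc h < k -> modc (f (z + h) - f z - d * h) <= e * modc h.

Lemma gt0_complexP (e : C) : reflect (exists2 r : R, 0 < r & e = r%:C) (0 < e).
Proof.
apply: (iffP idP) => [|[r r0 ->]]; last by rewrite ltcR.
case: e => a b; rewrite ltcE/= => /andP[/eqP-> a0].
by exists a.
Qed.

Lemma modc_slope d h x : h != 0 ->
  modc (d - h^-1 * x) = (modc h)^-1 * modc (x - d * h).
Proof.
move=> h0; rewrite modc_distC -modcV -modcM; congr modc.
by rewrite mulrBr mulrCA mulVf// mulr1.
Qed.

Lemma derivable_cdiffP f z :
  derivable (f : C^o -> C^o) z 1 <-> exists d, cdiff f z d.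
Proof.
split.
  move=> /cvg_ex[d /cvgrPdist_le hd]; exists d => e e0.
  have /hd : 0 < e%:C by rewrite ltcR.
  rewrite /dnbhs/= => /nbhs_ballP[_ /= /gt0_complexP[k k0 ->] hk].
  exists k => // h hk'.
  have [->|h0] := eqVneq h 0; first by rewrite addr0 subrr mulr0 subr0 modc0 mulr0.
  have := hk h; rewrite /ball/= /ball_/= sub0r normrN modcE ltcR => /(_ hk' h0).
  rewrite modcE lecR [_ *: 1]mulr1 [h + z]addrC => hh.
  by rewrite [leRHS]mulrC -ler_pdivrMl ?modc_gt0// -modc_slope.
move=> [d hd]; apply/cvg_ex; exists d; apply/cvgrPdist_le => _ /gt0_complexP[e e0 ->].
have [k k0 hk] := hd e e0.
rewrite /dnbhs/=; apply/nbhs_ballP; exists k%:C => /=; first by rewrite ltcR.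
move=> h; rewrite /ball/= /ball_/= sub0r normrN modcE ltcR => hk' h0.
rewrite modcE lecR [_ *: 1]mulr1 [h + z]addrC.
by rewrite modc_slope// ler_pdivrMl ?modc_gt0// [leRHS]mulrC hk.
Qed.

End ComplexDerivative.

(** * Circular means of entire functions *)

Section IntervalIntegral.
Variable R : realType.
Implicit Types (f g : R -> R) (a b c l : R).

Definition itvint f a b := \int[@lebesgue_measure R]_(x in `[a, b]) f x.

Lemma continuous_itv_integrable f a b : continuous f ->
  (@lebesgue_measure R).-integrable `[a, b] (EFin \o f).
Proof.
move=> cf; apply: continuous_compact_integrable; first exact: segment_compact.
exact: continuous_subspaceT.
Qed.

Lemma itvintB f g a b : continuous f -> continuous g ->
  itvint (fun x => f x - g x) a b = itvint f a b - itvint g a b.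
Proof. by move=> cf cg; apply: RintegralB => //; apply: continuous_itv_integrable. Qed.

Lemma itvint_cst c a b : a <= b -> itvint (fun=> c) a b = c * (b - a).
Proof.
move=> ab; rewrite /itvint Rintegral_cst//.
rewrite [X in fine X](lebesgue_measure_itv `[a, b])/= lte_fin.
by case: ltP => [//|ba]; rewrite (le_anti (introT andP (conj ab ba))) subrr.
Qed.

Lemma itvint_split f a b c : continuous f -> a <= b -> b <= c ->
  itvint f a c = itvint f a b + itvint f b c.
Proof.
move=> cf ab bc; rewrite /itvint.
rewrite -(Rintegral_itv_obnd_cbnd (r := b)); last first.
  have := continuous_itv_integrable b c cf; apply: integrableS => //.
  by apply: subset_itvr; rewrite bnd_simp.
rewrite -(@Rintegral_itvB _ _ (BLeft a) (BRight c) b) ?bnd_simp//.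
  by rewrite addrC subrK.
exact: continuous_itv_integrable.
Qed.

Lemma ler_norm_itvint f a b M : continuous f -> a <= b ->
  (forall x, a <= x <= b -> `|f x| <= M) -> `|itvint f a b| <= M * (b - a).
Proof.
move=> cf ab fM; rewrite -(itvint_cst M ab).
apply: le_trans (le_normr_Rintegral _ (continuous_itv_integrable a b cf)) _ => //.
apply: le_Rintegral => //.
- apply: (@continuous_itv_integrable (fun x => `|f x|)) => x.
  exact: (cvg_norm (cf x)).
- exact: (@continuous_itv_integrable (fun=> M)) (fun x => cvg_cst _).
Qed.

End IntervalIntegral.

(** * Goursat's lemma for closed forms on rectangles *)

Section Goursat.
Variable R : realType.
Variables P Q : R -> R -> R.

(* Sharing the coefficient [b] means that P and Q are differentiable with
   dP/dy = dQ/dx. The derivatives need not be continuous, whence Goursat's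
   subdivision argument. *)
Hypothesis closed : forall x0 y0, exists a b c : R, forall e : R, 0 < e ->
  exists2 k : R, 0 < k & forall x y, `|x - x0| <= k -> `|y - y0| <= k ->
  `|P x y - P x0 y0 - a * (x - x0) - b * (y - y0)| <= e * (`|x - x0| + `|y - y0|) /\
  `|Q x y - Q x0 y0 - b * (x - x0) - c * (y - y0)| <= e * (`|x - x0| + `|y - y0|).

Lemma linear_approx_cvg (f : R -> R) x0 a :
  (exists2 k : R, 0 < k & forall x, `|x - x0| <= k ->
    `|f x - f x0 - a * (x - x0)| <= `|x - x0|) -> {for x0, continuous f}.
Proof.
move=> [k k0 hk]; apply/cvgrPdist_le => e e0.
have a1 : 0 < `|a| + 1 by rewrite ltr_wpDl.
have near_id d : 0 < d -> \forall x \near x0, `|x0 - x| <= d.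
  by move=> d0; apply/nbhs_ballP; exists d => // y /ltW.
near=> x.
have xk : `|x - x0| <= k.
  by rewrite distrC; near: x; exact: near_id.
have xe : `|x - x0| <= e / (`|a| + 1).
  by rewrite distrC; near: x; apply: near_id; rewrite divr_gt0.
rewrite distrC (_ : _ - _ = (f x - f x0 - a * (x - x0)) + a * (x - x0)); last by ring.
apply: le_trans (ler_normD _ _) _; rewrite normrM.
move: xe; rewrite ler_pdivlMr//; have := hk x xk; lra.
Unshelve. all: by end_near. Qed.

Lemma closed_continuous1 y : continuous (fun x => P x y).
Proof.
move=> x0; have [a [b [c /(_ 1 ltr01)[k k0 hk]]]] := closed x0 y.
apply: (@linear_approx_cvg _ x0 a); exists k => // x xk.
have := (hk x y xk); rewrite subrr normr0 ltW// => /(_ isT)[+ _].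
by rewrite !(mulr0, subr0, addr0) mul1r.
Qed.

Lemma closed_continuous2 x : continuous (fun y => Q x y).
Proof.
move=> y0; have [a [b [c /(_ 1 ltr01)[k k0 hk]]]] := closed x y0.
apply: (@linear_approx_cvg _ y0 c); exists k => // y yk.
have := (hk x y); rewrite subrr normr0 ltW// => /(_ isT yk)[_].
by rewrite !(mulr0, subr0, addr0, add0r) mul1r.
Qed.

(** The integral of [P dx + Q dy], taken clockwise, around the rectangle with lower left corner
    [(a, c)] and sides [l], [m]. *)
Let G a l c m := itvint (fun x => P x (c + m) - P x c) a (a + l)
  - itvint (fun y => Q (a + l) y - Q a y) c (c + m).

Let cP y : continuous (fun x => P x y) := @closed_continuous1 y.
Let cQ x : continuous (fun y => Q x y) := @closed_continuous2 x.

Let G_splitx (a l c m : R) : 0 <= l -> 0 <= m ->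
  G a l c m = G a (l / 2) c m + G (a + l / 2) (l / 2) c m.
Proof.
move=> l0 m0; rewrite /G -!addrA -splitr !itvintB//.
rewrite !(@itvint_split _ _ a (a + l / 2) (a + l))//; [ring|lra..].
Qed.

Let G_splity (a l c m : R) : 0 <= l -> 0 <= m ->
  G a l c m = G a l c (m / 2) + G a l (c + m / 2) (m / 2).
Proof.
move=> l0 m0; rewrite /G -!addrA -splitr !itvintB//.
rewrite !(@itvint_split _ _ c (c + m / 2) (c + m))//; [ring|lra..].
Qed.

(** With [q] the coefficient shared by P and Q, subtracting [q * m] from one integrand and [q * l]
    from the other leaves [G] unchanged, both contributing [q * l * m]. Only approximation errors of
    order [e * (l + m)] on sides of length [l] and [m] remain. *)
Let G_local (x0 y0 e : R) : 0 < e -> exists2 k : R, 0 < k & forall a l c m : R,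
  0 <= l <= k -> 0 <= m <= k -> a <= x0 <= a + l -> c <= y0 <= c + m ->
  `|G a l c m| <= 4 * e * (l + m) ^+ 2.
Proof.
move=> e0; have [p [q [r /(_ e e0)[k k0 hk]]]] := closed x0 y0.
exists k => // a l c m /andP[l0 lk] /andP[m0 mk] /andP[ax xa] /andP[cy yc].
have cB (f g : R -> R) : continuous f -> continuous g ->
  continuous (fun x => f x - g x).
  by move=> cf cg x; apply: cvgB; [exact: cf|exact: cg].
have -> : G a l c m = itvint (fun x => P x (c + m) - P x c - q * m) a (a + l)
   - itvint (fun y => Q (a + l) y - Q a y - q * l) c (c + m).
  rewrite (itvintB _ _ (f := fun x => P x (c + m) - P x c))//; last 2 first.
  - exact: cB.
  - by move=> x; exact: cvg_cst.
  rewrite (itvintB _ _ (f := fun y => Q (a + l) y - Q a y))//; last 2 first.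
  - exact: cB.
  - by move=> x; exact: cvg_cst.
  rewrite !itvint_cst ?lerDl// /G; ring.
have nx x : a <= x <= a + l -> `|x - x0| <= l.
  by move=> /andP[? ?]; rewrite ler_norml; apply/andP; split; lra.
have ny y : c <= y <= c + m -> `|y - y0| <= m.
  by move=> /andP[? ?]; rewrite ler_norml; apply/andP; split; lra.
have aa : a <= a <= a + l by rewrite lexx lerDl.
have aal : a <= a + l <= a + l by rewrite lexx lerDl l0.
have cc : c <= c <= c + m by rewrite lexx lerDl.
have ccm : c <= c + m <= c + m by rewrite lexx lerDl m0.
have h1 : `|itvint (fun x => P x (c + m) - P x c - q * m) a (a + l)|
    <= (2 * e * (l + m)) * (a + l - a).
  apply: ler_norm_itvint; rewrite ?lerDl//.
    by apply: (cB); [exact: cB|move=> ?; exact: cvg_cst].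
  move=> x /nx xl.
  have [P1 _] := hk x (c + m) (le_trans xl lk) (le_trans (ny _ ccm) mk).
  have [P2 _] := hk x c (le_trans xl lk) (le_trans (ny _ cc) mk).
  have := ny _ cc; have := ny _ ccm => n1 n2.
  have e1 : e * (`|x - x0| + `|c + m - y0|) <= e * (l + m) by rewrite ler_pM2l// lerD.
  have e2 : e * (`|x - x0| + `|c - y0|) <= e * (l + m) by rewrite ler_pM2l// lerD.
  have := le_trans P1 e1; have := le_trans P2 e2.
  by rewrite !ler_norml => /andP[? ?] /andP[? ?]; apply/andP; split; lra.
have h2 : `|itvint (fun y => Q (a + l) y - Q a y - q * l) c (c + m)|
    <= (2 * e * (l + m)) * (c + m - c).
  apply: ler_norm_itvint; rewrite ?lerDl//.
    by apply: (cB); [exact: cB|move=> ?; exact: cvg_cst].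
  move=> y /ny yl.
  have [_ P1] := hk (a + l) y (le_trans (nx _ aal) lk) (le_trans yl mk).
  have [_ P2] := hk a y (le_trans (nx _ aa) lk) (le_trans yl mk).
  have := nx _ aa; have := nx _ aal => n1 n2.
  have e1 : e * (`|a + l - x0| + `|y - y0|) <= e * (l + m) by rewrite ler_pM2l// lerD.
  have e2 : e * (`|a - x0| + `|y - y0|) <= e * (l + m) by rewrite ler_pM2l// lerD.
  have := le_trans P1 e1; have := le_trans P2 e2.
  by rewrite !ler_norml => /andP[? ?] /andP[? ?]; apply/andP; split; lra.
apply: le_trans (ler_normB _ _) _; apply: le_trans (lerD h1 h2) _.
have : 0 <= e * (l + m) ^+ 2 by rewrite mulr_ge0 ?sqr_ge0// ltW.
by rewrite expr2; lra.
Qed.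

(** [G] is additive under subdivision, so one of the four quarters, indexed by two booleans, carries
    at least a quarter of the bound. *)
Let G_quad (D a l c m : R) : 0 <= l -> 0 <= m -> D <= `|G a l c m| ->
  exists2 ac : R * R, [/\ a <= ac.1, ac.1 + l / 2 <= a + l, c <= ac.2 &
    ac.2 + m / 2 <= c + m] & D / 4 <= `|G ac.1 (l / 2) ac.2 (m / 2)|.
Proof.
move=> l0 m0 DG.
suff : exists i j : bool, D / 4 <=
    `|G (a + i%:R * (l / 2)) (l / 2) (c + j%:R * (m / 2)) (m / 2)|.
  move=> [i [j ij]]; exists (a + i%:R * (l / 2), c + j%:R * (m / 2)) => //=.
  by case: i ij => _; case: j => /=; split; lra.
apply/not_existsP => h; have {}h (i j : bool) : `|G (a + i%:R * (l / 2)) (l / 2)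
    (c + j%:R * (m / 2)) (m / 2)| < D / 4.
  by rewrite ltNge; apply/negP => hij; apply: (h i); exists j.
have e0 x y : x + false%:R * y = x :> R by rewrite mulr0n mul0r addr0.
have e1 x y : x + true%:R * y = x + y :> R by rewrite mulr1n mul1r.
have := h true true; have := h true false; have := h false true; have := h false false.
have l2 : 0 <= l / 2 by rewrite divr_ge0.
move: DG; rewrite G_splitx// (G_splity a c l2 m0) (G_splity (a + l / 2) c l2 m0) !e0 !e1.
move: (G a _ c _) (G a _ (c + _) _) (G (a + _) _ c _) (G (a + _) _ (c + _) _).
move=> A B A' B' DG h1 h2 h3 h4.
have := le_trans DG (ler_normD (A + B) (A' + B')).
have := ler_normD A B; have := ler_normD A' B'; lra.
Qed.

Let nested_limit (u d : nat -> R) : (forall n, u n <= u n.+1) ->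
  (forall n, d n.+1 <= d n) -> (forall n, u n <= d n) ->
  exists x, forall n, u n <= x <= d n.
Proof.
move=> uS dS ud.
have un n k : u n <= u (n + k)%N.
  by elim: k => [|k IH]; rewrite ?addn0// addnS (le_trans IH).
have dn n k : d (n + k)%N <= d n.
  by elim: k => [|k IH]; rewrite ?addn0// addnS (le_trans _ IH).
have uk n k : u n <= d k.
  by rewrite (le_trans (un n k))// (le_trans (ud _))// addnC.
exists (sup (range u)) => n; apply/andP; split.
  apply: ub_le_sup; last by exists n.
  by exists (d 0%N) => _ [k _ <-].
by apply: ge_sup; [exists (u 0%N); exists 0%N|move=> _ [k _ <-]].
Qed.

Lemma goursat (a b c d : R) : a <= b -> c <= d ->
  itvint (fun x => P x d - P x c) a b = itvint (fun y => Q b y - Q a y) c d.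
Proof.
move=> ab cd; apply/eqP; rewrite -subr_eq0 -normr_le0.
set l := b - a; set m := d - c.
have l0 : 0 <= l by rewrite subr_ge0.
have m0 : 0 <= m by rewrite subr_ge0.
have [bE dE] : b = a + l /\ d = c + m by rewrite /l /m; split; ring.
rewrite bE dE -/(G a l c m); set D := `|G a l c m|.
(* A state is a depth and a lower left corner. The premise stands under the existential so that
   [choice] gives a total function; a state violating it gets a dummy successor. *)
have step (s : nat * (R * R)) : exists s' : nat * (R * R),
  D / 4 ^+ s.1 <= `|G s.2.1 (l / 2 ^+ s.1) s.2.2 (m / 2 ^+ s.1)| ->
  [/\ s'.1 = s.1.+1,
  D / 4 ^+ s'.1 <= `|G s'.2.1 (l / 2 ^+ s'.1) s'.2.2 (m / 2 ^+ s'.1)| &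
  [/\ s.2.1 <= s'.2.1, s'.2.1 + l / 2 ^+ s'.1 <= s.2.1 + l / 2 ^+ s.1,
      s.2.2 <= s'.2.2 & s'.2.2 + m / 2 ^+ s'.1 <= s.2.2 + m / 2 ^+ s.1]].
  case: s => n [x y] /=.
  have [hD|hD] := pselect (D / 4 ^+ n <= `|G x (l / 2 ^+ n) y (m / 2 ^+ n)|); last first.
    by exists (0%N, (0, 0)).
  have ln : 0 <= l / 2 ^+ n by rewrite divr_ge0// exprn_ge0.
  have mn : 0 <= m / 2 ^+ n by rewrite divr_ge0// exprn_ge0.
  have [[x' y'] /= h1 h2] := G_quad ln mn hD.
  exists (n.+1, (x', y')) => _ /=.
  by rewrite !exprSr !invfM !mulrA in h1 h2 *; split.
have [next nextP] := choice step.
pose s n := iter n next (0%N, (a, c)).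
have sP n : (s n).1 = n /\
  D / 4 ^+ n <= `|G (s n).2.1 (l / 2 ^+ n) (s n).2.2 (m / 2 ^+ n)|.
  elim: n => [|n [s1 sD]] /=; first by rewrite !expr0 !divr1.
  by have := nextP (s n); rewrite s1 => /(_ sD)[-> ? _].
have sS n := let: conj s1 sD := sP n in nextP (s n) (eq_ind_r (fun k => D / 4 ^+ k <= `|G (s n).2.1 (l / 2 ^+ k) (s n).2.2 (m / 2 ^+ k)|) sD s1).
have [x0 hx] : exists x, forall n, (s n).2.1 <= x <= (s n).2.1 + l / 2 ^+ n.
  apply: nested_limit => n.
  - by have [_ _ []] := sS n.
  - by have [s1 _ []] := sS n; rewrite s1 (sP n).1.
  - by rewrite lerDl divr_ge0// exprn_ge0.
have [y0 hy] : exists y, forall n, (s n).2.2 <= y <= (s n).2.2 + m / 2 ^+ n.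
  apply: nested_limit => n.
  - by have [_ _ []] := sS n.
  - by have [s1 _ []] := sS n; rewrite s1 (sP n).1.
  - by rewrite lerDl divr_ge0// exprn_ge0.
(* The factor [4 ^+ n] of [sP] matches the squared halvings in [G_local], so the depth drops out. *)
have small e : 0 < e -> D <= e * (4 * (l + m) ^+ 2).
  move=> e0; have [k k0 hk] := G_local x0 y0 e0.
  have [n hn] : exists n, (l + m) / 2 ^+ n <= k.
    have h2 : `|2^-1 : R| < 1 by rewrite ger0_norm//; lra.
    have /cvgrPdist_le/(_ k k0) := cvg_geometric (l + m) h2.
    move=> [n _ /(_ n (leqnn _))]; rewrite sub0r normrN /= => hn; exists n.
    by rewrite -exprVn (le_trans (ler_norm _)).
  have ln : 0 <= l / 2 ^+ n by rewrite divr_ge0// exprn_ge0.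
  have mn : 0 <= m / 2 ^+ n by rewrite divr_ge0// exprn_ge0.
  have := hk _ _ _ _ _ _ (hx n) (hy n).
  rewrite ln mn /= mulrDl in hn *.
  move=> /(_ ltac:(lra) ltac:(lra)) h.
  have := le_trans (sP n).2 h.
  rewrite -mulrDl expr_div_n -exprM mulnC exprM (_ : 2 ^+ 2 = 4); last by ring.
  rewrite !mulrA ler_pM2r ?invr_gt0 ?exprn_gt0//; lra.
apply/ler_addgt0Pl => e e0; rewrite addr0.
have X0 : 0 < 4 * (l + m) ^+ 2 + 1 by rewrite ltr_wpDl// mulr_ge0// sqr_ge0.
have /small : 0 < e / (4 * (l + m) ^+ 2 + 1) by rewrite divr_gt0.
move/le_trans; apply; rewrite -mulrA ler_piMr ?(ltW e0)//.
by rewrite mulrC ler_pdivrMr// mul1r lerDl.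
Qed.

End Goursat.

Section Entire.
Variable R : realType.
Local Notation C := R[i].
Implicit Types (z w d : C) (f g : C -> C).

Lemma entireP f : entire f <-> forall z, exists d, cdiff f z d.
Proof. by split=> h z; apply/derivable_cdiffP; exact: h. Qed.

Lemma entire_cst c : entire (fun=> c : C).
Proof. by move=> z; exact: (@derivable_cst _ C^o C^o). Qed.

Lemma entire_id : entire (@id C).
Proof. by move=> z; exact: (@derivable_id _ C^o). Qed.

Lemma entireD f g : entire f -> entire g -> entire (fun z => f z + g z).
Proof. by move=> ef eg z; exact: (@derivableD _ C^o C^o f g). Qed.

Lemma entireM f g : entire f -> entire g -> entire (fun z => f z * g z).
Proof. by move=> ef eg z; exact: (@derivableM _ C^o f g). Qed.

Lemma entire_comp f g : entire f -> entire g -> entire (fun z => f (g z)).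
Proof.
move=> ef eg z; apply/derivable1_diffP.
by apply: (@differentiable_comp _ C^o C^o C^o g f); apply/derivable1_diffP;
  [exact: eg|exact: ef].
Qed.

Lemma entire_expc : entire (@expc R).
Proof.
apply/entireP => z; exists (expc z) => e e0.
have E0 : 0 < 4 * expR 1 * modc (expc z).
  by rewrite !mulr_gt0// ?expR_gt0// modc_expc expR_gt0.
exists (Num.min 1 (e / (4 * expR 1 * modc (expc z)))).
  by rewrite lt_min ltr01 divr_gt0.
move=> h; rewrite lt_min => /andP[h1]; rewrite ltr_pdivlMr// => he.
rewrite expcD (_ : expc z * expc h - expc z - expc z * h = expc z * (expc h - 1 - h)); last by rewrite !mulrBr mulr1.
rewrite modcM; have n0 := modc_ge0 h; have m0 := modc_ge0 (expc z).
have eh : expR (modc h) <= expR 1 by rewrite ler_expR ltW.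
have t1 : modc (expc h - 1 - h) <= 4 * modc h ^+ 2 * expR 1.
  apply: le_trans (expc_taylor1 h) _; rewrite ler_wpM2l// mulr_ge0// exprn_ge0//.
apply: le_trans (ler_wpM2l m0 t1) _.
rewrite [leLHS](_ : _ = modc h * (4 * expR 1 * modc (expc z)) * modc h); last by ring.
by rewrite ler_wpM2r// ltW.
Qed.

Lemma entire_continuous f z : entire f -> forall e : R, 0 < e ->
  exists2 k : R, 0 < k & forall w, modc (w - z) < k -> modc (f w - f z) <= e.
Proof.
move=> /entireP/(_ z)[d hd] e e0; have [k k0 hk] := hd 1 ltr01.
have d0 : 0 < 1 + modc d by rewrite ltr_pwDl// modc_ge0.
exists (Num.min k (e / (1 + modc d))); first by rewrite lt_min k0 divr_gt0.
move=> w; rewrite lt_min => /andP[wk]; rewrite ltr_pdivlMr// => we.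
have := hk _ wk; rewrite [z + _]addrC subrK => h1.
rewrite (_ : f w - f z = (f w - f z - d * (w - z)) + d * (w - z)); last by ring.
apply: le_trans (modcD _ _) _; rewrite modcM; nra.
Qed.

End Entire.

Section CircleMean.
Variable R : realType.
Local Notation C := R[i].
Implicit Types (z w d : C) (f g : C -> C).

(** With [P = Im g] and [Q = Re g] the form is [Im (g dz)]; by the Cauchy-Riemann equations the
    shared coefficient is the real part of the derivative. *)
Let entire_closed g : entire g -> forall x0 y0 : R, exists a b c : R,
  forall e : R, 0 < e -> exists2 k : R, 0 < k & forall x y,
  `|x - x0| <= k -> `|y - y0| <= k ->
  `|complex.Im (g (x +i* y)) - complex.Im (g (x0 +i* y0)) - a * (x - x0) - b * (y - y0)|
     <= e * (`|x - x0| + `|y - y0|) /\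
  `|complex.Re (g (x +i* y)) - complex.Re (g (x0 +i* y0)) - b * (x - x0) - c * (y - y0)|
     <= e * (`|x - x0| + `|y - y0|).
Proof.
move=> /entireP eg x0 y0; have [d hd] := eg (x0 +i* y0).
exists (complex.Im d), (complex.Re d), (- complex.Im d) => e e0.
have [k k0 hk] := hd e e0; exists (k / 4); first by rewrite divr_gt0.
move=> x y xk yk.
have nh : modc ((x - x0) +i* (y - y0)) <= `|x - x0| + `|y - y0|.
  exact: modc_ler_ReIm.
have /hk : modc ((x - x0) +i* (y - y0)) < k by lra.
rewrite (_ : (x0 +i* y0) + _ = x +i* y); last first.
  by apply/eqP; rewrite eq_complex/= !(addrC _ (_ - _)) !subrK !eqxx.
move=> /le_trans/(_ (ler_wpM2l (ltW e0) nh)) h.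
split.
  apply: le_trans h; apply: le_trans (ler_Im_modc _).
  case: (g _) => ? ?; case: (g _) => ? ?; case: (d) => ? ? /=.
  rewrite le_eqVlt; apply/orP; left; apply/eqP; congr `|_|; ring.
apply: le_trans h; apply: le_trans (ler_Re_modc _).
case: (g _) => ? ?; case: (g _) => ? ?; case: (d) => ? ? /=.
rewrite le_eqVlt; apply/orP; left; apply/eqP; congr `|_|; ring.
Qed.

Lemma entire_Re_line_continuous g (x : R) : entire g ->
  continuous (fun y => complex.Re (g (x +i* y))).
Proof. by move=> eg; exact: (closed_continuous2 (entire_closed eg) (x := x)). Qed.

(** On a rectangle one period high the horizontal sides cancel, so [goursat] compares just the
    vertical ones. *)
Lemma entire_Re_line_integral g : entire g ->
  (forall z, g (z + (0 +i* (2 * pi))) = g z) -> forall a b : R, a <= b ->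
  itvint (fun y => complex.Re (g (b +i* y))) 0 (2 * pi) =
  itvint (fun y => complex.Re (g (a +i* y))) 0 (2 * pi).
Proof.
move=> eg pg a b ab.
have c0 : 0 <= 2 * pi :> R by rewrite mulr_ge0// pi_ge0.
have := goursat (entire_closed eg) ab c0.
have cR x := entire_Re_line_continuous (x := x) eg.
rewrite [in RHS]itvintB//.
rewrite [LHS](_ : _ = itvint (fun=> 0) a b); last first.
  congr itvint; apply/funext => x.
  by rewrite -[x +i* (2 * pi)](_ : (x +i* 0) + (0 +i* (2 * pi)) = _) ?pg ?subrr//;
    apply/eqP; rewrite eq_complex/= addr0 add0r !eqxx.
by rewrite itvint_cst// mul0r => /esym/eqP; rewrite subr_eq0 => /eqP.
Qed.

(* [z |-> f (w * expc z)] has period 2 pi i, so its mean over a vertical period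
   does not depend on the real part of [z], and the circle shrinks to 0 as the
   latter tends to -oo. *)
Lemma circle_mean_Re f w : entire f ->
  itvint (fun t => complex.Re (f (w * expc (0 +i* t)))) 0 (2 * pi) =
  2 * pi * complex.Re (f 0).
Proof.
move=> ef; pose g z := f (w * expc z).
have eg : entire g.
  apply: (entire_comp ef); apply: entireM; first exact: entire_cst.
  exact: entire_expc.
have pg z : g (z + (0 +i* (2 * pi))) = g z.
  congr (f (w * _)); case: z => x y; rewrite /expc/= addr0.
  by rewrite mulr_natl sinD2pi cosD2pi.
have c0 : 0 <= 2 * pi :> R by rewrite mulr_ge0// pi_ge0.
have c1 : 0 < 2 * pi + 1 :> R by rewrite ltr_wpDl.
apply/eqP; rewrite -subr_eq0 -normr_le0; apply/ler_addgt0Pl => e e0; rewrite addr0.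
have [k k0 hk] := entire_continuous 0 ef (divr_gt0 e0 c1).
have w0 : 0 < modc w + 1 by rewrite ltr_wpDl// modc_ge0.
(* The circle of radius [modc w * expR a] must lie in the disc of radius [k] given by continuity at
   0; [Num.min 0] puts the line to the left of the imaginary axis, as the comparison lemma
   requires. *)
pose a := Num.min 0 (ln (k / (modc w + 1) / 2)).
have a0 : a <= 0 by rewrite ge_min lexx.
have ea : expR a <= k / (modc w + 1) / 2.
  by rewrite -[leRHS]lnK ?posrE ?divr_gt0// ler_expR ge_min lexx orbT.
rewrite -/(itvint (fun t => complex.Re (g (0 +i* t))) 0 (2 * pi)).
rewrite (entire_Re_line_integral eg pg a0).
have cR := entire_Re_line_continuous (x := a) eg.
rewrite [2 * pi * _](_ : _ = itvint (fun=> complex.Re (f 0)) 0 (2 * pi)); last first.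
  by rewrite itvint_cst// subr0 mulrC.
rewrite -itvintB//; last by move=> x; exact: cvg_cst.
apply: (@le_trans _ _ (e / (2 * pi + 1) * (2 * pi - 0))).
  apply: ler_norm_itvint => //.
    by move=> x; apply: cvgB; [exact: cR|exact: cvg_cst].
  move=> t _; apply: le_trans (hk (w * expc (a +i* t)) _).
    have := ler_Re_modc (g (a +i* t) - f 0).
    by rewrite /g; case: (f (_ * _)) => ? ?; case: (f 0).
  rewrite subr0 modcM modc_expc/=.
  move: ea; rewrite -mulrA -invfM ler_pdivlMr ?mulr_gt0//.
  have := expR_gt0 a; have := modc_ge0 w; nra.
rewrite subr0 mulrAC ler_pdivrMr// ler_pM2l// lerDl ler01//.
Qed.

End CircleMean.

(** * Integration over the plane *)

Section Plane.
Variable R : realType.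
Local Notation mR := (measurableTypeR R).
Local Notation plane := (mR * mR)%type.
Local Notation leb := (@lebesgue_measure R).
Local Notation dA := (@dA R).
Implicit Types (T : plane -> plane).

Lemma dA_rect (A B : set mR) : measurable A -> measurable B ->
  dA (A `*` B) = (leb A * leb B)%E.
Proof. exact: product_measure1E. Qed.

Lemma sigma_finite_dA : sigma_finite setT dA.
Proof.
pose I n : set mR := `[- n%:R, n%:R]%classic.
exists (fun n => I n `*` I n).
  apply/seteqP; split => // -[x y] _;
  exists (Num.bound (`|x| + `|y|)) => //.
  have := archi_boundP (addr_ge0 (normr_ge0 x) (normr_ge0 y)).
  move=> /ltW h; split; rewrite /I /= in_itv/= -ler_norml; apply: le_trans h.
    by rewrite lerDl.
  by rewrite lerDr.
move=> n; have mI : measurable (I n) by exact: measurable_itv.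
split; first exact: measurableX.
rewrite dA_rect//; have -> : leb (I n) = (n%:R *+ 2)%:E.
  rewrite /I [LHS]lebesgue_measure_itv/= lte_fin -EFinB opprK -mulr2n.
  case: ltP => // h; have -> : n%:R = 0 :> R by apply/eqP; rewrite eq_le ler0n andbT; move: (ler0n R n) h; lra.
  by rewrite mul0rn.
by rewrite -EFinM ltry.
Qed.

(* [dA] with its sigma-finite structure, which its definition forgets. *)
Definition dAsf : {sigma_finite_measure set plane -> \bar R} :=
  HB.pack (Measure.sort dA) dA (Measure_isSigmaFinite.Build _ _ _ (Measure.sort dA) sigma_finite_dA).

Local Open Scope ereal_scope.

Lemma dA_tonelli1 (f : plane -> \bar R) : measurable_fun setT f ->
  (forall z, 0 <= f z) -> \int[dA]_z f z = \int[leb]_x \int[leb]_y f (x, y).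
Proof. by move=> mf f0; exact: fubini_tonelli1. Qed.

Lemma dA_tonelli2 (f : plane -> \bar R) : measurable_fun setT f ->
  (forall z, 0 <= f z) -> \int[dA]_z f z = \int[leb]_y \int[leb]_x f (x, y).
Proof. by move=> mf f0; rewrite [LHS](dA_tonelli1 mf f0) (fubini_tonelli _ mf). Qed.

Lemma dA_dA_tonelli (f : plane * plane -> \bar R) : measurable_fun setT f ->
  (forall z, 0 <= f z) ->
  \int[dA]_z \int[dA]_w f (z, w) = \int[dA]_w \int[dA]_z f (z, w).
Proof. by move=> mf f0; exact: (@fubini_tonelli _ _ _ _ _ dAsf dAsf f mf f0). Qed.

Lemma lebesgue_integral_shift (a : R) (f : mR -> \bar R) : measurable_fun setT f ->
  (forall x, 0 <= f x) -> \int[leb]_x f (x + a)%R = \int[leb]_x f x.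
Proof.
move=> mf f0.
have msh : measurable_fun setT (fun x : mR => (x + a)%R : mR).
  exact: measurable_funD.
transitivity (\int[pushforward leb (fun x : mR => (x + a)%R : mR)]_x f x).
  by rewrite ge0_integral_pushforward.
apply: eq_measure_integral => //= A mA _; apply/esym.
apply: lebesgue_measure_unique => //= _ [[b c]] _ <-.
rewrite /pushforward.
rewrite (_ : _ @^-1` _ = `](b - a)%R, (c - a)%R]%classic); last first.
  by apply/seteqP; split => x /=; rewrite !in_itv/= ltrBlDr lerBrDr.
rewrite [LHS]lebesgue_measure_itv [RHS]lebesgue_measure_itv/= !lte_fin ltrD2r.
by case: ifP => // _; rewrite -!EFinB; congr _%:E; ring.
Qed.

(** Invariance is stated for nonnegative integrals, not for sets: in this form it composes, and
    Tonelli proves it for shears and translations. *)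
Definition dA_preserving T := measurable_fun setT T /\
  forall f : plane -> \bar R, measurable_fun setT f -> (forall z, 0 <= f z) ->
  \int[dA]_z f (T z) = \int[dA]_z f z.

Lemma dA_preserving_comp T T' : dA_preserving T -> dA_preserving T' ->
  dA_preserving (T \o T').
Proof.
move=> [mT hT] [mT' hT']; split; first exact: measurableT_comp.
move=> f mf f0 /=; transitivity (\int[dA]_z f (T z)); last exact: hT.
apply: (hT' (f \o T)); first exact: measurableT_comp.
by move=> z; exact: f0.
Qed.

Lemma dA_preserving_integral T (f : plane -> \bar R) : dA_preserving T ->
  measurable_fun setT f -> \int[dA]_z f (T z) = \int[dA]_z f z.
Proof.
move=> [mT hT] mf; rewrite [LHS]integralE [RHS]integralE.
congr (_ - _).
  rewrite -(hT (f^\+))//; last exact: measurable_funepos.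
  by apply: eq_integral => z _; rewrite !funeposE.
rewrite -(hT (f^\-))//; last exact: measurable_funeneg.
by apply: eq_integral => z _; rewrite !funenegE.
Qed.

(** A shear translates each line parallel to the first axis, so integrating along these lines first
    reduces to [lebesgue_integral_shift]. *)
Lemma dA_preserving_shear1 (t : R) :
  dA_preserving (fun z => (z.1 + t * z.2, z.2)%R).
Proof.
have mT : measurable_fun setT (fun z : plane => (z.1 + t * z.2, z.2)%R : plane).
  apply: measurable_fun_pair; last exact: measurable_snd.
  by apply: measurable_funD => //; apply: measurable_funM.
split; [exact: mT|move=> f mf f0]; rewrite [LHS]dA_tonelli2//; last exact: (measurableT_comp mf mT).
rewrite [RHS](dA_tonelli2 mf f0); apply: eq_integral => y _ /=.
apply: (@lebesgue_integral_shift _ (fun x => f (x, y))) => //.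
by apply: measurableT_comp => //; exact: pair2_measurable.
Qed.

Lemma dA_preserving_shear2 (t : R) :
  dA_preserving (fun z => (z.1, z.2 + t * z.1)%R).
Proof.
have mT : measurable_fun setT (fun z : plane => (z.1, z.2 + t * z.1)%R : plane).
  apply: measurable_fun_pair; first exact: measurable_fst.
  by apply: measurable_funD => //; apply: measurable_funM.
split; [exact: mT|move=> f mf f0]; rewrite [LHS]dA_tonelli1//; last exact: (measurableT_comp mf mT).
rewrite [RHS](dA_tonelli1 mf f0); apply: eq_integral => x _ /=.
apply: (@lebesgue_integral_shift _ (fun y => f (x, y))) => //.
by apply: measurableT_comp => //; exact: pair1_measurable.
Qed.

Lemma dA_preserving_shift (a b : R) :
  dA_preserving (fun z => (z.1 + a, z.2 + b)%R).
Proof.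
have mT : measurable_fun setT (fun z : plane => (z.1 + a, z.2 + b)%R : plane).
  by apply: measurable_fun_pair; apply: measurable_funD.
split; [exact: mT|move=> f mf f0]; rewrite [LHS]dA_tonelli1//; last exact: (measurableT_comp mf mT).
rewrite [RHS](dA_tonelli1 mf f0).
transitivity (\int[leb]_x \int[leb]_y f (x + a, y)%R).
  apply: eq_integral => x _ /=.
  apply: (@lebesgue_integral_shift _ (fun y => f ((x + a)%R, y))) => //.
  by apply: measurableT_comp => //; exact: pair1_measurable.
apply: (@lebesgue_integral_shift _ (fun x => \int[leb]_y f (x, y))).
  exact: (measurable_fun_fubini_tonelli_F (m2 := leb) f).
by move=> x; apply: integral_ge0.
Qed.

Lemma dA_preserving_rot (c s : R) : (c ^+ 2 + s ^+ 2 = 1)%R ->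
  dA_preserving (fun z => (c * z.1 - s * z.2, s * z.1 + c * z.2)%R).
Proof.
(* A rotation is a product of three shears, unless it is the half-turn. *)
suff rot (a b : R) : (a ^+ 2 + b ^+ 2 = 1)%R -> (1 + a != 0)%R ->
    dA_preserving (fun z => (a * z.1 - b * z.2, b * z.1 + a * z.2)%R).
  move=> cs1; have [c1|] := eqVneq (1 + c)%R 0%R; last exact: rot.
  (* The half-turn is the square of the quarter-turn. *)
  have r1 : dA_preserving (fun z => (0 * z.1 - 1 * z.2, 1 * z.1 + 0 * z.2)%R).
    by apply: rot; rewrite ?addr0 ?oner_neq0// expr0n expr1n add0r.
  have cN1 : (c = - 1)%R by lra.
  have s0 : (s = 0)%R.
    by apply/eqP; rewrite -sqrf_eq0; apply/eqP; rewrite cN1 in cs1; lra.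
  rewrite cN1 s0 (_ : (fun z => _) = (fun z : plane => (0 * z.1 - 1 * z.2, 1 * z.1 + 0 * z.2)%R : plane) \o (fun z => (0 * z.1 - 1 * z.2, 1 * z.1 + 0 * z.2)%R)).
    exact: dA_preserving_comp.
  by apply/funext => z /=; congr (_, _); ring.
(* [t] is minus the tangent of half the angle, which is why [a = - 1] is excluded. *)
move=> ab1 a1; set t := (- b / (1 + a))%R.
have tb : (1 + t * b = a)%R.
  rewrite /t; apply: (mulIf a1); rewrite mulrDl mul1r mulrAC divfK//.
  by lra.
have tt : (t * a + t = - b)%R.
  rewrite (_ : t * a + t = t * (1 + a))%R; last by ring.
  by rewrite /t divfK.
rewrite (_ : (fun z => _) = (fun z : plane => (z.1 + t * z.2, z.2)%R : plane) \o
  ((fun z : plane => (z.1, z.2 + b * z.1)%R : plane) \o (fun z => (z.1 + t * z.2, z.2)%R))).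
  apply: dA_preserving_comp; first exact: dA_preserving_shear1.
  by apply: dA_preserving_comp; [exact: dA_preserving_shear2|exact: dA_preserving_shear1].
apply/funext => -[x y] /=; congr (_, _); last by rewrite -tb; ring.
have -> : (x + t * y + t * (y + b * (x + t * y)) =
  (1 + t * b) * x + (t * (1 + t * b) + t) * y)%R by ring.
by rewrite tb tt; ring.
Qed.

Local Close Scope ereal_scope.

(** For the variance [1 / (2 c)] the integrand is a normal density divided by its peak, and an
    infinite integral would contradict total mass 1. *)
Lemma gauss1_lty (c : R) : 0 < c ->
  (\int[leb]_x (expR (- (c * x ^+ 2)))%:E < +oo)%E.
Proof.
move=> c0; set s : R := Num.sqrt (2 * c)^-1.
have s0 : s != 0 by rewrite gt_eqF// sqrtr_gt0 invr_gt0 mulr_gt0.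
have := integral_normal_pdf 0 s.
rewrite normal_pdfE// => h.
have s2 : s ^+ 2 *+ 2 = c^-1.
  by rewrite sqr_sqrtr ?invr_ge0 ?mulr_ge0// 1?ltW// -mulr_natl invfM; field; rewrite gt_eqF.
have pk : 0 < normal_peak s by exact: normal_peak_gt0.
have : (\int[leb]_x ((normal_peak s)%:E * (expR (- (c * x ^+ 2)))%:E) = 1)%E.
  rewrite -h; apply: eq_integral => x _.
  rewrite -EFinM; congr _%:E; rewrite /normal_fun subr0 s2 invrK; congr (_ * expR _); ring.
rewrite ge0_integralZl//.
- move=> h1; rewrite ltey; apply/eqP => h2; move: h1; rewrite h2 gt0_muley ?lte_fin//.
- apply/measurable_EFinP; apply: measurableT_comp => //.
  by apply: measurable_funN; apply: measurable_funM => //; exact: exprn_measurable.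
- by rewrite lee_fin (ltW pk).
Qed.

Lemma gauss2_lty (c : R) : 0 < c ->
  (\int[dA]_z (expR (- (c * modc (C_of z) ^+ 2)))%:E < +oo)%E.
Proof.
move=> c0; have mg : measurable_fun setT (fun x : mR => expR (- (c * x ^+ 2))).
  apply: measurableT_comp => //; apply: measurable_funN.
  by apply: measurable_funM => //; exact: exprn_measurable.
have E z : expR (- (c * modc (C_of z) ^+ 2)) =
    expR (- (c * z.1 ^+ 2)) * expR (- (c * z.2 ^+ 2)).
  by rewrite -expRD modc_sqrE; congr expR => /=; ring.
have m2 : measurable_fun setT (fun z : plane => (expR (- (c * modc (C_of z) ^+ 2)))%:E).
  apply/measurable_EFinP; rewrite (_ : (fun z => _) = (fun z : plane =>
    expR (- (c * z.1 ^+ 2)) * expR (- (c * z.2 ^+ 2)))); last exact/funext.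
  apply: measurable_funM; first exact: (measurableT_comp mg measurable_fst).
  exact: (measurableT_comp mg measurable_snd).
have e0 (t : R) : (0 <= (expR t)%:E)%E by rewrite lee_fin expR_ge0.
rewrite (dA_tonelli1 m2)//.
set G := (\int[leb]_y (expR (- (c * y ^+ 2)))%:E)%E.
have G0 : (0 <= G)%E by exact: integral_ge0.
have Gfin : G \is a fin_num by rewrite ge0_fin_numE//; exact: gauss1_lty.
rewrite (_ : (\int[leb]_x _)%E = (G * G)%E).
  by apply: lte_mul_pinfty => //; exact: gauss1_lty.
transitivity (\int[leb]_x ((expR (- (c * x ^+ 2)))%:E * G))%E.
  apply: eq_integral => x _; rewrite -ge0_integralZl//; last exact/measurable_EFinP.
  by apply: eq_integral => y _; rewrite E EFinM.
by rewrite ge0_integralZr//; exact/measurable_EFinP.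
Qed.

(** The measurable sets of the plane are those of the product; a superlevel set is written as the
    countable union of the rational boxes that it contains. *)
Lemma continuous_measurable_plane (F : plane -> R) :
  (forall z (e : R), 0 < e -> exists2 k : R, 0 < k &
    forall w, `|w.1 - z.1| < k -> `|w.2 - z.2| < k -> `|F w - F z| <= e) ->
  measurable_fun setT F.
Proof.
move=> cF; apply: (measurability _ (RGenOInfty.measurableE R)).
move=> /= _ [_ [r ->]] <-; rewrite setTI.
pose box (a b k : rat) : set plane :=
  [set x | ratr a - ratr k < x < ratr a + ratr k]%classic `*`
  [set x | ratr b - ratr k < x < ratr b + ratr k]%classic.
pose U := F @^-1` `]r, +oo[.
pose good (a b k : rat) := `[< box a b k `<=` U >].
rewrite -/U (_ : U = \bigcup_a \bigcup_b \bigcup_k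
    (if good a b k then box a b k else set0)).
  apply: bigcupT_measurable_rat => a; apply: bigcupT_measurable_rat => b.
  apply: bigcupT_measurable_rat => k; case: ifPn => // _.
  have mI (x y : R) : measurable ([set t | x < t < y]%classic : set mR).
    rewrite (_ : [set t | _] = `]x, y[%classic); first exact: measurable_itv.
    by apply/seteqP; split=> t /=; rewrite in_itv.
  by apply: measurableX; exact: mI.
apply/seteqP; split=> [z|z [a _ [b _ [k _]]]]; last first.
  by rewrite /good; case: asboolP => // h /h.
rewrite /U /= in_itv/= andbT => rz.
have [e e0 he] := cF z ((F z - r) / 2) ltac:(lra).
have [k] := rat_in_itvoo (divr_gt0 e0 (ltr0Sn R 1)); rewrite in_itv/= => /andP[k0 ke].
have near_rat (x : R) : exists a : rat, `|x - ratr a| < ratr k.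
  have [a] := @rat_in_itvoo R (x - ratr k) (x + ratr k) ltac:(lra).
  by rewrite in_itv/= => /andP[? ?]; exists a; rewrite ltr_norml; lra.
have [a az] := near_rat z.1; have [b bz] := near_rat z.2.
exists a => //; exists b => //; exists k => //.
rewrite /good; case: asboolP => [_|]; last first.
  case=> w [/= /andP[? ?] /andP[? ?]]; rewrite /U/= in_itv/= andbT.
  move: az bz; rewrite !ltr_norml => az bz.
  have : `|F w - F z| <= (F z - r) / 2 by apply: he; rewrite ltr_norml; lra.
  by rewrite ler_norml; lra.
by split => /=; move: az bz; rewrite !ltr_norml; lra.
Qed.

End Plane.

Section MeasurableComplex.
Context d (X : measurableType d) (R : realType).
Local Notation C := R[i].
Local Notation mR := (measurableTypeR R).
Implicit Types f g : X -> C.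

Definition measC g := measurable_fun [set: X] (fun x => complex.Re (g x)) /\
  measurable_fun [set: X] (fun x => complex.Im (g x)).

Lemma measC_cst c : measC (fun=> c).
Proof. by split; exact: measurable_cst. Qed.

Lemma measC_real (u : X -> R) : measurable_fun setT u -> measC (fun x => (u x)%:C).
Proof. by move=> mu; split => //; exact: measurable_cst. Qed.

Lemma measC_conj g : measC g -> measC (fun x => (g x)^*).
Proof.
move=> [mu mv]; split.
  by rewrite (_ : (fun x => _) = (fun x => complex.Re (g x)))//; apply/funext => x; case: (g x).
rewrite (_ : (fun x => _) = (fun x => - complex.Im (g x))); last first.
  by apply/funext => x; case: (g x).
exact: measurable_funN.
Qed.

Lemma measCD f g : measC f -> measC g -> measC (fun x => f x + g x).
Proof.
move=> [fu fv] [gu gv]; split.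
  rewrite (_ : (fun x => _) = (fun x => complex.Re (f x) + complex.Re (g x))).
    exact: measurable_funD.
  by apply/funext => x; case: (f x) (g x) => ? ? [].
rewrite (_ : (fun x => _) = (fun x => complex.Im (f x) + complex.Im (g x))).
  exact: measurable_funD.
by apply/funext => x; case: (f x) (g x) => ? ? [].
Qed.

Lemma measCM f g : measC f -> measC g -> measC (fun x => f x * g x).
Proof.
move=> [fu fv] [gu gv]; split.
  rewrite (_ : (fun x => _) = (fun x => complex.Re (f x) * complex.Re (g x)
    - complex.Im (f x) * complex.Im (g x))).
    by apply: measurable_funB; exact: measurable_funM.
  by apply/funext => x; case: (f x) (g x) => ? ? [].
rewrite (_ : (fun x => _) = (fun x => complex.Re (f x) * complex.Im (g x)
    + complex.Im (f x) * complex.Re (g x))).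
  by apply: measurable_funD; exact: measurable_funM.
by apply/funext => x; case: (f x) (g x) => ? ? [].
Qed.

Lemma measCN f : measC f -> measC (fun x => - f x).
Proof.
move=> mf; rewrite (_ : (fun x => _) = (fun x => -1 * f x)).
  by apply: measCM => //; exact: measC_cst.
by apply/funext => x; rewrite mulN1r.
Qed.

Lemma measC_modc f : measC f -> measurable_fun setT (fun x => modc (f x)).
Proof.
move=> [fu fv]; rewrite (_ : (fun x => _) =
  (fun x => (complex.Re (f x) ^+ 2 + complex.Im (f x) ^+ 2) `^ 2^-1)).
  apply: (measurableT_comp (measurable_powR _)).
  by apply: measurable_funD; exact: measurable_funX.
by apply/funext => x; rewrite powR12_sqrt ?addr_ge0 ?sqr_ge0//; case: (f x).
Qed.

(** The real and imaginary parts are 1-Lipschitz for [modc], so both components of [h] are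
    continuous on the plane. *)
Lemma measC_entire (h : C -> C) g : entire h -> measC g -> measC (fun x => h (g x)).
Proof.
move=> eh [gu gv].
have mg : measurable_fun setT (fun x => (complex.Re (g x), complex.Im (g x)) : mR * mR).
  exact: measurable_fun_pair.
have gE x : g x = C_of (complex.Re (g x), complex.Im (g x)) by case: (g x).
have mh (p : C -> R) : (forall z w, `|p z - p w| <= modc (z - w)) ->
    measurable_fun setT (fun x => p (h (g x))).
  move=> hp; rewrite (_ : (fun x => _) = (fun z => p (h (C_of z))) \o
    (fun x => (complex.Re (g x), complex.Im (g x)) : mR * mR)); last first.
    by apply/funext => x; rewrite /= -gE.
  apply: (measurableT_comp _ mg); apply: continuous_measurable_plane => z e e0.
  have [k k0 hk] := entire_continuous (C_of z) eh e0.
  exists (k / 2); first by rewrite divr_gt0.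
  move=> w w1 w2; apply: le_trans (hp _ _) _; apply: hk.
  by apply: le_lt_trans (modc_ler_ReIm _) _ => /=; lra.
split; apply: mh => z w; [apply: le_trans (ler_Re_modc _)|apply: le_trans (ler_Im_modc _)];
  by case: z w => ? ? [].
Qed.

End MeasurableComplex.

Section PlaneC.
Variable R : realType.
Local Notation mR := (measurableTypeR R).
Local Notation plane := (mR * mR)%type.

Lemma measC_C_of d (X : measurableType d) (g : X -> plane) : measurable_fun setT g ->
  measC (fun x => C_of (g x)).
Proof. by move=> /measurable_fun_pairP. Qed.

End PlaneC.

Section PlaneIntegral.
Variable R : realType.
Local Notation mR := (measurableTypeR R).
Local Notation plane := (mR * mR)%type.
Local Notation dA := (@dA R).
Implicit Types f g : plane -> R.

Lemma ge0_le_dA f g : measurable_fun setT f -> measurable_fun setT g ->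
  (forall z, 0 <= f z <= g z) ->
  (\int[dA]_z (f z)%:E <= \int[dA]_z (g z)%:E)%E.
Proof.
move=> mf mg fg.
have f0 z : (0 <= (f z)%:E)%E by rewrite lee_fin; case/andP: (fg z).
have g0 z : (0 <= (g z)%:E)%E.
  by rewrite lee_fin; case/andP: (fg z) => a b; exact: le_trans a b.
have mf' : measurable_fun setT (EFin \o f) by exact/measurable_EFinP.
have mg' : measurable_fun setT (EFin \o g) by exact/measurable_EFinP.
have := (@ge0_le_integral _ _ _ dA setT measurableT (EFin \o f) (EFin \o g) (fun z _ => f0 z) mf' mg'). apply => z _.
by rewrite lee_fin; case/andP: (fg z).
Qed.

Lemma le_integrable_dA f g : measurable_fun setT f -> measurable_fun setT g ->
  (forall z, `|f z| <= g z) -> (\int[dA]_z (g z)%:E < +oo)%E ->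
  dA.-integrable setT (EFin \o f).
Proof.
move=> mf mg fg gfin; apply/integrableP; split; first exact/measurable_EFinP.
apply: le_lt_trans gfin; apply: (@ge0_le_dA (fun z => `|f z|)) => //.
  exact: (measurableT_comp (@normr_measurable R setT) mf).
by move=> z; rewrite normr_ge0 fg.
Qed.

End PlaneIntegral.

(** * Mean values of entire functions against radial weights *)

Section MeanValue.
Variable R : realType.
Local Notation C := R[i].
Local Notation mR := (measurableTypeR R).
Local Notation plane := (mR * mR)%type.
Local Notation leb := (@lebesgue_measure R).
Local Notation dA := (@dA R).
Implicit Types (f : C -> C) (psi : R -> R).

Let rot (t : R) (z : plane) : plane :=
  (cos t * z.1 - sin t * z.2, sin t * z.1 + cos t * z.2).

Let C_of_rot t z : C_of (rot t z) = C_of z * expc (0 +i* t).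
Proof.
rewrite /C_of /rot /expc /= expR0; apply/eqP; rewrite eq_complex/=.
by apply/andP; split; apply/eqP; ring.
Qed.

Let modc_rot t z : modc (C_of (rot t z)) = modc (C_of z).
Proof. by rewrite C_of_rot modcM modc_expc expR0 mulr1. Qed.

Let dA_preserving_rot t : dA_preserving (rot t).
Proof. by apply: dA_preserving_rot; exact: cos2Dsin2. Qed.

Let meas_rot : measurable_fun setT (fun x : mR * plane => rot x.1 x.2).
Proof.
have m1 : measurable_fun setT (fun x : mR * plane => cos x.1).
  apply: (measurableT_comp _ measurable_fst); apply: continuous_measurable_fun.
  exact: continuous_cos.
have m2 : measurable_fun setT (fun x : mR * plane => sin x.1).
  apply: (measurableT_comp _ measurable_fst); apply: continuous_measurable_fun.
  exact: continuous_sin.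
have m3 : measurable_fun setT (fun x : mR * plane => x.2.1).
  exact: (measurableT_comp measurable_fst measurable_snd).
have m4 : measurable_fun setT (fun x : mR * plane => x.2.2).
  exact: (measurableT_comp measurable_snd measurable_snd).
apply: measurable_fun_pair.
  by apply: measurable_funB; exact: measurable_funM.
by apply: measurable_funD; exact: measurable_funM.
Qed.

Lemma itv_integral_EFin (g : R -> R) (a b : R) : continuous g ->
  (\int[leb]_(t in `[a, b]) (g t)%:E = (itvint g a b)%:E)%E.
Proof.
move=> cg; rewrite /itvint /Rintegral fineK//.
apply: integrable_fin_num => //; exact: continuous_itv_integrable.
Qed.

(** Averaging over rotations replaces polar coordinates. The integral of
    [Re f (rot t z) * psi (modc z)] over [t] in [[0, 2 pi]] and z is computed in two orders:
    rotation invariance of [dA] gives [2 pi] times the left-hand side, and the circle means give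
    [2 pi] times the right-hand side. *)
Lemma mean_value_Re f psi : entire f -> (forall x, 0 <= psi x) ->
  measurable_fun setT (fun z : plane => psi (modc (C_of z))) ->
  (\int[dA]_z (psi (modc (C_of z)))%:E < +oo)%E ->
  (\int[dA]_z (modc (f (C_of z)) * psi (modc (C_of z)))%:E < +oo)%E ->
  (\int[dA]_z (complex.Re (f (C_of z)) * psi (modc (C_of z)))%:E =
    (complex.Re (f 0))%:E * \int[dA]_z (psi (modc (C_of z)))%:E)%E.
Proof.
move=> ef psi0 mpsi ipsi ifpsi.
pose D : set mR := `[0, 2 * pi]%classic.
have mD : measurable D by exact: measurable_itv.
have pi2 : 0 < 2 * pi :> R by rewrite mulr_gt0// pi_gt0.
have lebD : leb D = (2 * pi)%:E.
  by rewrite [LHS]lebesgue_measure_itv/= lte_fin pi2 -EFinB subr0.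
have intD : (\int[leb]_t (\1_D t)%:E = (2 * pi)%:E)%E.
  by rewrite integral_indic// setIT; exact: lebD.
pose g (z : plane) := complex.Re (f (C_of z)) * psi (modc (C_of z)).
have mC : measC (fun z : plane => C_of z) by apply: measC_C_of; exact: measurable_id.
have mg : measurable_fun setT g.
  by apply: measurable_funM => //; exact: (measC_entire ef mC).1.
pose F (x : mR * plane) := (\1_D x.1 * g (rot x.1 x.2))%:E.
have mF : measurable_fun setT F.
  apply/measurable_EFinP; apply: measurable_funM.
    by apply: (measurableT_comp _ measurable_fst); exact: measurable_indic.
  exact: (measurableT_comp mg meas_rot).
have gint : dA.-integrable setT (EFin \o g).
  apply: (le_integrable_dA mg _ _ ifpsi).
    by apply: measurable_funM => //; exact: (measC_modc (measC_entire ef mC)).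
  by move=> z; rewrite /g normrM (ger0_norm (psi0 _)) ler_wpM2r// ler_Re_modc.
have gfin : (\int[dA]_z (g z)%:E)%E \is a fin_num by exact: integrable_fin_num.
have psifin : (\int[dA]_z (psi (modc (C_of z)))%:E)%E \is a fin_num.
  by rewrite ge0_fin_numE//; apply: integral_ge0 => z _; rewrite lee_fin.
have Fz t (h : plane -> R) : measurable_fun setT h ->
    (\int[dA]_z (\1_D t * h (rot t z))%:E = (\1_D t)%:E * \int[dA]_z (h z)%:E)%E.
  move=> mh; rewrite indicE; case: (t \in D) => /=; last first.
    by rewrite mul0e integral0_eq// => z _; rewrite mul0r.
  rewrite mul1e; under eq_integral do rewrite mul1r.
  apply: (dA_preserving_integral (dA_preserving_rot t) (f := fun z => (h z)%:E)).
  exact/measurable_EFinP.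
have iD (c : \bar R) : c \is a fin_num ->
    (\int[leb]_t ((\1_D t)%:E * c) = (2 * pi)%:E * c)%E.
  move=> /fineK <-; rewrite integralZr//; last first.
    apply/integrableP; split; first by apply/measurable_EFinP; exact: measurable_indic.
    rewrite (eq_integral (fun t => (\1_D t)%:E)); first by rewrite intD ltry.
    by move=> t _; rewrite gee0_abs// lee_fin.
  by rewrite intD.
have Fint : (leb \x dAsf R)%E.-integrable setT F.
  apply/(integrable12ltyP leb (dAsf R) mF).
  have E t : (\int[dA]_z `|F (t, z)| = (\1_D t)%:E * \int[dA]_z (`|g z|)%:E)%E.
    rewrite -Fz; last exact: (measurableT_comp (@normr_measurable R setT) mg).
    have i0 : 0 <= \1_D t :> R by rewrite indicE.
    by apply: eq_integral => z _; rewrite /F/= normrM (ger0_norm i0).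
  rewrite [ltLHS](_ : _ = \int[leb]_t ((\1_D t)%:E * \int[dA]_z (`|g z|)%:E))%E; last first.
    by apply: eq_integral => t _; exact: E.
  have gn : (\int[dA]_z (`|g z|)%:E)%E \is a fin_num.
    have := integrable_abse gint; exact: integrable_fin_num.
  by rewrite iD// ltey_eq fin_numM.
have := Fubini Fint.
rewrite [LHS](_ : _ = (2 * pi)%:E * \int[dA]_z (g z)%:E)%E; last first.
  rewrite -iD//; apply: eq_integral => t _; exact: Fz.
rewrite [RHS](_ : _ = (2 * pi)%:E * ((complex.Re (f 0))%:E * \int[dA]_z (psi (modc (C_of z)))%:E))%E; last first.
  rewrite muleA -EFinM -integralZl//; last first.
    by apply: (le_integrable_dA mpsi mpsi _ ipsi) => z; rewrite ger0_norm.
  apply: eq_integral => z _.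
  pose h t := complex.Re (f (C_of z * expc (0 +i* t))).
  have ch : continuous h.
    apply: (@entire_Re_line_continuous _ (fun w => f (C_of z * expc w)) 0).
    apply: (entire_comp ef); apply: entireM; first exact: entire_cst.
    exact: entire_expc.
  transitivity (\int[leb]_(t in D) (h t * psi (modc (C_of z)))%:E)%E.
    rewrite [RHS]integral_mkcond; apply: eq_integral => t _.
    rewrite -[F (t, z)]/(\1_D t * g (rot t z))%:E /g modc_rot C_of_rot -/(h t).
    by rewrite patchE indicE; case: (t \in D); rewrite ?mul1r ?mul0r.
  rewrite itv_integral_EFin; last by move=> t; apply: cvgM; [exact: ch|exact: cvg_cst].
  rewrite -!EFinM; congr _%:E; rewrite /itvint RintegralZr//; last first.
    exact: continuous_itv_integrable.
  by congr (_ * _); exact: circle_mean_Re.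
rewrite -(fineK gfin) -(fineK psifin) -!EFinM => -[] /(mulfI _) -> //.
by rewrite gt_eqF.
Qed.

End MeanValue.

Section SubMean.
Variable R : realType.
Local Notation C := R[i].
Local Notation mR := (measurableTypeR R).
Local Notation plane := (mR * mR)%type.
Local Notation leb := (@lebesgue_measure R).
Local Notation dA := (@dA R).
Implicit Types (f : C -> C).

Definition disc (r : R) (a : C) (z : plane) : R := (modc (C_of z - a) <= r)%R%:R.

Lemma disc_ge0 r a z : 0 <= disc r a z.
Proof. exact: ler0n. Qed.

Lemma measC_id : measC (fun z : plane => C_of z).
Proof. by apply: measC_C_of; exact: measurable_id. Qed.

Lemma measurable_disc r a : measurable_fun setT (disc r a).
Proof.
have mm : measurable_fun setT (fun z : plane => modc (C_of z - a)).
  by apply: measC_modc; apply: measCD; [exact: measC_id|exact: measC_cst].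
have mb : measurable ((fun z : plane => modc (C_of z - a)) @^-1` `]-oo, r]).
  by rewrite -[X in measurable X]setTI; exact: mm.
rewrite (_ : disc r a = \1_((fun z : plane => modc (C_of z - a)) @^-1` `]-oo, r])).
  exact: measurable_indic.
apply/funext => z; rewrite /disc indicE; case: leP => h.
  by rewrite mem_set//= in_itv/=.
by rewrite memNset//= in_itv/= leNgt h.
Qed.

(** The bounds are the areas of the squares [[0, r / 2]^2], contained in the disc, and [[- r, r]^2],
    containing it. *)
Lemma integral_disc0 r : 0 < r ->
  ((r ^+ 2 / 4)%:E <= \int[dA]_z (disc r 0 z)%:E <= (4 * r ^+ 2)%:E)%E.
Proof.
move=> r0.
have sq (a b : R) : a <= b -> (\int[dA]_z (\1_(`[a, b]%classic `*` `[a, b]%classic) z)%:E = ((b - a) ^+ 2)%:E)%E.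
  move=> ab; have mI : measurable (`[a, b]%classic : set mR) by exact: measurable_itv.
  rewrite integral_indic//; last exact: measurableX.
  rewrite setIT [LHS]dA_rect//.
  have -> : leb `[a, b]%classic = (b - a)%:E.
    rewrite [LHS]lebesgue_measure_itv/= lte_fin EFinB.
    by case: ltP => // ba; rewrite -EFinB; congr _%:E; lra.
  by rewrite -EFinM.
have mI (a b : R) : measurable_fun setT (\1_(`[a, b]%classic `*` `[a, b]%classic) : plane -> R).
  by apply: measurable_indic; apply: measurableX; exact: measurable_itv.
have dE z : disc r 0 z = (z.1 ^+ 2 + z.2 ^+ 2 <= r ^+ 2)%R%:R.
  rewrite /disc subr0 -[in RHS](@modc_sqrE _ (C_of z)); congr (_%:R).
  by rewrite ler_pXn2r// nnegrE ?modc_ge0// ltW.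
apply/andP; split.
  have -> : (r ^+ 2 / 4)%:E = ((r / 2 - 0) ^+ 2)%:E by congr _%:E; field.
  rewrite -sq; last by lra.
  apply: (ge0_le_dA (mI _ _) (measurable_disc _ _)) => z.
  rewrite indicE ler0n dE; case: (boolP (_ \in _)) => //= /set_mem[/=].
  rewrite !in_itv/= => /andP[? ?] /andP[? ?].
  by have -> : z.1 ^+ 2 + z.2 ^+ 2 <= r ^+ 2 by nra.
have -> : (4 * r ^+ 2)%:E = ((r - - r) ^+ 2)%:E by congr _%:E; ring.
rewrite -sq; last by lra.
apply: (ge0_le_dA (measurable_disc _ _) (mI _ _)) => z.
rewrite disc_ge0 indicE dE; case: (boolP (_ + _ <= _)) => //= h.
rewrite mem_set//; split => /=; rewrite in_itv/= -ler_norml -(@ler_pXn2r _ 2)// ?nnegrE ?(ltW r0)//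
  real_normK ?num_real//; have := sqr_ge0 z.1; have := sqr_ge0 z.2; lra.
Qed.

Lemma dA_shiftC (h : plane -> R) (a : C) : measurable_fun setT h -> (forall z, 0 <= h z) ->
  (\int[dA]_z (h ((z.1 + complex.Re a, z.2 + complex.Im a)%R))%:E = \int[dA]_z (h z)%:E)%E.
Proof.
move=> mh h0.
have [_] := dA_preserving_shift (complex.Re a) (complex.Im a).
move=> /(_ (fun z => (h z)%:E)); apply; first exact/measurable_EFinP.
by move=> z; rewrite lee_fin.
Qed.

Lemma C_of_shift (a : C) z : C_of (z.1 + complex.Re a, z.2 + complex.Im a) = C_of z + a.
Proof. by case: a => ? ?. Qed.

Lemma measurable_modc_entire f : entire f -> measurable_fun setT (fun z : plane => modc (f (C_of z))).
Proof. by move=> ef; apply: measC_modc; apply: (measC_entire ef); exact: measC_id. Qed.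

(** The constant is [4 * 2]: the area of the disc is at least [r ^+ 2 / 4], and the real and
    imaginary parts of [f a] are bounded separately. *)
Lemma submean f a r : entire f -> 0 < r ->
  ((r ^+ 2 * modc (f a))%:E <= 8%:E * \int[dA]_z (modc (f (C_of z)) * disc r a z)%:E)%E.
Proof.
move=> ef r0.
wlog a0 : f a ef / a = 0 => [hw|].
  have ef' : entire (fun z => f (z + a)).
    by apply: (entire_comp ef); apply: entireD; [exact: entire_id|exact: entire_cst].
  have := hw _ 0 ef' erefl; rewrite add0r => /le_trans; apply.
  rewrite le_eqVlt; apply/orP; left; apply/eqP; congr (_ * _)%E.
  rewrite -[RHS](@dA_shiftC (fun z => modc (f (C_of z)) * disc r a z) a).
  - by apply: eq_integral => z _; rewrite /disc C_of_shift subr0 addrK.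
  - by apply: measurable_funM; [exact: measurable_modc_entire|exact: measurable_disc].
  - by move=> z; rewrite mulr_ge0// ?modc_ge0// disc_ge0.
rewrite {a}a0; set J := (\int[dA]_z _)%E.
have J0 : (0 <= J)%E by apply: integral_ge0 => z _; rewrite lee_fin mulr_ge0 ?modc_ge0 ?disc_ge0.
have [Joo|Joo] := eqVneq J +oo%E.
  by rewrite Joo gt0_muley ?lte_fin// leey.
have Jfin : (J < +oo)%E by rewrite ltey.
have /andP[V1 V2] := integral_disc0 r0.
set V := (\int[dA]_z _)%E in V1 V2.
have Vfin : (V < +oo)%E by apply: le_lt_trans V2 _; exact: ltry.
pose psi (x : R) : R := (x <= r)%R%:R.
have dpsi z : disc r 0 z = psi (modc (C_of z)) by rewrite /disc subr0.
have mpsi : measurable_fun setT (fun z : plane => psi (modc (C_of z))).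
  by have := measurable_disc r 0; congr measurable_fun; apply/funext.
have bound (g : C -> C) : entire g -> (forall z, modc (g z) = modc (f z)) ->
    ((`|complex.Re (g 0)|)%:E * V <= J)%E.
  move=> eg gf.
  have E : (J = \int[dA]_z (modc (g (C_of z)) * psi (modc (C_of z)))%:E)%E.
    by apply: eq_integral => z _; rewrite gf dpsi.
  have EV : (V = \int[dA]_z (psi (modc (C_of z)))%:E)%E.
    by apply: eq_integral => z _; rewrite dpsi.
  have mv := mean_value_Re eg (fun x => ler0n _ _ : 0 <= psi x) mpsi.
  rewrite -EV -E in mv; have {}mv := mv Vfin Jfin.
  have V0 : (0 <= V)%E by apply: integral_ge0 => z _; rewrite lee_fin disc_ge0.
  have -> : (((`|complex.Re (g 0)|)%:E * V) = `|(complex.Re (g 0))%:E * V|)%E.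
    by rewrite abseM (gee0_abs V0).
  rewrite -mv E.
  have mg : measurable_fun setT (fun z : plane => complex.Re (g (C_of z)) * psi (modc (C_of z))).
    by apply: measurable_funM => //; exact: (measC_entire eg measC_id).1.
  apply: le_trans (le_abse_integral dA measurableT _) _; first exact/measurable_EFinP.
  apply: (@ge0_le_dA _ (fun z => `|complex.Re (g (C_of z)) * psi (modc (C_of z))|)).
  - exact: (measurableT_comp (@normr_measurable R setT) mg).
  - by apply: measurable_funM => //; exact: measurable_modc_entire.
  - by move=> z; rewrite normr_ge0 normrM (ger0_norm (ler0n _ _)) ler_wpM2r// ler_Re_modc.
have b1 := bound f ef (fun=> erefl).
have b2 : ((`|complex.Im (f 0)|)%:E * V <= J)%E.
  (* The real part of [- i f] is the imaginary part of [f], and the modulus does not change. *)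
  pose c : C := 0 -i* 1.
  have gf z : modc (c * f z) = modc (f z).
    by rewrite modcM [X in X * _]/modc/= expr0n/= add0r sqrrN expr1n sqrtr1 mul1r.
  have := bound (fun z => c * f z) (entireM (@entire_cst R c) ef) gf.
  rewrite (_ : complex.Re (c * f 0) = complex.Im (f 0))//.
  by case: (f 0) => x y /=; rewrite mul0r sub0r mulN1r opprK.
have V0 : (0 <= V)%E by apply: integral_ge0 => z _; rewrite lee_fin disc_ge0.
have Jf : J \is a fin_num by rewrite ge0_fin_numE.
have Vf : V \is a fin_num by rewrite ge0_fin_numE.
move: b1 b2 V1; rewrite -(fineK Jf) -(fineK Vf) -!EFinM !lee_fin => b1 b2 V1.
have h := modc_ler_ReIm (f 0).
have r2 : 0 < r ^+ 2 by rewrite exprn_gt0.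
have n1 := modc_ge0 (f 0).
have : r ^+ 2 / 4 * modc (f 0) <= fine V * (`|complex.Re (f 0)| + `|complex.Im (f 0)|).
  by apply: ler_pM => //; rewrite divr_ge0// ltW.
by rewrite mulrDr ![fine V * _]mulrC; lra.
Qed.

End SubMean.

(** * Pointwise estimates and Fock spaces *)

Section Pointwise.
Variable R : realType.
Local Notation C := R[i].
Local Notation mR := (measurableTypeR R).
Local Notation plane := (mR * mR)%type.
Local Notation dA := (@dA R).
Implicit Types (f F : C -> C).

Lemma entire_bounded_disc f r : entire f -> exists2 M : R, 0 < M &
  forall z, modc z <= r -> modc (f z) <= M.
Proof.
move=> ef; have [r0|r0] := leP 0 r; last first.
  by exists 1 => // z zr; have := le_lt_trans zr r0; rewrite ltNge modc_ge0.
pose G (z : R * R) := modc (f (C_of z)).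
have cG : continuous G.
  move=> z; apply/cvgrPdist_le => e e0.
  have [k k0 hk] := entire_continuous (C_of z) ef e0.
  have k2 : 0 < k / 2 by rewrite divr_gt0.
  exists (ball z.1 (k / 2), ball z.2 (k / 2)).
    by split; exact: nbhsx_ballx.
  move=> w [/= w1 w2]; rewrite distrC.
  apply: le_trans (hk (C_of w) _).
    rewrite /G ler_norml; apply/andP; split.
      by have := modcD (f (C_of w)) (f (C_of z) - f (C_of w)); rewrite addrC subrK modc_distC; lra.
    by have := modcD (f (C_of z)) (f (C_of w) - f (C_of z)); rewrite addrC subrK; lra.
  apply: le_lt_trans (modc_ler_ReIm _) _ => /=.
  have w1' : `|z.1 - w.1| < k / 2 by [].
  have w2' : `|z.2 - w.2| < k / 2 by [].
  by rewrite (distrC w.1) (distrC w.2); lra.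
have cK : compact (`[(- r), r]%classic `*` `[(- r), r]%classic : set (R * R)).
  by apply: compact_setX; exact: segment_compact.
have ne : (`[(- r), r]%classic `*` `[(- r), r]%classic : set (R * R)) !=set0.
  by exists (0, 0); split => /=; rewrite in_itv/= oppr_le0 r0.
have [c _ hc] := compact_EVT_max ne cK (continuous_subspaceT cG).
exists (G c + 1); first by rewrite ltr_wpDl// modc_ge0.
move=> z zr; have zE : z = C_of (complex.Re z, complex.Im z) by case: z {zr}.
have : G (complex.Re z, complex.Im z) <= G c.
  apply: hc; apply/mem_set; split => /=; rewrite in_itv/= -ler_norml; apply: le_trans zr.
    exact: ler_Re_modc.
  exact: ler_Im_modc.
by rewrite {1}/G -zE; lra.
Qed.

Let I p F := (\int[dA]_z (modc (F (C_of z)) `^ p * disc 1 0 z)%:E)%E.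

Let I_ge0 p F : (0 <= I p F)%E.
Proof. by apply: integral_ge0 => z _; rewrite lee_fin mulr_ge0 ?powR_ge0 ?disc_ge0. Qed.

Let measurable_I p F : entire F ->
  measurable_fun setT (fun z : plane => modc (F (C_of z)) `^ p * disc 1 0 z).
Proof.
move=> eF; apply: measurable_funM; last exact: measurable_disc.
by apply: (measurableT_comp (measurable_powR _)); exact: measurable_modc_entire.
Qed.

Lemma powRD_gt0 (x r q : R) : 0 < x -> x `^ (r + q) = x `^ r * x `^ q.
Proof. by move=> x0; rewrite powRD// (gt_eqF x0) implybT. Qed.

(** The elementary inequality [x <= A + A^(1 - p) x^p], valid for every A > 0, takes the place of
    Jensen's inequality. *)
Lemma local_estimate_ge1 p F : 1 <= p -> entire F ->
  ((modc (F 0) `^ p)%:E <= (64 `^ p)%:E * I p F)%E.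
Proof.
move=> p1 eF; have p0 : 0 < p by lra.
have [F0|F0] := eqVneq (F 0) 0.
  by rewrite F0 modc0 powR0 ?gt_eqF// mule_ge0// lee_fin powR_ge0.
have n0 : 0 < modc (F 0) by rewrite modc_gt0.
have [Ioo|Ioo] := eqVneq (I p F) +oo%E.
  by rewrite Ioo gt0_muley ?leey// lte_fin powR_gt0.
have If : I p F \is a fin_num by rewrite ge0_fin_numE ?ltey.
(* With 8 from [submean] and the area bound 4, the term linear in [A] becomes [8 * 4 * A], half of
   [modc (F 0)], and is absorbed on the left. *)
set A := modc (F 0) / 64; have A0 : 0 < A by rewrite divr_gt0.
have Ap : 0 < A `^ (1 - p) by exact: powR_gt0.
have key z : modc (F (C_of z)) * disc 1 0 z <=
    A * disc 1 0 z + A `^ (1 - p) * (modc (F (C_of z)) `^ p * disc 1 0 z).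
  rewrite mulrA -mulrDl ler_wpM2r ?disc_ge0//.
  set x := modc _; have x0 : 0 <= x by exact: modc_ge0.
  have [xA|Ax] := leP x A; first by rewrite (le_trans xA)// lerDl mulr_ge0 ?powR_ge0.
  apply: (@le_trans _ _ (A `^ (1 - p) * x `^ p)); last by rewrite lerDr ltW.
  have xp : 0 < x by apply: lt_trans Ax.
  have -> : x `^ p = x * x `^ (p - 1).
    by rewrite -[X in X * _]powRr1// -powRD_gt0//; congr (_ `^ _); ring.
  rewrite mulrCA ler_peMr// -[1 - p]opprB powRN mulrC ler_pdivlMr ?powR_gt0// mul1r.
  by apply: ge0_ler_powR; rewrite ?nnegrE ?subr_ge0 ?(ltW A0) ?(ltW Ax).
have := submean 0 eF ltr01; rewrite expr1n mul1r.
set J := (\int[dA]_z _)%E => hJ.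
have mE (g : plane -> R) : measurable_fun setT g -> measurable_fun setT (EFin \o g).
  by move=> ?; exact/measurable_EFinP.
have J1 : (J <= A%:E * \int[dA]_z (disc 1 0 z)%:E + (A `^ (1 - p))%:E * I p F)%E.
  rewrite /I -(@ge0_integralZl_EFin _ _ _ dA setT measurableT (EFin \o disc 1 0) (fun z _ => disc_ge0 _ _ _ : (0 <= (disc 1 0 z)%:E)%E) (mE _ (measurable_disc _ _)) _ (ltW A0)).
  have i0 z : setT z -> (0 <= (modc (F (C_of z)) `^ p * disc 1 0 z)%:E)%E.
    by move=> _; rewrite lee_fin mulr_ge0 ?powR_ge0 ?disc_ge0.
  rewrite -(@ge0_integralZl_EFin _ _ _ dA setT measurableT (EFin \o (fun z => modc (F (C_of z)) `^ p * disc 1 0 z)) i0 (mE _ (measurable_I p eF)) _ (ltW Ap)).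
  have m1 : measurable_fun setT (fun z : plane => A * disc 1 0 z).
    by apply: measurable_funM => //; exact: measurable_disc.
  have m2 : measurable_fun setT (fun z : plane => A `^ (1 - p) * (modc (F (C_of z)) `^ p * disc 1 0 z)).
    by apply: measurable_funM => //; exact: measurable_I.
  rewrite -(@ge0_integralD _ _ _ dA setT measurableT (EFin \o _) (EFin \o _) _ (mE _ m1) _ (mE _ m2))/=.
  - under [leRHS]eq_integral do rewrite -EFinD.
    apply: ge0_le_dA.
    + by apply: measurable_funM; [exact: measurable_modc_entire|exact: measurable_disc].
    + exact: measurable_funD.
    + by move=> z; rewrite mulr_ge0 ?modc_ge0 ?disc_ge0//= key.
  - by move=> z _; rewrite lee_fin mulr_ge0 ?disc_ge0// ltW.
  - by move=> z _; rewrite lee_fin mulr_ge0 ?(ltW Ap)// mulr_ge0 ?powR_ge0 ?disc_ge0.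
have /andP[_ V2] := integral_disc0 (ltr01 : (0:R) < 1).
have J2 : (J <= A%:E * 4%:E + (A `^ (1 - p))%:E * I p F)%E.
  apply: le_trans J1 _; rewrite leeD2r// lee_pmul2l ?lte_fin//.
  by rewrite expr1n mulr1 in V2.
have : ((modc (F 0))%:E <= 8%:E * (A%:E * 4%:E + (A `^ (1 - p))%:E * I p F))%E.
  by apply: le_trans hJ _; rewrite lee_pmul2l// lte_fin.
rewrite -(fineK If) -!EFinM !lee_fin => h.
have {}h : A <= A `^ (1 - p) * fine (I p F) by rewrite /A in h *; lra.
have : A `^ p <= fine (I p F).
  have -> : A `^ p = A / A `^ (1 - p).
    rewrite -[X in X / _](powRr1 (ltW A0)) -powRN -powRD_gt0//; congr (_ `^ _); ring.
  by rewrite ler_pdivrMr// mulrC.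
have -> : modc (F 0) = 64 * A by rewrite /A; field.
by rewrite powRM ?(ltW A0)// => h1; rewrite ler_pM2l ?powR_gt0.
Qed.

(* For p < 1 write |F| = |F|^p |F|^(1 - p) and absorb the last factor: the
   supremum of |F z| (1 - |z|)^(2 / p) over the unit disc is finite. *)
Lemma local_estimate_lt1 p F : 0 < p < 1 -> entire F ->
  ((modc (F 0) `^ p)%:E <= (8 * 2 `^ (2 / p))%:E * I p F)%E.
Proof.
move=> /andP[p0 p1] eF.
have c0 : 0 < 8 * 2 `^ (2 / p) :> R by rewrite mulr_gt0// powR_gt0.
have [Ioo|Ioo] := eqVneq (I p F) +oo%E.
  by rewrite Ioo gt0_muley ?leey.
have If : I p F \is a fin_num by rewrite ge0_fin_numE ?ltey.
set b := 2 / p; have b0 : 0 < b by rewrite divr_gt0.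
have [M M0 hM] := entire_bounded_disc 1 eF.
pose S := [set x | exists2 w, modc w < 1 & x = modc (F w) * (1 - modc w) `^ b].
have S0 : S (modc (F 0)) by exists 0; rewrite ?modc0 ?ltr01// subr0 powR1 mulr1.
have ubS : has_ubound S.
  exists M => _ [w w1 ->]; have := hM w (ltW w1).
  have : (1 - modc w) `^ b <= 1 `^ b.
    have w0 := modc_ge0 w.
    by apply: ge0_ler_powR; rewrite ?nnegrE ?(ltW b0)//; lra.
  rewrite powR1; have := modc_ge0 (F w); have := powR_ge0 (1 - modc w) b; nra.
set N := sup S.
have FN : modc (F 0) <= N by exact: ub_le_sup.
have N0 : 0 <= N by exact: le_trans (modc_ge0 _) FN.
have [Nz|Nz] := eqVneq N 0.
  have -> : modc (F 0) = 0 by apply/eqP; rewrite eq_le modc_ge0 -Nz FN.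
  by rewrite powR0 ?gt_eqF// mule_ge0// lee_fin ltW.
have Np : 0 < N by rewrite lt_def Nz.
have step w : modc w < 1 ->
    modc (F w) * (1 - modc w) `^ b <= 8 * 2 `^ b * N `^ (1 - p) * fine (I p F).
  move=> w1; set d := (1 - modc w) / 2; have d0 : 0 < d by rewrite divr_gt0// subr_gt0.
  set B := (N * d `^ (- b)) `^ (1 - p).
  have := submean w eF d0.
  have key z : modc (F (C_of z)) * disc d w z <= B * (modc (F (C_of z)) `^ p * disc 1 0 z).
    rewrite {1}/disc; case: (boolP (_ <= d)) => zd; last first.
      by rewrite mulr0 !mulr_ge0 ?powR_ge0 ?disc_ge0.
    have zm : modc (C_of z) <= 1 - d.
      have := modcD (C_of z - w) w; rewrite subrK; rewrite /d in zd *; lra.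
    rewrite mulr1 /disc subr0; have -> : modc (C_of z) <= 1 by lra.
    rewrite mulr1; set x := modc (F _); have x0 : 0 <= x by exact: modc_ge0.
    have xN : x <= N * d `^ (- b).
      rewrite powRN ler_pdivlMr ?powR_gt0//.
      apply: (@le_trans _ _ (x * (1 - modc (C_of z)) `^ b)).
        rewrite ler_wpM2l//; apply: ge0_ler_powR; rewrite ?nnegrE ?(ltW b0) ?(ltW d0)//; lra.
      by apply: ub_le_sup => //; exists (C_of z) => //; lra.
    have [->|xn0] := eqVneq x 0; first by rewrite mulr_ge0 ?powR_ge0.
    have xp : 0 < x by rewrite lt_def xn0.
    have {1}-> : x = x `^ (1 - p) * x `^ p.
      by rewrite -powRD_gt0// subrK powRr1.
    rewrite ler_wpM2r ?powR_ge0//; apply: ge0_ler_powR; rewrite ?nnegrE ?mulr_ge0 ?powR_ge0 ?subr_ge0 ?(ltW p1)//.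
  have J1 : (\int[dA]_z (modc (F (C_of z)) * disc d w z)%:E <= B%:E * I p F)%E.
    rewrite /I -(@ge0_integralZl_EFin _ _ _ dA setT measurableT (EFin \o (fun z => modc (F (C_of z)) `^ p * disc 1 0 z))).
    - apply: ge0_le_dA.
      + by apply: measurable_funM; [exact: measurable_modc_entire|exact: measurable_disc].
      + by apply: measurable_funM => //; exact: measurable_I.
      + by move=> z; rewrite mulr_ge0 ?modc_ge0 ?disc_ge0//= key.
    - by move=> z _; rewrite lee_fin mulr_ge0 ?powR_ge0 ?disc_ge0.
    - by apply/measurable_EFinP; exact: measurable_I.
    - by rewrite powR_ge0.
  move=> /le_trans/(_ (lee_wpmul2l _ J1)) => /(_ (ltac:(by rewrite lee_fin))).
  rewrite -(fineK If) -!EFinM lee_fin => h.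
  have db : d ^+ 2 = d `^ 2 by rewrite -powR_mulrn// (ltW d0).
  have BE : B = N `^ (1 - p) * (d `^ 2 / d `^ b).
    rewrite /B powRM ?powR_ge0// -powRrM -powRN -powRD_gt0//.
    by congr (_ * _ `^ _); rewrite /b; field; rewrite gt_eqF.
  have -> : 1 - modc w = 2 * d by rewrite /d; field.
  rewrite powRM ?(ltW d0)//.
  have dp : 0 < d `^ b by exact: powR_gt0.
  have d2 : 0 < d ^+ 2 by rewrite exprn_gt0.
  have tb : 0 < 2 `^ b :> R by exact: powR_gt0.
  have {}h : modc (F w) * d `^ b <= 8 * N `^ (1 - p) * fine (I p F).
    rewrite -(ler_pM2l d2) mulrA; rewrite -ler_pdivlMr//; apply: le_trans h _.
    rewrite BE -db le_eqVlt; apply/orP; left; apply/eqP; field; rewrite gt_eqF//.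
  have : 2 `^ b * (modc (F w) * d `^ b) <= 2 `^ b * (8 * N `^ (1 - p) * fine (I p F)).
    by rewrite ler_pM2l.
  by lra.
have : N <= 8 * 2 `^ b * N `^ (1 - p) * fine (I p F).
  by apply: ge_sup; [exists (modc (F 0))|move=> _ [w w1 ->]; exact: step].
move=> hN; have {}hN : N `^ p <= 8 * 2 `^ b * fine (I p F).
  have Nq : 0 < N `^ (1 - p) by exact: powR_gt0.
  rewrite -(ler_pM2l Nq) -powRD_gt0// subrK powRr1//.
  by move: hN; lra.
rewrite -(fineK If) -EFinM lee_fin; apply: le_trans hN.
by apply: ge0_ler_powR; rewrite ?nnegrE ?modc_ge0 ?(ltW p0).
Qed.

End Pointwise.

Section Weighted.
Variable R : realType.
Local Notation C := R[i].
Local Notation mR := (measurableTypeR R).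
Local Notation plane := (mR * mR)%type.
Local Notation dA := (@dA R).
Implicit Types (f F : C -> C).

Definition wmod (al : R) f (z : C) : R := modc (f z) * expR (- (al * modc z ^+ 2)).

Lemma wmod_ge0 al f z : 0 <= wmod al f z.
Proof. by rewrite mulr_ge0 ?modc_ge0 ?expR_ge0. Qed.

Lemma measurable_wmod al f : entire f ->
  measurable_fun setT (fun z : plane => wmod al f (C_of z)).
Proof.
move=> ef; apply: measurable_funM; first exact: measurable_modc_entire.
apply: (measurableT_comp (@measurable_expR R)); apply: measurable_funN.
apply: measurable_funM => //; apply: measurable_funX.
by apply: measC_modc; exact: measC_id.
Qed.

Lemma modcD_sqr (z w : C) :
  modc (z + w) ^+ 2 = modc z ^+ 2 + 2 * complex.Re (w^* * z) + modc w ^+ 2.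
Proof. by rewrite !modc_sqrE; case: z w => a b [c d] /=; ring. Qed.

(* Multiplying the translate by an exponential makes the weight at [a] centred
   at 0, see [modc_recenter]. *)
Definition recenter al (a : C) f (w : C) : C :=
  f (w + a) * expc (- (2 * al)%:C * a^* * w + (- (al * modc a ^+ 2))%:C).

Lemma entire_recenter al a f : entire f -> entire (recenter al a f).
Proof.
move=> ef; apply: entireM.
  by apply: (entire_comp ef); apply: entireD; [exact: entire_id|exact: entire_cst].
apply: (entire_comp (@entire_expc R)); apply: entireD; last exact: entire_cst.
by apply: entireM; [exact: entire_cst|exact: entire_id].
Qed.

Lemma modc_recenter al a f w :
  modc (recenter al a f w) = wmod al f (w + a) * expR (al * modc w ^+ 2).
Proof.
rewrite /recenter /wmod modcM modc_expc -[RHS]mulrA -expRD; congr (_ * expR _).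
rewrite modcD_sqr; case: a w => a b [c d] /=; ring.
Qed.

Lemma modc_recenter0 al a f : modc (recenter al a f 0) = wmod al f a.
Proof. by rewrite modc_recenter add0r modc0 expr0n mulr0 expR0 mulr1. Qed.

(** The local estimate is applied to [recenter al a f]; on the unit disc the factor [exp (al |w|^2)]
    is at most [expR al], whence a constant independent of [a]. *)
Lemma weighted_estimate (p al : R) : 0 < p -> 0 <= al ->
  exists2 K : R, 0 < K & forall f a, entire f ->
  ((wmod al f a `^ p)%:E <= K%:E * \int[dA]_z (wmod al f (C_of z) `^ p)%:E)%E.
Proof.
move=> p0 al0.
have [K0 K00 hK] : exists2 K : R, 0 < K & forall F, entire F -> ((modc (F 0) `^ p)%:E <=
    K%:E * \int[dA]_z (modc (F (C_of z)) `^ p * disc 1 0 z)%:E)%E.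
  have [p1|p1] := leP 1 p.
    by exists (64 `^ p); [rewrite powR_gt0|move=> F eF; exact: local_estimate_ge1].
  exists (8 * 2 `^ (2 / p)); first by rewrite mulr_gt0// powR_gt0.
  by move=> F eF; apply: local_estimate_lt1; rewrite ?p0.
exists (K0 * expR al `^ p); first by rewrite mulr_gt0// powR_gt0// expR_gt0.
move=> f a ef; have := hK _ (@entire_recenter al a f ef).
rewrite modc_recenter0 => /le_trans; apply.
rewrite EFinM -muleA lee_pmul2l ?lte_fin//.
have mW : measurable_fun setT (fun z : plane => wmod al f (C_of z) `^ p).
  by apply: (measurableT_comp (measurable_powR _)); exact: measurable_wmod.
rewrite -(@dA_shiftC _ (fun z => wmod al f (C_of z) `^ p) a mW (fun z => powR_ge0 _ _)).
have mW' : measurable_fun setT (fun z : plane => wmod al f (C_of (z.1 + complex.Re a, z.2 + complex.Im a)) `^ p).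
  exact: (measurableT_comp mW (dA_preserving_shift (complex.Re a) (complex.Im a)).1).
rewrite -(@ge0_integralZl_EFin _ _ _ dA setT measurableT (fun z => (wmod al f (C_of (z.1 + complex.Re a, z.2 + complex.Im a)) `^ p)%:E)).
- apply: ge0_le_dA.
  + apply: measurable_funM; last exact: measurable_disc.
    apply: (measurableT_comp (measurable_powR _)); apply: measurable_modc_entire.
    exact: entire_recenter.
  + exact: measurable_funM.
  + move=> z; rewrite mulr_ge0 ?powR_ge0 ?disc_ge0//= C_of_shift.
    rewrite /disc subr0; case: (boolP (modc (C_of z) <= 1)) => z1; last first.
      by rewrite mulr0 mulr_ge0 ?powR_ge0.
    rewrite mulr1 -powRM ?expR_ge0 ?wmod_ge0//; apply: ge0_ler_powR; rewrite ?nnegrE ?modc_ge0 ?(ltW p0)//.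
      by rewrite mulr_ge0 ?expR_ge0 ?wmod_ge0.
    rewrite modc_recenter mulrC ler_wpM2r ?wmod_ge0// ler_expR.
    by rewrite ler_piMr// exprn_ile1 ?modc_ge0.
- by move=> z _; rewrite lee_fin powR_ge0.
- exact/measurable_EFinP.
- exact: powR_ge0.
Qed.

End Weighted.

(** * Membership, norms and pointwise bounds in Fock spaces *)

Section FockSpaces.
Variable R : realType.
Local Notation C := R[i].
Local Notation mR := (measurableTypeR R).
Local Notation plane := (mR * mR)%type.
Local Notation dA := (@dA R).
Local Notation wt := (@wmod R 2^-1).
Implicit Types (f F : C -> C) (p : \bar R) (r : R).

Lemma wtE f z : modc (f z) * expR (- modc z ^+ 2 / 2) = wt f z.
Proof. by rewrite /wmod; congr (_ * expR _); ring. Qed.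

Lemma modc_weighted f z : modc (f z * (expR (- modc z ^+ 2 / 2))%:C) = wt f z.
Proof. by rewrite modcM modcR ger0_norm ?expR_ge0// wtE. Qed.

Lemma measC_weighted f : entire f ->
  measC (fun z : plane => f (C_of z) * (expR (- modc (C_of z) ^+ 2 / 2))%:C).
Proof.
move=> ef; apply: measCM; first by apply: (measC_entire ef); exact: measC_id.
apply: measC_real; apply: (measurableT_comp (@measurable_expR R)).
apply: measurable_funM => //; apply: measurable_funN; apply: measurable_funX.
by apply: measC_modc; exact: measC_id.
Qed.

Definition wint r f : \bar R := (\int[dA]_z (wt f (C_of z) `^ r)%:E)%E.

Lemma wint_ge0 r f : (0 <= wint r f)%E.
Proof. by apply: integral_ge0 => z _; rewrite lee_fin powR_ge0. Qed.

Lemma fock_finP r f : 0 < r -> fock r%:E f <-> entire f /\ (wint r f < +oo)%E.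
Proof.
move=> r0.
have E : Lnorm dA r%:E (EFin \o (fun z : plane => modc (f (C_of z) * (expR (- modc (C_of z) ^+ 2 / 2))%:C))) =
    (wint r f `^ r^-1)%E.
  rewrite Lnorm.unlock.
  have E : (fun z : plane => (`|(modc (f (C_of z) * (expR (- modc (C_of z) ^+ 2 / 2))%:C))%:E| `^ r)%E) =
      (fun z => (wt f (C_of z) `^ r)%:E).
    apply/funext => z; rewrite (modc_weighted f (C_of z)).
    by rewrite gee0_abs ?poweR_EFin// lee_fin wmod_ge0.
  exact: (congr1 (fun h => ((\int[dA]_z h z) `^ r^-1)%E) E).
rewrite /fock /memLp /finite_norm E; split=> [[ef [_ _]]|[ef fin]].
  by move/lty_poweRy => -> //; rewrite invr_neq0// gt_eqF.
split => //; have [m1 m2] := measC_weighted ef; split => //.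
exact: poweR_lty.
Qed.

Lemma fock_norm_fin r f : fock_norm r%:E f = (((r / (2 * pi))%:E * wint r f) `^ r^-1)%E.
Proof.
have E : (fun z : plane => ((modc (f (C_of z)) * expR (- modc (C_of z) ^+ 2 / 2)) `^ r)%:E) =
    (fun z => (wt f (C_of z) `^ r)%:E).
  by apply/funext => z; rewrite (wtE f (C_of z)).
exact: (congr1 (fun h => (((r / (2 * pi))%:E * \int[dA]_z h z) `^ r^-1)%E) E).
Qed.

Lemma fock_norm_oo f : fock_norm +oo%E f = ereal_sup [set (wt f z)%:E | z in [set: C]].
Proof. by rewrite /fock_norm; congr ereal_sup; apply: eq_imagel => z _; rewrite (wtE f z). Qed.

Lemma fock_entire p f : fock p f -> entire f.
Proof. by case. Qed.

(** [Lnorm] at [+oo] is the essential supremum on condition that the whole space has positive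
    measure. *)
Lemma dA_setT_gt0 : (0 < dA setT)%E.
Proof.
rewrite (@lt_le_trans _ _ (\int[dA]_z (disc 1 0 z)%:E)%E)//.
  by have /andP[+ _] := integral_disc0 (ltr01 : (0:R) < 1); apply: lt_le_trans; rewrite lte_fin; lra.
rewrite -[leRHS]mul1e -(integral_cst dA measurableT).
apply: (@ge0_le_dA _ (disc 1 0) (fun=> 1)) => //; first exact: measurable_disc.
by move=> z; rewrite disc_ge0 /disc lern1 leq_b1.
Qed.

(** Membership is defined by an essential supremum; [submean], applied to the recentred function,
    turns an almost everywhere bound into an everywhere bound. *)
Lemma fock_ooP f : fock +oo%E f <-> entire f /\ exists M : R, forall z, wt f z <= M.
Proof.
have E : Lnorm dA +oo%E (EFin \o (fun z : plane => modc (f (C_of z) * (expR (- modc (C_of z) ^+ 2 / 2))%:C))) =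
    ess_sup dA (fun z => (wt f (C_of z))%:E).
  rewrite Lnorm.unlock dA_setT_gt0; congr ess_sup; apply/funext => z.
  rewrite [LHS]/= (modc_weighted f (C_of z)) ger0_norm//; exact: wmod_ge0.
rewrite /fock /memLp /finite_norm E; split=> [[ef [_ _ fin]]|[ef [M hM]]]; last first.
  split => //; have [m1 m2] := measC_weighted ef; split => //.
  apply: le_lt_trans (ltry M); apply/ess_supP/nearW => z; by rewrite lee_fin.
split => //.
have [M hM] : exists M : R, \forall z \ae dA, ((wt f (C_of z))%:E <= M%:E)%E.
  move: fin; case: (ess_sup _ _) (ess_sup_ge dA (fun z => (wt f (C_of z))%:E)) => [M hM _|//|hM _].
    by exists M.
  by exists 0; apply: filterS hM => z /le_trans; apply; rewrite leNye.
(* 8 comes from [submean], [expR 2^-1] from recentring on the unit disc, and 4 from the area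
   bound. *)
exists (8 * (expR 2^-1 * `|M| * 4)) => a.
have eF := @entire_recenter R 2^-1 a f ef.
have := submean 0 eF ltr01; rewrite expr1n mul1r modc_recenter0.
have mW : measurable_fun setT (fun z : plane => modc (recenter 2^-1 a f (C_of z)) * disc 1 0 z).
  by apply: measurable_funM; [exact: measurable_modc_entire|exact: measurable_disc].
set J := (\int[dA]_z _)%E => hJ.
pose T (z : plane) : plane := (z.1 + complex.Re (- a), z.2 + complex.Im (- a)).
have [mT hT] : dA_preserving T by exact: dA_preserving_shift.
have CT z : C_of (T z) = C_of z - a by rewrite -C_of_shift.
have J1 : (J = \int[dA]_z (modc (recenter 2^-1 a f (C_of z - a)) * disc 1 a z)%:E)%E.
  rewrite /J -(hT (fun z => (modc (recenter 2^-1 a f (C_of z)) * disc 1 0 z)%:E)).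
  - by apply: eq_integral => z _; rewrite CT /disc subr0 CT.
  - exact/measurable_EFinP.
  - by move=> z; rewrite lee_fin mulr_ge0 ?modc_ge0 ?disc_ge0.
have md : measurable_fun setT (fun z : plane => expR 2^-1 * `|M| * disc 1 a z).
  by apply: measurable_funM => //; exact: measurable_disc.
have c0 : 0 <= expR 2^-1 * `|M| by rewrite mulr_ge0 ?expR_ge0.
have J2 : (J <= \int[dA]_z (expR 2^-1 * `|M| * disc 1 a z)%:E)%E.
  rewrite J1; apply: (@ae_ge0_le_integral _ _ _ dA setT measurableT).
  - by move=> z _; rewrite lee_fin mulr_ge0 ?modc_ge0 ?disc_ge0.
  - apply/measurable_EFinP; have := measurableT_comp mW mT.
    by congr measurable_fun; apply/funext => z /=; rewrite CT /disc subr0 CT.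
  - by move=> z _; rewrite lee_fin mulr_ge0 ?disc_ge0.
  - exact/measurable_EFinP.
  - move: hM; apply: (@filterS _ _ (ae_filter_ringOfSetsType dA)) => z; rewrite !lee_fin => hz _.
    rewrite /disc; case: (boolP (modc (C_of z - a) <= 1)) => z1; last by rewrite !mulr0.
    rewrite !mulr1 modc_recenter subrK mulrC; apply: ler_pM; rewrite ?expR_ge0 ?wmod_ge0//.
      by rewrite ler_expR ler_piMr// exprn_ile1 ?modc_ge0.
    exact: le_trans hz (ler_norm _).
have J3 : (\int[dA]_z (expR 2^-1 * `|M| * disc 1 a z)%:E <= (expR 2^-1 * `|M| * 4)%:E)%E.
  rewrite (eq_integral (fun z => (expR 2^-1 * `|M|)%:E * (disc 1 a z)%:E)%E)//.
  rewrite (@ge0_integralZl_EFin _ _ _ dA setT measurableT (EFin \o disc 1 a))//; last 2 first.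
  - by move=> z _; rewrite lee_fin disc_ge0.
  - by apply/measurable_EFinP; exact: measurable_disc.
  rewrite [leRHS]EFinM; apply: lee_wpmul2l; first by rewrite lee_fin.
  have /andP[_] := integral_disc0 (ltr01 : (0:R) < 1); rewrite expr1n mulr1; apply: le_trans.
  rewrite le_eqVlt; apply/orP; left; apply/eqP.
  rewrite -(hT (fun z => (disc 1 0 z)%:E)).
  - by apply: eq_integral => z _; rewrite /disc CT subr0.
  - by apply/measurable_EFinP; exact: measurable_disc.
  - by move=> z; rewrite lee_fin disc_ge0.
rewrite -lee_fin [leRHS]EFinM; apply: le_trans hJ _.
by rewrite lee_pmul2l ?lte_fin// (le_trans J2).
Qed.

Lemma fock_norm_ge0 p f : (0 < p)%E -> (0 <= fock_norm p f)%E.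
Proof.
case: p => [r _|_|//]; first by rewrite fock_norm_fin poweR_ge0.
rewrite fock_norm_oo; apply: le_trans (_ : (wt f 0)%:E <= _)%E.
  by rewrite lee_fin wmod_ge0.
by apply: ereal_sup_ubound; exists 0.
Qed.

Lemma fock_norm_lty p f : (0 < p)%E -> fock p f -> (fock_norm p f < +oo)%E.
Proof.
case: p => [r|_|//].
  rewrite lte_fin => r0 /(fock_finP f r0)[ef fin].
  rewrite fock_norm_fin; apply: poweR_lty.
  by rewrite lte_mul_pinfty// lee_fin divr_ge0 ?mulr_ge0 ?pi_ge0 ?ltW.
move/fock_ooP => [ef [M hM]]; rewrite fock_norm_oo; apply: le_lt_trans (ltry M).
by apply: ge_ereal_sup => _ [z _ <-]; rewrite lee_fin.
Qed.

(** For finite p this is [weighted_estimate] with the weight of the Fock norm, after dividing out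
    the normalization and taking roots; it embeds each [F^p] in [F^oo]. *)
Lemma fock_pointwise p : (0 < p)%E -> exists2 K : R, 0 < K &
  forall f, entire f -> forall z, ((wt f z)%:E <= K%:E * fock_norm p f)%E.
Proof.
case: p => [r|_|//]; last first.
  exists 1 => // f ef z; rewrite mul1e fock_norm_oo.
  by apply: ereal_sup_ubound; exists z.
rewrite lte_fin => r0.
have [K0 K00 hK] := weighted_estimate r0 (ltac:(by rewrite invr_ge0) : 0 <= 2^-1).
have q0 : 0 < r / (2 * pi) :> R by rewrite divr_gt0// mulr_gt0// pi_gt0.
exists ((K0 / (r / (2 * pi))) `^ r^-1); first by rewrite powR_gt0// divr_gt0.
move=> f ef z; rewrite fock_norm_fin -poweR_EFin -poweRM; last 2 first.
- by rewrite lee_fin divr_ge0// ltW.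
- by rewrite mule_ge0// ?wint_ge0// lee_fin ltW.
rewrite muleA -EFinM divfK ?gt_eqF//.
have -> : (wt f z)%:E = ((wt f z `^ r)%:E `^ r^-1)%E.
  by rewrite poweR_EFin -powRrM divff ?gt_eqF// powRr1// wmod_ge0.
apply: gt0_ler_poweR; rewrite ?invr_ge0 ?(ltW r0)//.
- by rewrite in_itv/= lee_fin powR_ge0 leey.
- by rewrite in_itv/= mule_ge0 ?leey ?wint_ge0// lee_fin ltW.
- exact: hK.
Qed.

Lemma fock_bounded p f : (0 < p)%E -> fock p f -> exists M : R, forall z, wt f z <= M.
Proof.
move=> p0 Ff; have [K K0 hK] := fock_pointwise p0.
have nf : fock_norm p f \is a fin_num.
  by rewrite ge0_fin_numE ?fock_norm_ge0// fock_norm_lty.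
exists (K * fine (fock_norm p f)) => z; rewrite -lee_fin [leRHS]EFinM fineK//.
by apply: hK; exact: fock_entire Ff.
Qed.

End FockSpaces.

(** * Complex-valued integrals and differentiation under the integral sign *)

Section ComplexIntegral.
Variable R : realType.
Local Notation C := R[i].
Local Notation mR := (measurableTypeR R).
Local Notation plane := (mR * mR)%type.
Local Notation dA := (@dA R).
Implicit Types (f g h : C -> C).

Definition integrableC g := measC (fun z : plane => g (C_of z)) /\
  (\int[dA]_z (modc (g (C_of z)))%:E < +oo)%E.

Lemma le_integrableC g (h : plane -> R) : measC (fun z : plane => g (C_of z)) ->
  measurable_fun setT h -> (forall z, modc (g (C_of z)) <= h z) ->
  (\int[dA]_z (h z)%:E < +oo)%E -> integrableC g.
Proof.
move=> mg mh gh hfin; split => //; apply: le_lt_trans hfin.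
apply: (ge0_le_dA (measC_modc mg) mh) => z.
by rewrite modc_ge0 gh.
Qed.

Lemma integrableC_Re g : integrableC g ->
  dA.-integrable setT (fun z => (complex.Re (g (C_of z)))%:E).
Proof.
move=> [mg gfin]; apply: (le_integrable_dA mg.1 (measC_modc mg) _ gfin) => z.
exact: ler_Re_modc.
Qed.

Lemma integrableC_Im g : integrableC g ->
  dA.-integrable setT (fun z => (complex.Im (g (C_of z)))%:E).
Proof.
move=> [mg gfin]; apply: (le_integrable_dA mg.2 (measC_modc mg) _ gfin) => z.
exact: ler_Im_modc.
Qed.

Lemma integralCD g h : integrableC g -> integrableC h ->
  integralC (fun z => g z + h z) = integralC g + integralC h.
Proof.
move=> ig ih; rewrite /integralC; apply/eqP; rewrite eq_complex /=; apply/andP; split; apply/eqP.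
  rewrite -(@RintegralD _ _ _ dA setT (fun z => complex.Re (g (C_of z))) (fun z => complex.Re (h (C_of z))) measurableT (integrableC_Re ig) (integrableC_Re ih)).
  by apply: eq_Rintegral => z _; case: (g _) (h _) => ? ? [].
rewrite -(@RintegralD _ _ _ dA setT (fun z => complex.Im (g (C_of z))) (fun z => complex.Im (h (C_of z))) measurableT (integrableC_Im ig) (integrableC_Im ih)).
by apply: eq_Rintegral => z _; case: (g _) (h _) => ? ? [].
Qed.

Lemma integrableCD g h : integrableC g -> integrableC h ->
  integrableC (fun z => g z + h z).
Proof.
move=> [mg gfin] [mh hfin].
apply: (@le_integrableC _ (fun z => modc (g (C_of z)) + modc (h (C_of z)))).
- exact: measCD.
- by apply: measurable_funD; exact: measC_modc.
- by move=> z; exact: modcD.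
- under eq_integral do rewrite EFinD.
  rewrite (@ge0_integralD _ _ _ dA setT measurableT (fun z => (modc (g (C_of z)))%:E) (fun z => (modc (h (C_of z)))%:E)).
  + exact: lte_add_pinfty.
  + by move=> z _; rewrite lee_fin modc_ge0.
  + by apply/measurable_EFinP; exact: measC_modc.
  + by move=> z _; rewrite lee_fin modc_ge0.
  + by apply/measurable_EFinP; exact: measC_modc.
Qed.

Lemma integrableCZ (c : C) g : integrableC g -> integrableC (fun z => c * g z).
Proof.
move=> [mg gfin]; split; first by apply: measCM => //; exact: measC_cst.
under eq_integral do rewrite modcM EFinM.
rewrite (@ge0_integralZl_EFin _ _ _ dA setT measurableT (fun z => (modc (g (C_of z)))%:E)).
- by rewrite lte_mul_pinfty// lee_fin modc_ge0.
- by move=> z _; rewrite lee_fin modc_ge0.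
- by apply/measurable_EFinP; exact: measC_modc.
- exact: modc_ge0.
Qed.

Lemma integralCZ (c : C) g : integrableC g ->
  integralC (fun z => c * g z) = c * integralC g.
Proof.
move=> ig; have iR := integrableC_Re ig; have iI := integrableC_Im ig.
have EZ (a : R) (u : plane -> R) : dA.-integrable setT (EFin \o u) ->
    \int[dA]_z (a * u z) = a * \int[dA]_z u z.
  by move=> iu; rewrite (@RintegralZl _ _ _ dA setT u a measurableT iu).
have IZ (a : R) (u : plane -> R) : dA.-integrable setT (EFin \o u) ->
    dA.-integrable setT (EFin \o (fun z => a * u z)).
  by move=> iu; exact: (@integrableZl _ _ _ dA setT measurableT a (EFin \o u) iu).
case: c => a b; rewrite /integralC; apply/eqP; rewrite eq_complex /=.
apply/andP; split; apply/eqP.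
  transitivity (\int[dA]_z (a * complex.Re (g (C_of z))) - \int[dA]_z (b * complex.Im (g (C_of z)))).
    rewrite -(@RintegralB _ _ _ dA setT _ _ measurableT (IZ a _ iR) (IZ b _ iI)).
    by apply: eq_Rintegral => z _; case: (g _).
  by rewrite (EZ a _ iR) (EZ b _ iI).
transitivity (\int[dA]_z (a * complex.Im (g (C_of z))) + \int[dA]_z (b * complex.Re (g (C_of z)))).
  rewrite -(@RintegralD _ _ _ dA setT _ _ measurableT (IZ a _ iI) (IZ b _ iR)).
  by apply: eq_Rintegral => z _; case: (g _).
by rewrite (EZ a _ iI) (EZ b _ iR).
Qed.

(** The factor 2 comes from bounding the real and imaginary parts separately. *)
Lemma modc_integralC_le g : integrableC g ->
  ((modc (integralC g))%:E <= 2%:E * \int[dA]_z (modc (g (C_of z)))%:E)%E.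
Proof.
move=> ig; have [mg gfin] := ig.
have b (u : plane -> R) : measurable_fun setT u -> (forall z, `|u z| <= modc (g (C_of z))) ->
   ((`|\int[dA]_z u z|)%:E <= \int[dA]_z (modc (g (C_of z)))%:E)%E.
  move=> mu hu; have iu := le_integrable_dA mu (measC_modc mg) hu gfin.
  rewrite (@EFin_normr_Rintegral _ _ _ dA setT u measurableT iu).
  apply: le_trans (le_abse_integral dA measurableT _) _; first exact/measurable_EFinP.
  apply: (@ge0_le_dA _ (fun z => `|u z|)) => //.
  - exact: (measurableT_comp (@normr_measurable R setT) mu).
  - exact: measC_modc.
  - by move=> z; rewrite normr_ge0 hu.
have b1 := b _ mg.1 (fun z => ler_Re_modc _).
have b2 := b _ mg.2 (fun z => ler_Im_modc _).
set I := (\int[dA]_z _)%E in b1 b2 *.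
have -> : (2%:E * I = I + I)%E by rewrite mule_natl mule2n.
apply: le_trans (leeD b1 b2); rewrite -EFinD lee_fin.
exact: modc_ler_ReIm.
Qed.

(** By [expc_taylor1] the remainder of the difference is [modc h ^+ 2] times an integrable function.
    Integrability is assumed for every [c] because z is arbitrary and the derivative and remainder
    need rates beyond [modc z]. *)
Lemma entire_integralC_exp (u phi : C -> C) :
  measC (fun z : plane => u (C_of z)) -> measC (fun z : plane => phi (C_of z)) ->
  (forall c : R, (\int[dA]_z (expR (c * modc (u (C_of z))) * modc (phi (C_of z)))%:E < +oo)%E) ->
  entire (fun z => integralC (fun w => expc (z * u w) * phi w)).
Proof.
move=> mu mphi fin.
have mU c : measurable_fun setT (fun z : plane => expR (c * modc (u (C_of z))) * modc (phi (C_of z))).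
  apply: measurable_funM; last exact: measC_modc.
  apply: (measurableT_comp (@measurable_expR R)); apply: measurable_funM => //.
  exact: measC_modc.
have mE z : measC (fun w : plane => expc (z * u (C_of w)) * phi (C_of w)).
  apply: measCM => //; apply: (measC_entire (@entire_expc R)).
  by apply: measCM => //; exact: measC_cst.
have eb z w : modc (expc (z * u w)) <= expR (modc z * modc (u w)).
  by rewrite modc_expc ler_expR -modcM (le_trans (ler_norm _))// ler_Re_modc.
have i0 z : integrableC (fun w => expc (z * u w) * phi w).
  apply: (le_integrableC (mE z) (mU (modc z)) _ (fin _)) => w.
  by rewrite modcM ler_wpM2r ?modc_ge0.
have i1 z : integrableC (fun w => u w * (expc (z * u w) * phi w)).
  apply: (le_integrableC _ (mU (modc z + 1)) _ (fin _)); first exact: measCM.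
  move=> w; rewrite mulrDl mul1r expRD [X in _ <= X * _]mulrC modcM
    [modc (_ * phi _)]modcM -[leRHS]mulrA.
  apply: ler_pM; rewrite ?modc_ge0 ?mulr_ge0 ?modc_ge0//.
    by apply: le_trans _ (expR_ge1Dx _); rewrite lerDr.
  by apply: ler_wpM2r; [exact: modc_ge0|exact: eb].
apply/entireP => z; exists (integralC (fun w => u w * (expc (z * u w) * phi w))) => e e0.
(* In the rate [modc z + 3], two units absorb a square through [x ^+ 2 <= expR (2 * x)], and one
   absorbs [expR (modc h * x)] for [modc h < 1]. *)
set B := fine (\int[dA]_w (expR ((modc z + 3) * modc (u (C_of w))) * modc (phi (C_of w)))%:E)%E.
have B0 : 0 <= B.
  by rewrite fine_ge0// integral_ge0// => w _; rewrite lee_fin mulr_ge0 ?expR_ge0 ?modc_ge0.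
have B1 : 0 < 8 * B + 1 by rewrite ltr_wpDl// mulr_ge0.
exists (Num.min 1 (e / (8 * B + 1))); first by rewrite lt_min ltr01 divr_gt0.
move=> h; rewrite lt_min => /andP[h1]; rewrite ltr_pdivlMr// => he.
have iN c g : integrableC g -> integralC (fun w => - (c * g w)) = - (c * integralC g).
  move=> ig; rewrite -mulNr -integralCZ//; congr integralC; apply/funext => w.
  by rewrite mulNr.
have -> : integralC (fun w => expc ((z + h) * u w) * phi w)
    - integralC (fun w => expc (z * u w) * phi w)
    - integralC (fun w => u w * (expc (z * u w) * phi w)) * h =
  integralC (fun w => expc (z * u w) * (expc (h * u w) - 1 - h * u w) * phi w).
  have E1 : - integralC (fun w => expc (z * u w) * phi w) = integralC (fun w => -1 * (expc (z * u w) * phi w)).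
    by rewrite integralCZ// mulN1r.
  have E2 : - (integralC (fun w => u w * (expc (z * u w) * phi w)) * h) =
      integralC (fun w => - h * (u w * (expc (z * u w) * phi w))).
    by rewrite integralCZ// mulNr mulrC.
  have j2 := integrableCZ (-1) (i0 z); have j3 := integrableCZ (- h) (i1 z).
  rewrite E1 E2 -(integralCD (i0 _) j2) -(integralCD (integrableCD (i0 _) j2) j3).
  congr integralC; apply/funext => w; rewrite mulrDl expcD.
  move: (expc (z * u w)) (expc (h * u w)) => a b; ring.
have bound w : modc (expc (z * u w) * (expc (h * u w) - 1 - h * u w) * phi w) <=
    4 * modc h ^+ 2 * (expR ((modc z + 3) * modc (u w)) * modc (phi w)).
  rewrite modcM [modc (expc _ * _)]modcM [leRHS]mulrA ler_wpM2r ?modc_ge0//.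
  apply: le_trans (ler_pM (modc_ge0 _) (modc_ge0 _) (eb z w) (expc_taylor1 _)) _.
  rewrite modcM; set x := modc (u w); have x0 : 0 <= x by exact: modc_ge0.
  have n0 := modc_ge0 h.
  have x1 : x ^+ 2 <= expR (2 * x).
    rewrite mulr2n mulrDl mul1r expRD expr2; have : x <= expR x by apply: le_trans _ (expR_ge1Dx _); rewrite lerDr.
    by move=> xe; exact: ler_pM.
  have x2 : expR (modc h * x) <= expR x by rewrite ler_expR ler_piMl// ltW.
  rewrite (_ : (modc z + 3) * x = modc z * x + (2 * x + x)); last by ring.
  rewrite !expRD [leRHS]mulrCA ler_wpM2l ?expR_ge0// exprMn.
  rewrite (_ : 4 * (modc h ^+ 2 * x ^+ 2) * _ = 4 * modc h ^+ 2 * (x ^+ 2 * expR (modc h * x))); last by ring.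
  rewrite ler_wpM2l ?mulr_ge0 ?sqr_ge0//.
  by apply: ler_pM => //; rewrite ?sqr_ge0 ?expR_ge0.
have mB : measurable_fun setT (fun w : plane => 4 * modc h ^+ 2 * (expR ((modc z + 3) * modc (u (C_of w))) * modc (phi (C_of w)))).
  by apply: measurable_funM => //; exact: mU.
have mR : measC (fun w : plane => expc (z * u (C_of w)) * (expc (h * u (C_of w)) - 1 - h * u (C_of w)) * phi (C_of w)).
  have me c : measC (fun w : plane => expc (c * u (C_of w))).
    by apply: (measC_entire (@entire_expc R)); apply: measCM => //; exact: measC_cst.
  apply: measCM => //; apply: measCM => //; apply: measCD.
    by apply: measCD => //; exact: measC_cst.
  by apply: measCN; apply: measCM => //; exact: measC_cst.
have iB : (\int[dA]_w (4 * modc h ^+ 2 * (expR ((modc z + 3) * modc (u (C_of w))) * modc (phi (C_of w))))%:E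
    = (4 * modc h ^+ 2)%:E * B%:E)%E.
  rewrite /B fineK; last first.
    rewrite ge0_fin_numE// integral_ge0// => w _.
    by rewrite lee_fin mulr_ge0 ?expR_ge0 ?modc_ge0.
  rewrite -(@ge0_integralZl_EFin _ _ _ dA setT measurableT (fun w => (expR ((modc z + 3) * modc (u (C_of w))) * modc (phi (C_of w)))%:E))//.
  - by move=> w _; rewrite lee_fin mulr_ge0 ?expR_ge0 ?modc_ge0.
  - by apply/measurable_EFinP; exact: mU.
  - by rewrite mulr_ge0// sqr_ge0.
have iR : integrableC (fun w => expc (z * u w) * (expc (h * u w) - 1 - h * u w) * phi w).
  apply: (le_integrableC mR mB (fun w => bound _)); by rewrite iB -EFinM ltry.
rewrite -lee_fin; apply: le_trans (modc_integralC_le iR) _.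
apply: (@le_trans _ _ (2%:E * ((4 * modc h ^+ 2)%:E * B%:E))%E).
  rewrite lee_pmul2l ?lte_fin// -iB.
  apply: (ge0_le_dA (measC_modc mR) mB) => w; by rewrite modc_ge0 bound.
rewrite -!EFinM lee_fin; have n0 := modc_ge0 h.
have : modc h * (modc h * (8 * B + 1)) <= modc h * e by rewrite ler_wpM2l// ltW.
rewrite expr2; have : 0 <= modc h * modc h by rewrite mulr_ge0.
lra.
Qed.

End ComplexIntegral.

(** * The kernel *)

Section Kernel.
Variable R : realType.
Local Notation C := R[i].
Variables s t : C.
Implicit Types z w : C.

Definition knum z w : C := t * z ^+ 2 - (t * w ^+ 2)^* + 2 * z * w^*.

Definition kexp z w : C := knum z w / (2 * s).

(* |K| with both weights absorbed, up to the factor |sqrt s|^-1. *)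
Definition wker z w : R := expR (complex.Re (kexp z w) - modc z ^+ 2 / 2 - modc w ^+ 2 / 2).

Lemma wker_ge0 z w : 0 <= wker z w. Proof. exact: expR_ge0. Qed.

Local Notation n := (modc s).
Local Notation m := (Num.sqrt (modc t ^+ 2 + 1)).

Definition Qform z w : R := modc z ^+ 2 + modc w ^+ 2 - 2 * complex.Re (kexp z w).

Lemma wkerE z w : wker z w = expR (- (Qform z w / 2)).
Proof. by rewrite /wker /Qform; congr expR; field. Qed.

Lemma Re_divc (x y : C) : y != 0 ->
  complex.Re (x / y) = complex.Re (x * y^*) / modc y ^+ 2.
Proof.
move=> y0; have ny : modc y ^+ 2 != 0 by rewrite expf_neq0// modc_eq0.
move: ny; rewrite modc_sqrE; case: x y {y0} => a b [c d] /= ny.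
by field.
Qed.

Lemma modc2 : modc (2 : C) = 2.
Proof.
have -> : (2 : C) = (2 : R)%:C by rewrite rmorph_nat.
by rewrite modcR ger0_norm.
Qed.

Hypothesis s0 : s != 0.

Let n0 : 0 < n. Proof. by rewrite modc_gt0. Qed.

Let m0 : 0 < m. Proof. by rewrite sqrtr_gt0 ltr_wpDl// sqr_ge0. Qed.

Lemma m_sqr : m ^+ 2 = modc t ^+ 2 + 1.
Proof. by rewrite sqr_sqrtr// addr_ge0// sqr_ge0. Qed.

Lemma Re_kexp z w : 2 * complex.Re (kexp z w) = complex.Re (knum z w * s^*) / n ^+ 2.
Proof.
have -> : kexp z w = (2^-1)%:C * (knum z w / s).
  by rewrite /kexp invfM mulrCA fmorphV rmorph_nat.
have -> (a : R) (y : C) : complex.Re (a%:C * y) = a * complex.Re y.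
  by case: y => ? ? /=; rewrite mul0r subr0.
by rewrite Re_divc// mulrA divff// mul1r.
Qed.

Let D0 : 0 < 2 * m * n ^+ 2.
Proof. by rewrite !mulr_gt0// exprn_gt0. Qed.

Definition defect1 z w : C := (n * m)%:C * z - s * ((t * z)^* + w).
Definition defect2 z w : C := (n * m)%:C * w - s^* * (z - (t * w)^*).

(** With [v = (z, conj w)] and [M] the matrix of rows [(t, 1)], [(1, - conj t)], the defects are, up
    to conjugating the second, the components of [n m v - s conj (M v)]. Expanding its squared norm
    with [|M v| = m |v|] gives the right-hand side. *)
Lemma defect_identity z w :
  modc (defect1 z w) ^+ 2 + modc (defect2 z w) ^+ 2 =
  2 * m ^+ 2 * n ^+ 2 * (modc z ^+ 2 + modc w ^+ 2)
  - 2 * m * n * complex.Re (knum z w * s^*).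
Proof.
have hn := modc_sqrE s; have hm := etrans m_sqr (congr1 (fun x => x + 1) (modc_sqrE t)).
rewrite /defect1 /defect2 /knum; move: m hm; move: n hn => a + b.
rewrite !modc_sqrE; case: s t z w => s1 s2 [t1 t2] [z1 z2] [w1 w2] /= ha hb.
have key : (s1 ^+ 2 + s2 ^+ 2) * (t1 ^+ 2 + t2 ^+ 2 + 1) - a ^+ 2 * b ^+ 2 = 0.
  by rewrite ha hb subrr.
apply/eqP; rewrite -subr_eq0; apply/eqP.
(* Modulo ring identities the two sides differ by a multiple of the relation
   [|s|^2 (|t|^2 + 1) = n^2 m^2]. *)
transitivity (((s1 ^+ 2 + s2 ^+ 2) * (t1 ^+ 2 + t2 ^+ 2 + 1) - a ^+ 2 * b ^+ 2)
  * (z1 ^+ 2 + z2 ^+ 2 + w1 ^+ 2 + w2 ^+ 2)); last by rewrite key mul0r.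
ring.
Qed.

Lemma Qform_identity z w :
  n * Qform z w = (n - m) * (modc z ^+ 2 + modc w ^+ 2)
   + (modc (defect1 z w) ^+ 2 + modc (defect2 z w) ^+ 2) / (2 * m * n ^+ 2).
Proof.
rewrite /Qform Re_kexp defect_identity; field.
by rewrite !gt_eqF.
Qed.

(** [center1 z] is the zero of [defect1 z] in w, and [center2 w] the zero in z of [defect2] at this
    w. *)
Definition center1 z : C := ((n * m)%:C * z - s * (t * z)^*) / s.
Definition center2 w : C := ((n * m)%:C * w + s^* * (t * w)^*) / s^*.

Lemma modc_defect1 z w : modc (defect1 z w) = n * modc (w - center1 z).
Proof.
rewrite -modcM -[LHS]modcN; congr modc; rewrite /defect1 /center1.
by move: (n * m)%:C (t * z)^* => a b; field.
Qed.

Lemma modc_defect2 z w : modc (defect2 z w) = n * modc (z - center2 w).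
Proof.
have sj : s^* != 0 by rewrite conjc_eq0.
rewrite -(modcJ s) -modcM -[LHS]modcN; congr modc; rewrite /defect2 /center2.
have E (a b c : C) : c != 0 -> - (a * w - c * (z - b)) = c * (z - (a * w + c * b) / c).
  by move=> c0; field.
exact: E.
Qed.

(** One square of [Qform_identity] is kept and the other nonnegative terms are dropped. The centre
    moves with z but the rate does not, so by translation invariance the integral in w is bounded
    uniformly in z; [wker_le2] exchanges the roles, as in a Schur test. *)
Lemma wker_le1 q z w : m <= n -> 0 <= q ->
  wker z w `^ q <= expR (- (q / (4 * m * n) * modc (w - center1 z) ^+ 2)).
Proof.
move=> mn q0; rewrite wkerE -expRM ler_expR.
have nQ := Qform_identity z w.
have h1 : n * Qform z w >= modc (defect1 z w) ^+ 2 / (2 * m * n ^+ 2).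
  rewrite nQ; apply: (@le_trans _ _ ((modc (defect1 z w) ^+ 2 + modc (defect2 z w) ^+ 2) / (2 * m * n ^+ 2))).
    by apply: ler_wpM2r; [rewrite invr_ge0 (ltW D0)|rewrite lerDl sqr_ge0].
  by rewrite lerDr; apply: mulr_ge0; rewrite ?subr_ge0// addr_ge0 ?sqr_ge0.
have {}h1 : Qform z w >= modc (w - center1 z) ^+ 2 / (2 * m * n).
  rewrite -(ler_pM2l n0); apply: le_trans h1.
  rewrite modc_defect1 le_eqVlt; apply/orP; left; apply/eqP.
  by field; rewrite !gt_eqF.
have : q * (modc (w - center1 z) ^+ 2 / (2 * m * n)) <= q * Qform z w by rewrite ler_wpM2l.
rewrite (_ : q / (4 * m * n) * _ = q * (modc (w - center1 z) ^+ 2 / (2 * m * n)) / 2); last first.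
  by field; rewrite !gt_eqF.
lra.
Qed.

Lemma wker_le2 q z w : m <= n -> 0 <= q ->
  wker z w `^ q <= expR (- (q / (4 * m * n) * modc (z - center2 w) ^+ 2)).
Proof.
move=> mn q0; rewrite wkerE -expRM ler_expR.
have nQ := Qform_identity z w.
have h1 : n * Qform z w >= modc (defect2 z w) ^+ 2 / (2 * m * n ^+ 2).
  rewrite nQ; apply: (@le_trans _ _ ((modc (defect1 z w) ^+ 2 + modc (defect2 z w) ^+ 2) / (2 * m * n ^+ 2))).
    by apply: ler_wpM2r; [rewrite invr_ge0 (ltW D0)|rewrite lerDr sqr_ge0].
  by rewrite lerDr; apply: mulr_ge0; rewrite ?subr_ge0// addr_ge0 ?sqr_ge0.
have {}h1 : Qform z w >= modc (z - center2 w) ^+ 2 / (2 * m * n).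
  rewrite -(ler_pM2l n0); apply: le_trans h1.
  rewrite modc_defect2 le_eqVlt; apply/orP; left; apply/eqP.
  by field; rewrite !gt_eqF.
have : q * (modc (z - center2 w) ^+ 2 / (2 * m * n)) <= q * Qform z w by rewrite ler_wpM2l.
rewrite (_ : q / (4 * m * n) * _ = q * (modc (z - center2 w) ^+ 2 / (2 * m * n)) / 2); last first.
  by field; rewrite !gt_eqF.
lra.
Qed.

Lemma wker_le_strict z w :
  wker z w <= expR (- ((1 - m / n) / 2 * (modc z ^+ 2 + modc w ^+ 2))).
Proof.
rewrite wkerE ler_expR.
have nQ := Qform_identity z w.
have : n * Qform z w >= (n - m) * (modc z ^+ 2 + modc w ^+ 2).
  by rewrite nQ lerDl; apply: divr_ge0; rewrite ?(ltW D0)// addr_ge0 ?sqr_ge0.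
rewrite -ler_pdivrMl// mulrA mulrBr mulVf ?gt_eqF// [_^-1 * m]mulrC.
lra.
Qed.

End Kernel.

Section Gaussians.
Variable R : realType.
Local Notation C := R[i].
Local Notation mR := (measurableTypeR R).
Local Notation plane := (mR * mR)%type.
Local Notation dA := (@dA R).

Definition gaussI (c : R) : \bar R := (\int[dA]_z (expR (- (c * modc (C_of z) ^+ 2)))%:E)%E.

Lemma measurable_gauss_modc (c : R) (a : C) :
  measurable_fun setT (fun z : plane => expR (- (c * modc (C_of z - a) ^+ 2))).
Proof.
apply: (measurableT_comp (@measurable_expR R)); apply: measurable_funN.
apply: measurable_funM => //; apply: measurable_funX; apply: measC_modc.
by apply: measCD; [exact: measC_id|exact: measC_cst].
Qed.

Lemma gauss_shift (c : R) (a : C) :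
  (\int[dA]_z (expR (- (c * modc (C_of z - a) ^+ 2)))%:E = gaussI c)%E.
Proof.
rewrite -(@dA_shiftC _ (fun z => expR (- (c * modc (C_of z - a) ^+ 2))) a).
- by apply: eq_integral => z _; rewrite C_of_shift addrK.
- exact: measurable_gauss_modc.
- by move=> z; exact: expR_ge0.
Qed.

(** Completing the square: [c x - b x^2 <= c^2 / (2 b) - (b / 2) x^2]. *)
Lemma gauss_linear_lty (c b : R) : 0 < b ->
  (\int[dA]_z (expR (c * modc (C_of z) - b * modc (C_of z) ^+ 2))%:E < +oo)%E.
Proof.
move=> b0; have b2 : 0 < b / 2 by rewrite divr_gt0.
have mm : measurable_fun setT (fun z : plane => modc (C_of z)).
  by apply: measC_modc; exact: measC_id.
have mg : measurable_fun setT (fun z : plane => expR (- (b / 2 * modc (C_of z) ^+ 2))).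
  by have := measurable_gauss_modc (b / 2) 0; congr measurable_fun; apply/funext => z; rewrite subr0.
apply: (@le_lt_trans _ _ (\int[dA]_z (expR (c ^+ 2 / (2 * b)) * expR (- (b / 2 * modc (C_of z) ^+ 2)))%:E)%E).
  apply: ge0_le_dA.
  - apply: (measurableT_comp (@measurable_expR R)); apply: measurable_funB; apply: measurable_funM => //.
    exact: measurable_funX.
  - exact: measurable_funM.
  - move=> z; rewrite expR_ge0 andTb -expRD ler_expR; set x := modc (C_of z).
    rewrite -subr_ge0 (_ : _ - _ = b / 2 * (x - c / b) ^+ 2).
      by rewrite mulr_ge0 ?sqr_ge0// ltW.
    by field; rewrite gt_eqF.
under eq_integral do rewrite EFinM.
rewrite (@ge0_integralZl_EFin _ _ _ dA setT measurableT (fun z => (expR (- (b / 2 * modc (C_of z) ^+ 2)))%:E)).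
- by rewrite lte_mul_pinfty ?lee_fin ?expR_ge0//; exact: gauss2_lty.
- by move=> z _; rewrite lee_fin expR_ge0.
- exact/measurable_EFinP.
- exact: expR_ge0.
Qed.

End Gaussians.

(** * The operator *)

Section Operator.
Variable R : realType.
Local Notation C := R[i].
Local Notation mR := (measurableTypeR R).
Local Notation plane := (mR * mR)%type.
Local Notation dA := (@dA R).
Local Notation wt := (@wmod R 2^-1).
Variables s t : C.
Hypothesis hst : modc t < modc s.
Implicit Types (f g : C -> C) (z w : C).
Local Notation n := (modc s).
Local Notation wker := (wker s t).

Let n0 : 0 < n. Proof. by rewrite (le_lt_trans (modc_ge0 t)). Qed.

Let s0 : s != 0. Proof. by rewrite -modc_gt0. Qed.

Let two0 : (2 : C) != 0. Proof. by rewrite pnatr_eq0. Qed.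

(** A domain common to all exponents: it contains every [fock p] with [0 < p], so convergence,
    linearity and holomorphy of [Top s t f] are settled once. *)
Definition wbounded f := entire f /\ exists M : R, forall z, wt f z <= M.

Lemma measurable_wker d (X : measurableType d) (g h : X -> C) : measC g -> measC h ->
  measurable_fun setT (fun x => wker (g x) (h x)).
Proof.
move=> mg mh; apply: (measurableT_comp (@measurable_expR R)).
have mq (k : X -> C) : measC k -> measurable_fun setT (fun x => modc (k x) ^+ 2 / 2).
  by move=> mk; apply: measurable_funM => //; apply: measurable_funX; exact: measC_modc.
apply: measurable_funB; last exact: mq.
apply: measurable_funB; last exact: mq.
have mm (c : C) (k : X -> C) : measC k -> measC (fun x => c * k x).
  by move=> mk; apply: measCM => //; exact: measC_cst.
have mh2 : measC (fun x => h x ^+ 2) by apply: measCM.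
have mg2 : measC (fun x => g x ^+ 2) by apply: measCM.
suff : measC (fun x => kexp s t (g x) (h x)) by case.
apply: measCM; last exact: measC_cst.
apply: measCD; last by apply: measCM; [exact: mm|exact: measC_conj].
by apply: measCD; [exact: mm|apply: measCN; apply: measC_conj; exact: mm].
Qed.

Definition kernel_cst : R := modc (sqrtc s)^-1 * pi^-1.

Lemma kernel_cst_gt0 : 0 < kernel_cst.
Proof. by rewrite mulr_gt0 ?invr_gt0 ?pi_gt0// modc_gt0 invr_eq0 sqrtc_eq0. Qed.

Lemma modc_gauss_weight w : modc (gauss_weight w) = pi^-1 * expR (- modc w ^+ 2).
Proof. by rewrite modcR ger0_norm// mulr_ge0 ?expR_ge0// invr_ge0 pi_ge0. Qed.

Lemma measC_gauss_weight : measC (fun w : plane => gauss_weight (C_of w)).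
Proof.
apply: measC_real; apply: measurable_funM => //.
apply: (measurableT_comp (@measurable_expR R)); apply: measurable_funN.
by apply: measurable_funX; apply: measC_modc; exact: measC_id.
Qed.

Lemma modc_integrand f z w :
  modc (K s t z w * f w * gauss_weight w) =
  kernel_cst * expR (modc z ^+ 2 / 2) * (wker z w * wt f w).
Proof.
rewrite modcM modcM [modc (K _ _ _ _)]modcM modc_expc modc_gauss_weight.
rewrite -/(knum t z w) -/(kexp s t z w) /kernel_cst /wker /wmod.
set X := complex.Re _ - _ - _; set c := modc (sqrtc s)^-1.
rewrite (_ : complex.Re (kexp s t z w) = modc z ^+ 2 / 2 + X + modc w ^+ 2 / 2); last by rewrite /X; ring.
rewrite (_ : expR (- modc w ^+ 2) = (expR (modc w ^+ 2 / 2))^-1 * expR (- (2^-1 * modc w ^+ 2))); last first.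
  by rewrite -expRN -expRD; congr expR; field.
rewrite !expRD; have e0 : expR (modc w ^+ 2 / 2) != 0 by rewrite gt_eqF// expR_gt0.
by move: pi^-1 => q; field.
Qed.

(** With [u] and [phi] the integrand depends on z through [expc (z * u w)] and a prefactor, which is
    the shape required by [entire_integralC_exp]. *)
Let u w : C := w^* / s.
Let phi f w : C := expc (- (t * w ^+ 2)^* / (2 * s)) * f w * gauss_weight w.

Let integrandE f z w : K s t z w * f w * gauss_weight w =
  ((sqrtc s)^-1 * expc (t * z ^+ 2 / (2 * s))) * (expc (z * u w) * phi f w).
Proof.
rewrite /K /phi /u.
have -> : (t * z ^+ 2 - (t * w ^+ 2)^* + 2 * z * w^*) / (2 * s) =
    t * z ^+ 2 / (2 * s) + (z * (w^* / s) + - (t * w ^+ 2)^* / (2 * s)).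
  have E (a b c : C) : (a - b + 2 * z * c) / (2 * s) = a / (2 * s) + (z * (c / s) + - b / (2 * s)).
    by field; rewrite ?s0 ?two0.
  exact: E.
rewrite !expcD; move: (expc _) (expc _) (expc _) (sqrtc s)^-1 => a b c d; ring.
Qed.

Let b0 : 0 < (1 - modc t / n) / 2.
Proof. by rewrite divr_gt0// subr_gt0 ltr_pdivrMr// mul1r. Qed.

Let measC_u : measC (fun w : plane => u (C_of w)).
Proof. by apply: measCM; [apply: measC_conj; exact: measC_id|exact: measC_cst]. Qed.

Let measC_phi f : entire f -> measC (fun w : plane => phi f (C_of w)).
Proof.
move=> ef; apply: measCM; last exact: measC_gauss_weight.
apply: measCM; last by apply: (measC_entire ef); exact: measC_id.
apply: (measC_entire (@entire_expc R)); apply: measCM; last exact: measC_cst.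
apply: measCN; apply: measC_conj; apply: measCM; first exact: measC_cst.
by apply: measCM; exact: measC_id.
Qed.

(** Half of the Gaussian weight is spent on bounding [f]; the other half outweighs the exponential
    of [- (t * w ^+ 2)^* / (2 * s)], which grows at rate at most [modc t / (2 * n)], and
    [modc t < n]. *)
Let modc_phi f M w : (forall z, wt f z <= M) ->
  modc (phi f w) <= pi^-1 * M * expR (- ((1 - modc t / n) / 2 * modc w ^+ 2)).
Proof.
move=> hM; have M0 : 0 <= M by exact: le_trans (wmod_ge0 _ _ _) (hM 0).
rewrite modcM [modc (_ * f w)]modcM modc_expc modc_gauss_weight.
have h1 : complex.Re (- (t * w ^+ 2)^* / (2 * s)) <= modc t / n * modc w ^+ 2 / 2.
  apply: le_trans (ler_norm _) _; apply: le_trans (ler_Re_modc _) _.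
  rewrite modcM modcN modcJ modcV [modc (2 * s)]modcM modc2 [modc (t * _)]modcM modcX le_eqVlt.
  by apply/orP; left; apply/eqP; field; rewrite gt_eqF.
have E2 : expR (- modc w ^+ 2) = expR (- (2^-1 * modc w ^+ 2)) * expR (- (2^-1 * modc w ^+ 2)).
  by rewrite -expRD; congr expR; field.
rewrite E2 [leLHS](_ : _ = pi^-1 * (wt f w * (expR (complex.Re (- (t * w ^+ 2)^* / (2 * s))) * expR (- (2^-1 * modc w ^+ 2))))); last first.
  by rewrite /wmod; move: (expR (complex.Re _)) pi^-1 => c q; ring.
rewrite -mulrA; apply: ler_wpM2l; first by rewrite invr_ge0 pi_ge0.
apply: ler_pM; rewrite ?wmod_ge0 ?mulr_ge0 ?expR_ge0//.
rewrite -expRD ler_expR; apply: le_trans (lerD h1 (lexx _)) _.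
by rewrite le_eqVlt; apply/orP; left; apply/eqP; field; rewrite gt_eqF.
Qed.

Let phi_lty f (c : R) : wbounded f ->
  (\int[dA]_w (expR (c * modc (u (C_of w))) * modc (phi f (C_of w)))%:E < +oo)%E.
Proof.
move=> [ef [M hM]].
set b := (1 - modc t / n) / 2.
have M0 : 0 <= M by exact: le_trans (wmod_ge0 _ _ _) (hM 0).
have A0 : 0 <= pi^-1 * M by rewrite mulr_ge0// invr_ge0 pi_ge0.
have mm : measurable_fun setT (fun w : plane => modc (C_of w)).
  by apply: measC_modc; exact: measC_id.
have mg : measurable_fun setT (fun w : plane => expR (c / n * modc (C_of w) - b * modc (C_of w) ^+ 2)).
  apply: (measurableT_comp (@measurable_expR R)); apply: measurable_funB; apply: measurable_funM => //.
  exact: measurable_funX.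
apply: (@le_lt_trans _ _ (\int[dA]_w (pi^-1 * M * expR (c / n * modc (C_of w) - b * modc (C_of w) ^+ 2))%:E)%E).
  apply: ge0_le_dA.
  - apply: measurable_funM; last exact: measC_modc (measC_phi ef).
    apply: (measurableT_comp (@measurable_expR R)); apply: measurable_funM => //.
    exact: measC_modc measC_u.
  - exact: measurable_funM.
  - move=> w; rewrite mulr_ge0 ?expR_ge0 ?modc_ge0// andTb.
    apply: le_trans (ler_wpM2l (expR_ge0 _) (@modc_phi f M (C_of w) hM)) _.
    rewrite mulrCA ler_wpM2l// -expRD ler_expR /u modcM modcJ modcV.
    by rewrite le_eqVlt; apply/orP; left; apply/eqP; rewrite /b; field; rewrite gt_eqF.
under eq_integral do rewrite EFinM.
rewrite (@ge0_integralZl_EFin _ _ _ dA setT measurableT (fun w : plane => (expR (c / n * modc (C_of w) - b * modc (C_of w) ^+ 2))%:E)).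
- by rewrite lte_mul_pinfty ?lee_fin//; apply: gauss_linear_lty; exact: b0.
- by move=> w _; rewrite lee_fin expR_ge0.
- exact/measurable_EFinP.
- exact: A0.
Qed.

Let integrable_phi f z : wbounded f -> integrableC (fun w => expc (z * u w) * phi f w).
Proof.
move=> bf; have ef := bf.1.
have mu : measurable_fun setT (fun w : plane => expR (modc z * modc (u (C_of w))) * modc (phi f (C_of w))).
  apply: measurable_funM; last exact: measC_modc (measC_phi ef).
  apply: (measurableT_comp (@measurable_expR R)); apply: measurable_funM => //.
  exact: measC_modc measC_u.
apply: (le_integrableC _ mu _ (phi_lty (modc z) bf)).
  apply: measCM; last exact: measC_phi.
  apply: (measC_entire (@entire_expc R)); apply: measCM; [exact: measC_cst|exact: measC_u].
move=> w; rewrite modcM; apply: ler_wpM2r; first exact: modc_ge0.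
by rewrite modc_expc ler_expR -modcM (le_trans (ler_norm _))// ler_Re_modc.
Qed.

Lemma Top_integrable f z : wbounded f ->
  integrableC (fun w => K s t z w * f w * gauss_weight w).
Proof.
move=> bf; have := integrableCZ ((sqrtc s)^-1 * expc (t * z ^+ 2 / (2 * s))) (integrable_phi z bf).
by congr integrableC; apply/funext => w; rewrite integrandE.
Qed.

Lemma TopE f z : wbounded f -> Top s t f z = (sqrtc s)^-1 * expc (t * z ^+ 2 / (2 * s)) *
  integralC (fun w => expc (z * u w) * phi f w).
Proof.
move=> bf; rewrite -(integralCZ _ (integrable_phi z bf)); congr integralC.
by apply/funext => w; rewrite integrandE.
Qed.

Lemma entire_Top f : wbounded f -> entire (Top s t f).
Proof.
move=> bf; have -> : Top s t f = (fun z => ((sqrtc s)^-1 * expc (t * z ^+ 2 / (2 * s))) *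
    integralC (fun w => expc (z * u w) * phi f w)).
  by apply/funext => z; rewrite TopE.
apply: entireM; last first.
  exact: (entire_integralC_exp measC_u (measC_phi bf.1) (fun c => phi_lty c bf)).
apply: entireM; first exact: entire_cst.
apply: (entire_comp (@entire_expc R)); apply: entireM; last exact: entire_cst.
apply: entireM; first exact: entire_cst.
by apply: entireM; exact: entire_id.
Qed.

Lemma Top_linear (a : C) f g : wbounded f -> wbounded g ->
  Top s t (fun z => a * f z + g z) = (fun z => a * Top s t f z + Top s t g z).
Proof.
move=> bf bg; apply/funext => z; rewrite /Top.
rewrite -(integralCZ a (Top_integrable z bf)) -(integralCD (integrableCZ a (Top_integrable z bf)) (Top_integrable z bg)).
congr integralC; apply/funext => w.
by move: (K s t z w) (gauss_weight w) => c d; ring.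
Qed.

Lemma wt_Top_le f z : wbounded f ->
  ((wt (Top s t f) z)%:E <= (2 * kernel_cst)%:E * \int[dA]_w (wker z (C_of w) * wt f (C_of w))%:E)%E.
Proof.
move=> bf; have := modc_integralC_le (Top_integrable z bf).
rewrite -/(Top s t f z).
have E : (\int[dA]_w (modc (K s t z (C_of w) * f (C_of w) * gauss_weight (C_of w)))%:E =
    (kernel_cst * expR (modc z ^+ 2 / 2))%:E * \int[dA]_w (wker z (C_of w) * wt f (C_of w))%:E)%E.
  rewrite -(@ge0_integralZl_EFin _ _ _ dA setT measurableT (fun w : plane => (wker z (C_of w) * wt f (C_of w))%:E)).
  - by apply: eq_integral => w _; rewrite modc_integrand.
  - by move=> w _; rewrite lee_fin mulr_ge0 ?wker_ge0 ?wmod_ge0.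
  - apply/measurable_EFinP; apply: measurable_funM; last exact: measurable_wmod bf.1.
    by apply: measurable_wker; [exact: measC_cst|exact: measC_id].
  - by rewrite mulr_ge0 ?expR_ge0// ltW// kernel_cst_gt0.
rewrite E; set J := (\int[dA]_w _)%E => h.
have e0 : (0 <= (expR (- (2^-1 * modc z ^+ 2)))%:E)%E by rewrite lee_fin expR_ge0.
have := lee_wpmul2l e0 h; rewrite -EFinM mulrC => /le_trans; apply.
rewrite !muleA -!EFinM le_eqVlt; apply/orP; left; apply/eqP; congr (_%:E * _)%E.
rewrite (_ : modc z ^+ 2 / 2 = 2^-1 * modc z ^+ 2); last by ring.
rewrite expRN; have e1 : expR (2^-1 * modc z ^+ 2) != 0 by rewrite gt_eqF// expR_gt0.
by field.
Qed.

End Operator.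

(** * Boundedness when m <= n *)

Section Sufficiency.
Variable R : realType.
Local Notation C := R[i].
Local Notation mR := (measurableTypeR R).
Local Notation plane := (mR * mR)%type.
Local Notation dA := (@dA R).
Local Notation wt := (@wmod R 2^-1).
Variables s t : C.
Hypothesis hst : modc t < modc s.
Implicit Types (f g : C -> C) (z w : C).
Local Notation n := (modc s).
Local Notation m := (Num.sqrt (modc t ^+ 2 + 1)).
Local Notation wker := (wker s t).
Local Notation kernel_cst := (kernel_cst s).

Let n0 : 0 < n. Proof. by rewrite (le_lt_trans (modc_ge0 t)). Qed.
Let s0 : s != 0. Proof. by rewrite -modc_gt0. Qed.
Let m0 : 0 < m. Proof. by rewrite sqrtr_gt0 ltr_wpDl// sqr_ge0. Qed.

Lemma fock_wbounded p f : (0 < p)%E -> fock p f -> wbounded f.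
Proof. by move=> p0 Ff; split; [exact: fock_entire Ff|exact: fock_bounded p0 Ff]. Qed.

Let cst_mn (q : R) : R := q / (4 * m * n).

Let cst_gt0 q : 0 < q -> 0 < cst_mn q.
Proof. by move=> q0; rewrite divr_gt0// !mulr_gt0. Qed.

Lemma gaussI_ge0 (c : R) : (0 <= gaussI c)%E.
Proof. by apply: integral_ge0 => z _; rewrite lee_fin expR_ge0. Qed.

Lemma gaussI_fin (c : R) : 0 < c -> gaussI c \is a fin_num.
Proof. by move=> c0; rewrite ge0_fin_numE ?gaussI_ge0//; exact: gauss2_lty. Qed.

Let measurable_wkerq q z : measurable_fun setT (fun w : plane => wker z (C_of w) `^ q).
Proof.
apply: (measurableT_comp (measurable_powR _)).
by apply: measurable_wker; [exact: measC_cst|exact: measC_id].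
Qed.

Let measurable_wkerq' q w : measurable_fun setT (fun z : plane => wker (C_of z) w `^ q).
Proof.
apply: (measurableT_comp (measurable_powR _)).
by apply: measurable_wker; [exact: measC_id|exact: measC_cst].
Qed.

Lemma wker_integral_w q z : m <= n -> 0 < q ->
  (\int[dA]_w (wker z (C_of w) `^ q)%:E <= gaussI (cst_mn q))%E.
Proof.
move=> mn q0; rewrite -(gauss_shift _ (center1 s t z)).
apply: (ge0_le_dA (measurable_wkerq _ _) (measurable_gauss_modc _ _)) => w.
by rewrite powR_ge0 /cst_mn; apply: wker_le1 => //; exact: ltW.
Qed.

Lemma wker_integral_z q w : m <= n -> 0 < q ->
  (\int[dA]_z (wker (C_of z) w `^ q)%:E <= gaussI (cst_mn q))%E.
Proof.
move=> mn q0; rewrite -(gauss_shift _ (center2 s t w)).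
apply: (ge0_le_dA (measurable_wkerq' _ _) (measurable_gauss_modc _ _)) => z.
by rewrite powR_ge0 /cst_mn; apply: wker_le2 => //; exact: ltW.
Qed.

(* Freezing [z], the modulus of the holomorphic function [half_kernel z f],
   weighted by exp (- 3/4 |w|^2), is sqrt (wker z w) * wt f w. *)
Let half_kernel z f w : C :=
  (expR (- (modc z ^+ 2 / 4)))%:C * (f w * expc ((2^-1)%:C * (kexp s t z w)^*)).

Let half_kernelE z f w : wmod (3 / 4) (half_kernel z f) w = wker z w `^ 2^-1 * wt f w.
Proof.
rewrite /half_kernel /wker /wmod modcM modcR ger0_norm ?expR_ge0// modcM modc_expc -expRM.
rewrite (_ : complex.Re (_ * _) = 2^-1 * complex.Re (kexp s t z w)); last first.
  by case: (kexp _ _ _ _) => a b /=; rewrite mul0r subr0.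
have E1 (a b c d : R) : a * (b * c) * d = b * (a * c * d) by ring.
by rewrite E1 [RHS]mulrCA -!expRD; congr (_ * expR _); field.
Qed.

Lemma entire_conj_kexp z : entire (fun w => (kexp s t z w)^*).
Proof.
have -> : (fun w => (kexp s t z w)^*) = (fun w =>
    ((t * z ^+ 2)^* + (- t * (w * w)) + (2 * z)^* * w) * ((2 * s)^-1)^*).
  apply/funext => w; rewrite /kexp /knum rmorphM/=; congr (_ * _).
  move: (t) (z) (w) => [t1 t2] [z1 z2] [w1 w2]; apply/eqP; rewrite eq_complex/=.
  by apply/andP; split; apply/eqP; ring.
have ei := @entire_id R; have ec := @entire_cst R.
exact: (entireM (entireD (entireD (ec _) (entireM (ec _) (entireM ei ei))) (entireM (ec _) ei)) (ec _)).
Qed.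

Let entire_half_kernel z f : entire f -> entire (half_kernel z f).
Proof.
move=> ef.
have e2 := entire_comp (@entire_expc R) (entireM (@entire_cst R (2^-1)%:C) (@entire_conj_kexp z)).
exact: (entireM (@entire_cst R (expR (- (modc z ^+ 2 / 4)))%:C) (entireM ef e2)).
Qed.

(** The r-th power of the weighted modulus of [half_kernel], as a function of both variables for use
    with Tonelli. *)
Let Phi r f (zw : plane * plane) : R :=
  wker (C_of zw.1) (C_of zw.2) `^ (r / 2) * wt f (C_of zw.2) `^ r.

Let Phi_ge0 r f zw : 0 <= Phi r f zw.
Proof. by rewrite mulr_ge0 ?powR_ge0. Qed.

Let measurable_Phi r f : entire f -> measurable_fun setT (Phi r f).
Proof.
move=> ef; apply: measurable_funM.
  apply: (measurableT_comp (measurable_powR _)).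
  by apply: measurable_wker; apply: measC_C_of; [exact: measurable_fst|exact: measurable_snd].
apply: (measurableT_comp (measurable_powR _)).
exact: (measurableT_comp (measurable_wmod 2^-1 ef) measurable_snd).
Qed.

Lemma Top_local (r : R) : m <= n -> 0 < r -> exists2 c : R, 0 < c & forall f (z : plane), wbounded f ->
  ((wt (Top s t f) (C_of z) `^ r)%:E <= c%:E * \int[dA]_v (Phi r f (z, v))%:E)%E.
Proof.
move=> mn r0.
have [K K0 hK] := weighted_estimate r0 (ltac:(by lra) : 0 <= 3 / 4 :> R).
have q0 : 0 < cst_mn 2^-1 by apply: cst_gt0; rewrite invr_gt0.
set G := gaussI (cst_mn 2^-1).
have Gf : G \is a fin_num by exact: gaussI_fin.
have G0 : 0 <= fine G by rewrite fine_ge0// gaussI_ge0.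
have kap0 := kernel_cst_gt0 hst.
have g1 : 0 < 2 * kernel_cst * (fine G + 1) by apply: mulr_gt0; [apply: mulr_gt0|rewrite ltr_wpDl].
exists ((2 * kernel_cst * (fine G + 1)) `^ r * K).
  by rewrite mulr_gt0// powR_gt0.
move=> f z bf; set J := (\int[dA]_w _)%E.
have J0 : (0 <= J)%E by apply: integral_ge0 => w _; rewrite lee_fin Phi_ge0.
have [Joo|Joo] := eqVneq J +oo%E.
  by rewrite Joo gt0_muley ?leey// lte_fin; apply: mulr_gt0 => //; exact: powR_gt0.
have Jf : J \is a fin_num by rewrite ge0_fin_numE ?ltey.
have hS w : wker (C_of z) w `^ 2^-1 * wt f w <= (K * fine J) `^ r^-1.
  have := hK (half_kernel (C_of z) f) w (@entire_half_kernel (C_of z) f bf.1).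
  rewrite half_kernelE.
  have -> : (\int[dA]_w (wmod (3 / 4) (half_kernel (C_of z) f) (C_of w) `^ r)%:E = J)%E.
    apply: eq_integral => v _; rewrite half_kernelE powRM ?powR_ge0 ?wmod_ge0//.
    by rewrite /Phi -powRrM [_ * r]mulrC.
  rewrite -(fineK Jf) -EFinM lee_fin => h.
  have x0 : 0 <= wker (C_of z) w `^ 2^-1 * wt f w by rewrite mulr_ge0 ?powR_ge0 ?wmod_ge0.
  rewrite (_ : wker (C_of z) w `^ 2^-1 * wt f w = ((wker (C_of z) w `^ 2^-1 * wt f w) `^ r) `^ r^-1).
    apply: ge0_ler_powR; rewrite ?nnegrE.
    - by rewrite invr_ge0 ltW.
    - exact: powR_ge0.
    - by apply: mulr_ge0; [exact: (ltW K0)|rewrite -lee_fin (fineK Jf)].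
    - exact: h.
  by rewrite -powRrM divff ?lt0r_neq0// powRr1.
set S := (K * fine J) `^ r^-1 in hS.
have S0 : 0 <= S by exact: powR_ge0.
have h2 : 2^-1 + 2^-1 = 1 :> R by lra.
have hI : (\int[dA]_w (wker (C_of z) (C_of w) * wt f (C_of w))%:E <= S%:E * G)%E.
  apply: (@le_trans _ _ (S%:E * \int[dA]_w (wker (C_of z) (C_of w) `^ 2^-1)%:E)%E); last first.
    apply: lee_wpmul2l; first by rewrite lee_fin.
    by apply: wker_integral_w => //; rewrite invr_gt0.
  rewrite -(@ge0_integralZl_EFin _ _ _ dA setT measurableT (fun w : plane => (wker (C_of z) (C_of w) `^ 2^-1)%:E)).
  - apply: ge0_le_dA.
    + apply: measurable_funM; last exact: measurable_wmod bf.1.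
      by apply: measurable_wker; [exact: measC_cst|exact: measC_id].
    + by apply: measurable_funM => //; exact: measurable_wkerq.
    + move=> w; rewrite mulr_ge0 ?wker_ge0 ?wmod_ge0// andTb.
      have {1}-> : wker (C_of z) (C_of w) = wker (C_of z) (C_of w) `^ 2^-1 * wker (C_of z) (C_of w) `^ 2^-1.
        by rewrite -powRD_gt0 ?expR_gt0// h2 powRr1 ?wker_ge0.
      rewrite -mulrA mulrC; apply: ler_wpM2r; [exact: powR_ge0|exact: hS].
  - by move=> w _; rewrite lee_fin powR_ge0.
  - by apply/measurable_EFinP; exact: measurable_wkerq.
  - exact: S0.
have k2 : (0 <= (2 * kernel_cst)%:E)%E by rewrite lee_fin mulr_ge0// ltW.
have := le_trans (wt_Top_le hst (C_of z) bf) (lee_wpmul2l k2 hI).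
rewrite -(fineK Gf) -!EFinM lee_fin => h.
rewrite -(fineK Jf) -EFinM lee_fin.
have {}h : wt (Top s t f) (C_of z) <= 2 * kernel_cst * (fine G + 1) * S.
  apply: le_trans h _; rewrite -[leRHS]mulrA; apply: ler_wpM2l; last by rewrite mulrC mulrDl mul1r lerDl.
  by apply: mulr_ge0 => //; exact: ltW.
apply: (@le_trans _ _ ((2 * kernel_cst * (fine G + 1) * S) `^ r)).
  by apply: ge0_ler_powR; rewrite ?nnegrE ?(ltW r0) ?wmod_ge0// mulr_ge0// ltW.
rewrite powRM ?(ltW g1)// -[leRHS]mulrA; apply: ler_wpM2l; first exact: powR_ge0.
rewrite /S -powRrM mulVf ?lt0r_neq0// powRr1//; apply: mulr_ge0; [exact: (ltW K0)|by rewrite -lee_fin (fineK Jf)].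
Qed.

Lemma wint_Top (r : R) : m <= n -> 0 < r -> exists2 c : R, 0 < c & forall f, wbounded f ->
  (wint r (Top s t f) <= c%:E * wint r f)%E.
Proof.
move=> mn r0; have [c c0 hc] := Top_local mn r0.
have q0 : 0 < cst_mn (r / 2) by apply: cst_gt0; rewrite divr_gt0.
set G := gaussI (cst_mn (r / 2)).
have Gf : G \is a fin_num by exact: gaussI_fin.
have G0 : 0 <= fine G by rewrite fine_ge0// gaussI_ge0.
exists (c * (fine G + 1)); first by rewrite mulr_gt0//; lra.
move=> f bf.
have mPhi := measurable_Phi r bf.1.
have mPhiE : measurable_fun setT (fun zw => (Phi r f zw)%:E) by exact/measurable_EFinP.
have PhiE0 zw : (0 <= (Phi r f zw)%:E)%E by rewrite lee_fin Phi_ge0.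
have mI : measurable_fun setT (fun z : plane => \int[dA]_v (Phi r f (z, v))%:E)%E.
  exact: (@measurable_fun_fubini_tonelli_F _ _ _ _ R (dAsf R) (fun zw => (Phi r f zw)%:E) mPhiE PhiE0).
have I0 (z : plane) : (0 <= \int[dA]_v (Phi r f (z, v))%:E)%E by apply: integral_ge0.
have step1 : (wint r (Top s t f) <= c%:E * \int[dA]_u \int[dA]_v (Phi r f (u, v))%:E)%E.
  rewrite -(@ge0_integralZl_EFin _ _ _ dA setT measurableT (fun z : plane => \int[dA]_v (Phi r f (z, v))%:E)%E (fun (z : plane) _ => I0 z) mI c (ltW c0)).
  apply: (@ge0_le_integral _ _ _ dA setT measurableT).
  - by move=> z _; rewrite lee_fin powR_ge0.
  - apply/measurable_EFinP; apply: (measurableT_comp (measurable_powR _)).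
    by apply: measurable_wmod; exact: entire_Top.
  - exact: measurable_funeM.
  - by move=> z _; exact: hc.
have step2 : (\int[dA]_u \int[dA]_v (Phi r f (u, v))%:E <= (fine G + 1)%:E * wint r f)%E.
  rewrite (dA_dA_tonelli mPhiE PhiE0).
  have mW : measurable_fun setT (fun w : plane => (wt f (C_of w) `^ r)%:E).
    apply/measurable_EFinP; apply: (measurableT_comp (measurable_powR _)).
    by apply: measurable_wmod; exact: bf.1.
  rewrite /wint -(@ge0_integralZl_EFin _ _ _ dA setT measurableT (fun w : plane => (wt f (C_of w) `^ r)%:E) _ mW (fine G + 1)); last 2 first.
  - by move=> w _; rewrite lee_fin powR_ge0.
  - by lra.
  apply: (@ge0_le_integral _ _ _ dA setT measurableT).
  - by move=> w _; apply: integral_ge0.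
  - exact: (@measurable_fun_fubini_tonelli_G _ _ _ _ R (dAsf R) (fun zw => (Phi r f zw)%:E) mPhiE PhiE0).
  - exact: measurable_funeM.
  - move=> w _; rewrite [X in (X <= _)%E](_ : _ =
      (wt f (C_of w) `^ r)%:E * \int[dA]_u (wker (C_of u) (C_of w) `^ (r / 2))%:E)%E; last first.
      rewrite -(@ge0_integralZl_EFin _ _ _ dA setT measurableT (fun z : plane => (wker (C_of z) (C_of w) `^ (r / 2))%:E)).
      + by apply: eq_integral => z _; rewrite -EFinM mulrC.
      + by move=> z _; rewrite lee_fin powR_ge0.
      + by apply/measurable_EFinP; exact: measurable_wkerq'.
      + exact: powR_ge0.
    rewrite [leRHS]muleC; apply: lee_wpmul2l; first by rewrite lee_fin powR_ge0.
    apply: le_trans (wker_integral_z _ mn _) _; first by rewrite divr_gt0.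
    by rewrite -/G -(fineK Gf) lee_fin; lra.
apply: le_trans step1 _; rewrite EFinM -muleA.
by apply: lee_wpmul2l => //; rewrite lee_fin ltW.
Qed.

Lemma Top_bounded p : m <= n -> (0 < p)%E -> bounded_on p (Top s t).
Proof.
move=> mn p0.
have kap0 := kernel_cst_gt0 hst.
case: p p0 => [r|_|//].
  rewrite lte_fin => r0; have p0 : (0 < r%:E)%E by rewrite lte_fin.
  have [c c0 hc] := wint_Top mn r0.
  split.
    move=> f Ff; have bf := fock_wbounded p0 Ff.
    have [ef fin] := (fock_finP f r0).1 Ff.
    apply/(fock_finP _ r0); split; first exact: entire_Top.
    apply: le_lt_trans (hc f bf) _; rewrite lte_mul_pinfty// lee_fin ltW//.
  exists (c `^ r^-1) => f Ff; have bf := fock_wbounded p0 Ff.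
  have q0 : 0 <= r / (2 * pi) :> R by rewrite divr_ge0 ?(ltW r0)// mulr_ge0// pi_ge0.
  rewrite !fock_norm_fin -poweR_EFin -poweRM; last 2 first.
  - by rewrite lee_fin ltW.
  - by rewrite mule_ge0 ?wint_ge0// lee_fin.
  apply: gt0_ler_poweR; rewrite ?invr_ge0 ?(ltW r0)//.
  - by rewrite in_itv/= leey andbT mule_ge0 ?wint_ge0// lee_fin.
  - by rewrite in_itv/= leey andbT !mule_ge0 ?wint_ge0// lee_fin// ltW.
  - by rewrite muleCA; apply: lee_wpmul2l; [rewrite lee_fin|exact: hc].
have q0 : 0 < cst_mn 1 by exact: cst_gt0.
set G := gaussI (cst_mn 1).
have Gf : G \is a fin_num by exact: gaussI_fin.
have bound f M z : wbounded f -> (forall w, wt f w <= M) ->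
    wt (Top s t f) z <= 2 * kernel_cst * fine G * M.
  move=> bf hM; have M0 : 0 <= M by exact: le_trans (wmod_ge0 _ _ _) (hM 0).
  rewrite -lee_fin; apply: le_trans (wt_Top_le hst z bf) _.
  rewrite -mulrA [leRHS]EFinM; apply: lee_wpmul2l; first by rewrite lee_fin mulr_ge0// ltW.
  apply: (@le_trans _ _ (M%:E * \int[dA]_w (wker z (C_of w) `^ 1)%:E)%E).
    rewrite -(@ge0_integralZl_EFin _ _ _ dA setT measurableT (fun w : plane => (wker z (C_of w) `^ 1)%:E)).
    - apply: ge0_le_dA.
      + apply: measurable_funM; last exact: measurable_wmod bf.1.
        by apply: measurable_wker; [exact: measC_cst|exact: measC_id].
      + by apply: measurable_funM => //; exact: measurable_wkerq.
      + move=> w; rewrite mulr_ge0 ?wker_ge0 ?wmod_ge0// andTb powRr1 ?wker_ge0// mulrC.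
        by apply: ler_wpM2r; [exact: wker_ge0|exact: hM].
    - by move=> w _; rewrite lee_fin powR_ge0.
    - by apply/measurable_EFinP; exact: measurable_wkerq.
    - exact: M0.
  rewrite mulrC EFinM fineK//; apply: lee_wpmul2l; first by rewrite lee_fin.
  by apply: wker_integral_w.
have p0 : (0 < +oo :> \bar R)%E by [].
split.
  move=> f Ff; have bf := fock_wbounded p0 Ff; have [ef [M hM]] := bf.
  apply/fock_ooP; split; first exact: entire_Top.
  by exists (2 * kernel_cst * fine G * M) => z; exact: bound.
exists (2 * kernel_cst * fine G) => f Ff; have bf := fock_wbounded p0 Ff.
have Nf : fock_norm +oo%E f \is a fin_num by rewrite ge0_fin_numE ?fock_norm_ge0// fock_norm_lty.
rewrite -(fineK Nf) [leLHS]fock_norm_oo; apply: ge_ereal_sup => _ [z _ <-].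
rewrite -EFinM lee_fin; apply: bound => // w.
rewrite -lee_fin fineK// fock_norm_oo; apply: ereal_sup_ubound; by exists w.
Qed.

End Sufficiency.

(** * Normalized reproducing kernels *)

Section Necessity.
Variable R : realType.
Local Notation C := R[i].
Local Notation mR := (measurableTypeR R).
Local Notation plane := (mR * mR)%type.
Local Notation dA := (@dA R).
Local Notation wt := (@wmod R 2^-1).
Implicit Types (f g : C -> C) (z w a : C).

Definition nker a z : C := expc (z * conjc a - (modc a ^+ 2 / 2)%:C).

Lemma entire_nker a : entire (nker a).
Proof.
have := entire_comp (@entire_expc R) (entireD (entireM (@entire_id R) (@entire_cst R (conjc a))) (@entire_cst R (- (modc a ^+ 2 / 2)%:C))).
by [].
Qed.

Lemma wt_nker a z : wt (nker a) z = expR (- (2^-1 * modc (z - a) ^+ 2)).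
Proof.
rewrite /wmod modc_expc -expRD; congr expR; rewrite !modc_sqrE.
by case: z a => x y [u v] /=; field.
Qed.

(** By [wt_nker] the weighted moduli are translates of one Gaussian, so for finite p the norm does
    not depend on [a]. *)
Lemma nker_norm p : (0 < p)%E -> exists N : R, forall a,
  fock p (nker a) /\ (fock_norm p (nker a) <= N%:E)%E.
Proof.
case: p => [r|_|//]; last first.
  have le1 a z : wt (nker a) z <= 1.
    by rewrite wt_nker -expR0 ler_expR oppr_le0 mulr_ge0 ?invr_ge0// sqr_ge0.
  exists 1 => a; split.
    by apply/fock_ooP; split; [exact: entire_nker|exists 1 => z; exact: le1].
  by rewrite fock_norm_oo; apply: ge_ereal_sup => _ [z _ <-]; rewrite lee_fin.
rewrite lte_fin => r0.
have E a : wint r (nker a) = gaussI (r / 2).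
  rewrite -(gauss_shift _ a); apply: eq_integral => z _.
  by rewrite wt_nker -expRM; congr (expR _)%:E; field.
have Gf : (gaussI (r / 2) < +oo)%E by apply: gauss2_lty; rewrite divr_gt0.
have nf : fock_norm r%:E (nker 0) \is a fin_num.
  rewrite ge0_fin_numE; last by apply: fock_norm_ge0; rewrite lte_fin.
  apply: fock_norm_lty; first by rewrite lte_fin.
  by apply/(fock_finP _ r0); split; [exact: entire_nker|rewrite E].
exists (fine (fock_norm r%:E (nker 0))) => a; split.
  by apply/(fock_finP _ r0); split; [exact: entire_nker|rewrite E].
by rewrite (fineK nf) [leLHS]fock_norm_fin [leRHS]fock_norm_fin (E a) (E 0).
Qed.

Let psi (x : R) : R := pi^-1 * expR (- x ^+ 2).

Let psi_ge0 x : 0 <= psi x.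
Proof. by rewrite mulr_ge0 ?expR_ge0// invr_ge0 pi_ge0. Qed.

Let measurable_psi : measurable_fun setT (fun z : plane => psi (modc (C_of z))).
Proof.
apply: measurable_funM => //; apply: (measurableT_comp (@measurable_expR R)).
by apply: measurable_funN; apply: measurable_funX; apply: measC_modc; exact: measC_id.
Qed.

(** The total mass of d lambda, kept as a symbol: it enters as a positive finite factor. *)
Let kappa : \bar R := (\int[dA]_z (psi (modc (C_of z)))%:E)%E.

Let kappa_lty : (kappa < +oo)%E.
Proof.
have p0 : 0 <= pi^-1 :> R by rewrite invr_ge0 pi_ge0.
apply: (@le_lt_trans _ _ ((pi^-1)%:E * gaussI 1)%E); last first.
  by apply: lte_mul_pinfty => //; exact: gauss2_lty.
rewrite -(@ge0_integralZl_EFin _ _ _ dA setT measurableT (fun z : plane => (expR (- (1 * modc (C_of z) ^+ 2)))%:E)).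
- apply: ge0_le_dA.
  + exact: measurable_psi.
  + apply: measurable_funM => //; apply: (measurableT_comp (@measurable_expR R)).
    by apply: measurable_funN; apply: measurable_funM => //; apply: measurable_funX; apply: measC_modc; exact: measC_id.
  + by move=> z; rewrite psi_ge0 mul1r lexx.
- by move=> z _; rewrite lee_fin expR_ge0.
- apply/measurable_EFinP; apply: (measurableT_comp (@measurable_expR R)).
  by apply: measurable_funN; apply: measurable_funM => //; apply: measurable_funX; apply: measC_modc; exact: measC_id.
- exact: p0.
Qed.

Let kappa_gt0 : (0 < kappa)%E.
Proof.
have p0 : 0 < pi^-1 * expR (- 1) :> R by rewrite mulr_gt0 ?expR_gt0// invr_gt0 pi_gt0.
have d0 : (0 < \int[dA]_z (disc 1 0 z)%:E)%E.
  by have /andP[+ _] := integral_disc0 (ltr01 : (0:R) < 1); apply: lt_le_trans; rewrite lte_fin; lra.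
apply: (@lt_le_trans _ _ ((pi^-1 * expR (- 1))%:E * \int[dA]_z (disc 1 0 z)%:E)%E).
  by rewrite mule_gt0// lte_fin.
rewrite -(@ge0_integralZl_EFin _ _ _ dA setT measurableT (fun z : plane => (disc 1 0 z)%:E)).
- apply: ge0_le_dA.
  + by apply: measurable_funM => //; exact: measurable_disc.
  + exact: measurable_psi.
  + move=> z; rewrite mulr_ge0 ?(ltW p0) ?disc_ge0// andTb /disc subr0.
    have [h|h] := leP (modc (C_of z)) 1; last by rewrite mulr0 psi_ge0.
    rewrite mulr1 /psi ler_wpM2l ?invr_ge0 ?pi_ge0// ler_expR lerN2.
    by rewrite expr_le1// modc_ge0.
- by move=> z _; rewrite lee_fin disc_ge0.
- by apply/measurable_EFinP; exact: measurable_disc.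
- exact: (ltW p0).
Qed.

Variables s t : C.
Hypothesis hst : modc t < modc s.
Local Notation n := (modc s).
Local Notation m := (Num.sqrt (modc t ^+ 2 + 1)).
Local Notation wker := (wker s t).

Let n0 : 0 < n. Proof. by rewrite (le_lt_trans (modc_ge0 t)). Qed.
Let s0 : s != 0. Proof. by rewrite -modc_gt0. Qed.
Let m0 : 0 < m. Proof. by rewrite sqrtr_gt0 ltr_wpDl// sqr_ge0. Qed.

Lemma wbounded_nker a : wbounded (nker a).
Proof.
split; first exact: entire_nker; exists 1 => z.
by rewrite wt_nker -expR0 ler_expR oppr_le0 mulr_ge0 ?invr_ge0// sqr_ge0.
Qed.

(* The integrand centred at [a] is the conjugate of [h] times a radial Gaussian. *)
Lemma Top_nker a z :
  Top s t (nker a) z = K s t z a * (expR (- (modc a ^+ 2 / 2)) * fine kappa)%:C.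
Proof.
have ig := Top_integrable hst z (wbounded_nker a).
have sh (u : plane -> R) : measurable_fun setT u ->
    (\int[dA]_z (u z)%:E = \int[dA]_z (u (z.1 + complex.Re a, z.2 + complex.Im a)%R)%:E)%E.
  move=> mu; symmetry.
  exact: (dA_preserving_integral (dA_preserving_shift (complex.Re a) (complex.Im a)) (proj2 (measurable_EFinP _ _) mu)).
set g := (fun w => K s t z w * nker a w * gauss_weight w) in ig.
have conjM (x y : C) : conjc (x * y) = conjc x * conjc y by exact: rmorphM.
(* At [w + a] the product of [nker a] and [exp (- |.|^2)] is [exp (- |w|^2 - a conj w - |a|^2 / 2)].
   Conjugation makes the non-radial factor of the integrand holomorphic. *)
pose h w := conjc (K s t z (w + a)) * expc (w * (- conjc a) + (- (modc a ^+ 2 / 2))%:C).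
have eh : entire h.
  have ea := entireD (@entire_id R) (@entire_cst R a).
  have e1 := entire_comp (@entire_expc R) (entire_comp (@entire_conj_kexp R s t z) ea).
  have e2 := entire_comp (@entire_expc R) (entireD (entireM (@entire_id R) (@entire_cst R (- conjc a))) (@entire_cst R (- (modc a ^+ 2 / 2))%:C)).
  have := entireM (entireM (@entire_cst R (conjc (sqrtc s)^-1)) e1) e2.
  congr entire; apply/funext => w; rewrite /h; congr (_ * _).
  by rewrite (_ : K s t z (w + a) = (sqrtc s)^-1 * expc (kexp s t z (w + a)))// [RHS]conjM conjc_expc.
have expc_real (x : R) : (expR x)%:C = expc x%:C.
  by rewrite /expc/= cos0 sin0 -[1 +i* 0]/(1 : C) mulr1.
have gaussE (x : R) : (pi^-1 * expR x)%:C = (pi^-1)%:C * expc x%:C.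
  by rewrite -expc_real; exact: rmorphM.
have gE w : g (w + a) = conjc (h w) * (psi (modc w))%:C.
  have -> : conjc (h w) = K s t z (w + a) * expc (conjc (w * (- conjc a) + (- (modc a ^+ 2 / 2))%:C)).
    by rewrite [LHS]conjM conjc_expc; congr (_ * _); exact: conjcK.
  rewrite /g -[LHS]mulrA -[RHS]mulrA; congr (_ * _).
  rewrite /psi /gauss_weight !gaussE /nker [LHS]mulrCA [RHS]mulrCA -!expcD.
  congr (_ * expc _); rewrite !modc_sqrE; case: (w) (a) => x y [u v].
  by apply/eqP; rewrite eq_complex/=; apply/andP; split; apply/eqP; field.
have mg := ig.1.
have ig' : integrableC (fun w => g (w + a)).
  split.
    have mT := (dA_preserving_shift (complex.Re a) (complex.Im a)).1.
    have gT (F : C -> R) : (fun v : plane => F (g (C_of v + a))) =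
        (fun v => F (g (C_of v))) \o (fun v => (v.1 + complex.Re a, v.2 + complex.Im a)%R).
      by apply/funext => v /=; rewrite -C_of_shift.
    split.
      by rewrite (gT (@complex.Re R)); exact: (measurableT_comp mg.1 mT).
    by rewrite (gT (@complex.Im R)); exact: (measurableT_comp mg.2 mT).
  have := ig.2; rewrite (sh _ (measC_modc mg)).
  by under eq_integral do rewrite C_of_shift.
(* Used with c = 1 and c = i: the real parts of [h] and [i h] are the real and imaginary parts of
   the conjugate of [h]. *)
have mean c : fine (\int[dA]_v (complex.Re (c * h (C_of v)) * psi (modc (C_of v)))%:E)%E = complex.Re (c * h 0) * fine kappa.
  rewrite (mean_value_Re (entireM (@entire_cst R c) eh) psi_ge0 measurable_psi kappa_lty).
    by rewrite fineM// ge0_fin_numE// ltW.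
  have := (integrableCZ c ig').2; congr (_ < _)%E; apply: eq_integral => v _.
  rewrite gE [modc (c * (_ * _))]modcM [modc (_ * (psi _)%:C)]modcM modcJ modcR (ger0_norm (psi_ge0 _)).
  by rewrite [modc (c * _)]modcM mulrA.
have -> : Top s t (nker a) z = conjc (h 0) * (fine kappa)%:C.
  rewrite /Top -/g /integralC /Rintegral (sh _ mg.1) (sh _ mg.2).
  transitivity ((complex.Re (1 * h 0) * fine kappa) +i* (complex.Re ((0 +i* 1) * h 0) * fine kappa)).
    rewrite -!mean; congr (fine _ +i* fine _); apply: eq_integral => v _; rewrite C_of_shift gE.
      by rewrite mul1r; case: (h _) => x y /=; congr EFin; ring.
    by case: (h _) => x y /=; congr EFin; ring.
  by case: (h 0) => x y; apply/eqP; rewrite eq_complex/=; apply/andP; split; apply/eqP; ring.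
rewrite /h conjM conjcK add0r mul0r add0r -expc_real -mulrA; congr (_ * _).
rewrite rmorphM; congr (_ * _).
by apply/eqP; rewrite eq_complex/= oppr0 !eqxx.
Qed.

Lemma wt_Top_nker : exists2 c : R, 0 < c & forall a z, wt (Top s t (nker a)) z = c * wker z a.
Proof.
have k0 : 0 < fine kappa by rewrite fine_gt0// kappa_gt0 kappa_lty.
exists (modc (sqrtc s)^-1 * fine kappa).
  by rewrite mulr_gt0// modc_gt0 invr_eq0 sqrtc_eq0.
move=> a z; rewrite /wmod Top_nker modcM modcR [modc (K _ _ _ _)]modcM modc_expc.
rewrite ger0_norm; last by rewrite mulr_ge0 ?expR_ge0// ltW.
rewrite /wker -[complex.Re (_ / _)]/(complex.Re (kexp s t z a)) -[modc z ^+ 2 / 2]mulrC.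
have E (b c d e h : R) : b * c * (d * e) * h = b * e * (c * h * d) by ring.
by rewrite E -!expRD.
Qed.

(** This is [center2 s t w] written out. *)
Definition extremal w : C := conjc (t * w) + (n * m)%:C * w / conjc s.

(* Both defects vanish at [(extremal w, w)]. *)
Lemma wker_extremal w :
  wker (extremal w) w = expR ((m - n) / (2 * n) * (modc (extremal w) ^+ 2 + modc w ^+ 2)).
Proof.
rewrite wkerE; congr expR.
have sj : conjc s != 0 by rewrite conjc_eq0.
have conjM (x y : C) : conjc (x * y) = conjc x * conjc y by exact: rmorphM.
have conjD (x y : C) : conjc (x + y) = conjc x + conjc y by exact: rmorphD.
have conjV (x : C) : conjc x^-1 = (conjc x)^-1 by exact: fmorphV.
have conjR (x : R) : conjc x%:C = x%:C by apply/eqP; rewrite eq_complex/= oppr0 !eqxx.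
(* This relation makes the first defect vanish at the zero of the second. *)
have N2 : (n * m)%:C * (n * m)%:C = s * conjc s * (t * conjc t + 1).
  rewrite -[LHS]rmorphM/= (_ : n * m * (n * m) = n ^+ 2 * m ^+ 2); last by ring.
  rewrite m_sqr !modc_sqrE; case: (s) (t) => a b [x y].
  by apply/eqP; rewrite eq_complex/=; apply/andP; split; apply/eqP; ring.
have d2 : defect2 s t (extremal w) w = 0.
  transitivity ((n * m)%:C * w - conjc s * (extremal w - conjc (t * w))); first by [].
  rewrite /extremal; move: ((n * m)%:C) (conjc (t * w)) (conjc s) sj => N q S S0.
  by field.
have d1 : defect1 s t (extremal w) w = 0.
  transitivity ((n * m)%:C * extremal w - s * (conjc (t * extremal w) + w)); first by [].
  rewrite /extremal.
  rewrite !(conjM, conjD, conjV, conjR, conjcK); move: N2 sj.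
  move: ((n * m)%:C) (conjc t) (conjc w) (conjc s) => N T W S N2 S0.
  rewrite mulrDr [N * (N * w / S)](_ : _ = N * N * w / S); last by ring.
  by rewrite N2; field; rewrite s0 S0.
have := Qform_identity t s0 (extremal w) w; rewrite d1 d2 modc0 expr0n/= addr0 mul0r addr0.
move=> h; rewrite (_ : Qform s t (extremal w) w = (n - m) * (modc (extremal w) ^+ 2 + modc w ^+ 2) / n).
  by field; rewrite gt_eqF.
by rewrite -h mulrAC mulfV ?mul1r// gt_eqF.
Qed.

Lemma bounded_on_le p : (0 < p)%E -> bounded_on p (Top s t) -> m <= n.
Proof.
move=> p0 [Tf [M hM]].
have [K K0 hK] := fock_pointwise p0.
have [N hN] := nker_norm p0.
have [c c0 hc] := wt_Top_nker.
have N0 : 0 <= N.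
  by rewrite -lee_fin (le_trans _ (hN 0).2)// fock_norm_ge0.
have bnd z a : c * wker z a <= K * (`|M| * N).
  have [Fa na] := hN a.
  have h := hK (Top s t (nker a)) (fock_entire (Tf _ Fa)) z.
  rewrite -hc -lee_fin; apply: le_trans h _.
  rewrite [leRHS]EFinM; apply: lee_wpmul2l; first by rewrite lee_fin ltW.
  apply: le_trans (hM _ Fa) _; rewrite EFinM.
  apply: (@le_trans _ _ (`|M|%:E * fock_norm p (nker a))%E).
    by apply: lee_wpmul2r; [exact: fock_norm_ge0|rewrite lee_fin ler_norm].
  by apply: lee_wpmul2l => //; rewrite lee_fin.
rewrite leNgt; apply/negP => nm.
set d := (m - n) / (2 * n).
have d0 : 0 < d by rewrite divr_gt0 ?subr_gt0// mulr_gt0.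
set B := K * (`|M| * N) in bnd.
have B0 : 0 <= B by rewrite !mulr_ge0// ltW.
(* As [expR (d * x ^+ 2) >= d * x] for [x >= 1], it suffices that [c * (d * x)] exceed [B]; here it
   is [c * d + B]. *)
pose x : R := 1 + B / (c * d).
have x1 : 1 <= x by rewrite lerDl divr_ge0// mulr_ge0// ltW.
have xE : c * (d * x) = c * d + B.
  by rewrite /x; move: (d) d0 => e e0; field; rewrite !gt_eqF.
have := bnd (extremal x%:C) x%:C; rewrite wker_extremal -/d.
apply/negP; rewrite -ltNge.
apply: (@lt_le_trans _ _ (c * (d * x))).
  by rewrite xE ltrDr mulr_gt0.
rewrite ler_pM2l//; apply: le_trans (expR_ge1Dx _).
apply: le_trans (_ : d * (modc (extremal x%:C) ^+ 2 + modc x%:C ^+ 2) <= _); last by rewrite lerDr.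
rewrite ler_pM2l// modcR ger0_norm; last by lra.
have := sqr_ge0 (modc (extremal x%:C)); nra.
Qed.

End Necessity.

(** * Compactness *)

Section CompactConvergence.
Variable R : realType.
Local Notation C := R[i].
Implicit Types (z w : C).

Lemma uniform_modcP (A : set C^o) (f_ : nat -> C -> C) :
  {uniform A, (f_ : nat -> C^o -> C^o) @ \oo --> (cst 0 : C^o -> C^o)} <->
  forall e : R, 0 < e -> \forall k \near \oo, forall w, A w -> modc (f_ k w) < e.
Proof.
split.
  move=> cf e e0.
  have e0' : 0 < e%:C by rewrite ltcR.
  have := cf [set h | forall y, A y -> ball (0 : C^o) (e%:C) (h y)].
  case.
    apply/uniform_nbhs; exists [set xy : C^o * C^o | ball xy.1 e%:C xy.2]; split => //.
    by rewrite -entourage_ballE; exists e%:C.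
  move=> N _ hN; exists N => // k /hN /= hk w Aw.
  by have := hk w Aw; rewrite /ball/= /ball_/= sub0r normrN modcE ltcR.
move=> hf P /uniform_nbhs[E [entE subP]].
move: entE; rewrite -entourage_ballE => -[_ /= /gt0_complexP[e e0 ->] hE].
have [N _ hN] := hf e e0; exists N => // k /hN hk.
apply: subP => w Aw; apply: hE => /=.
by rewrite /ball/= /ball_/= sub0r normrN modcE ltcR; exact: hk.
Qed.

Lemma compact_modc_bounded (A : set C^o) : compact A ->
  exists B : R, forall w, A w -> modc w <= B.
Proof.
rewrite compact_cover => cA.
have [i _||D' _ cov] := cA nat setT (fun i => [set w : C^o | modc w < i%:R]).
- rewrite openE => w /= wi; apply/nbhs_ballP; exists (i%:R - modc w)%:C => /=.
    by rewrite ltcR subr_gt0.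
  move=> v; rewrite /ball/= /ball_/= modcE ltcR => h.
  have := modcD (v - w) w; rewrite subrK modc_distC => h'; apply: le_lt_trans h' _.
  by rewrite -ltrBrDr.
- move=> w _; exists (Num.bound (modc w)) => //=.
  exact: archi_boundP (modc_ge0 w).
exists (\max_(i <- finmap.enum_fset D') i)%N%:R => w /cov[i /= iD wi].
by apply: le_trans (ltW wi) _; rewrite ler_nat; exact: leq_bigmax_seq.
Qed.

End CompactConvergence.

Section Compactness.
Variable R : realType.
Local Notation C := R[i].
Local Notation mR := (measurableTypeR R).
Local Notation plane := (mR * mR)%type.
Local Notation dA := (@dA R).
Local Notation wt := (@wmod R 2^-1).
Variables s t : C.
Hypothesis hst : modc t < modc s.
Implicit Types (f g : C -> C) (z w : C).
Local Notation n := (modc s).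
Local Notation m := (Num.sqrt (modc t ^+ 2 + 1)).
Local Notation kernel_cst := (kernel_cst s).

Let n0 : 0 < n. Proof. by rewrite (le_lt_trans (modc_ge0 t)). Qed.
Let s0 : s != 0. Proof. by rewrite -modc_gt0. Qed.
Let m0 : 0 < m. Proof. by rewrite sqrtr_gt0 ltr_wpDl// sqr_ge0. Qed.

Lemma nker_cvg0 (A : set C^o) : compact A ->
  {uniform A, (fun k => nker (k%:R : R)%:C : C^o -> C^o) @ \oo --> (cst 0 : C^o -> C^o)}.
Proof.
move=> /compact_modc_bounded[B hB]; apply/uniform_modcP => e e0.
near=> k => w Aw.
(* [k >= 2 |B| + 2] makes the exponent [Re w * k - k^2 / 2] at most [- k], and [k > 1 / e] then
   makes [expR (- k)] less than [e]. *)
have hk : 2 * `|B| + 2 + e^-1 < k%:R by near: k; exact: nbhs_infty_gtr.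
have k0 : 0 <= (k%:R : R) by exact: ler0n.
have ei : 0 < e^-1 by rewrite invr_gt0.
rewrite modc_expc; apply: (@le_lt_trans _ _ (expR (- k%:R))).
  rewrite ler_expR modcR (ger0_norm k0).
  rewrite (_ : complex.Re _ = complex.Re w * k%:R - k%:R ^+ 2 / 2); last first.
    by case: (w) => x y /=; ring.
  have h1 : complex.Re w <= `|B|.
    exact: le_trans (ler_norm _) (le_trans (ler_Re_modc _) (le_trans (hB _ Aw) (ler_norm _))).
  have := normr_ge0 B; nra.
rewrite expRN -[ltRHS]invrK ltf_pV2 ?posrE ?expR_gt0//.
by apply: lt_le_trans (expR_ge1Dx _); have := normr_ge0 B; lra.
Unshelve. all: by end_near.
Qed.

Lemma compact_on_lt p : (0 < p)%E -> compact_on p (Top s t) -> m < n.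
Proof.
move=> p0 [_ bT cT]; have mn := bounded_on_le hst p0 bT.
rewrite lt_neqAle mn andbT; apply/negP => /eqP mn'.
have [K K0 hK] := fock_pointwise p0.
have [N hN] := nker_norm p0.
have [c c0 hc] := wt_Top_nker hst.
pose a (k : nat) : C := (k%:R : R)%:C.
have ne k : (c%:E <= K%:E * fock_norm p (Top s t (nker (a k))))%E.
  have h := hK (Top s t (nker (a k))) (fock_entire (bT.1 _ (hN (a k)).1)) (extremal s t (a k)).
  by apply: le_trans h; rewrite hc wker_extremal// mn' subrr !mul0r expR0 mulr1.
have := cT (fun k => nker (a k)) (fun k => (hN (a k)).1) (ex_intro _ N (fun k => (hN (a k)).2)) nker_cvg0.
move=> /(cvgeZl (ltac:(by []) : K%:E \is a fin_num)); rewrite mule0 => h.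
have : (c%:E <= 0)%E by apply: cvge_ge h; apply: nearW => k; exact: ne.
by rewrite lee_fin leNgt c0.
Qed.

(** The bound is linear in [J] for every p, so convergence of the norms to 0 reduces to that of one
    scalar sequence. *)
Lemma fock_norm_gauss p (d : R) : (0 < p)%E -> 0 < d -> exists2 D : R, 0 <= D &
  forall g (J : R), entire g -> 0 <= J -> (forall z, wt g z <= expR (- (d * modc z ^+ 2)) * J) ->
  (fock_norm p g <= (D * J)%:E)%E.
Proof.
move=> + d0; case: p => [r|_|//]; last first.
  exists 1 => // g J _ J0 hJ; rewrite mul1r fock_norm_oo; apply: ge_ereal_sup => _ [z _ <-].
  rewrite lee_fin; apply: le_trans (hJ z) _; rewrite ler_piMl// -expR0 ler_expR oppr_le0.
  by rewrite mulr_ge0 ?sqr_ge0// ltW.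
rewrite lte_fin => r0; set G := gaussI (r * d).
have Gf : G \is a fin_num by apply: gaussI_fin; rewrite mulr_gt0.
have G0 : 0 <= fine G by rewrite fine_ge0// gaussI_ge0.
have q0 : 0 <= r / (2 * pi) :> R by rewrite divr_ge0 ?(ltW r0)// mulr_ge0// pi_ge0.
exists ((r / (2 * pi) * fine G) `^ r^-1); first exact: powR_ge0.
move=> g J eg J0 hJ.
have h : (wint r g <= (J `^ r * fine G)%:E)%E.
  rewrite EFinM (fineK Gf) /G /gaussI.
  rewrite -(@ge0_integralZl_EFin _ _ _ dA setT measurableT (fun z : plane => (expR (- (r * d * modc (C_of z) ^+ 2)))%:E)).
  - apply: ge0_le_dA.
    + by apply: (measurableT_comp (measurable_powR _)); exact: measurable_wmod.
    + apply: measurable_funM => //; have := measurable_gauss_modc (r * d) 0.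
      by congr measurable_fun; apply/funext => z; rewrite subr0.
    + move=> z; rewrite powR_ge0 andTb.
      apply: (@le_trans _ _ ((expR (- (d * modc (C_of z) ^+ 2)) * J) `^ r)).
        apply: ge0_ler_powR; rewrite ?nnegrE ?(ltW r0) ?wmod_ge0//.
        by rewrite mulr_ge0 ?expR_ge0.
      rewrite powRM ?expR_ge0// -expRM mulrC; apply: ler_wpM2l; first exact: powR_ge0.
      by rewrite ler_expR; lra.
  - by move=> z _; rewrite lee_fin expR_ge0.
  - apply/measurable_EFinP; have := measurable_gauss_modc (r * d) 0.
    by congr measurable_fun; apply/funext => z; rewrite subr0.
  - exact: powR_ge0.
rewrite fock_norm_fin.
apply: (@le_trans _ _ (((r / (2 * pi) * (J `^ r * fine G))%:E) `^ r^-1)%E).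
  apply: gt0_ler_poweR; rewrite ?invr_ge0 ?(ltW r0)//.
  - by rewrite in_itv/= leey andbT mule_ge0 ?wint_ge0// lee_fin.
  - by rewrite in_itv/= leey andbT lee_fin (mulr_ge0 q0 (mulr_ge0 (powR_ge0 _ _) G0)).
  - by rewrite [leRHS]EFinM; apply: lee_wpmul2l; [rewrite lee_fin|exact: h].
rewrite poweR_EFin lee_fin mulrCA [X in X `^ _]mulrC powRM ?powR_ge0//; last exact: mulr_ge0.
by rewrite -powRrM divff ?gt_eqF// powRr1.
Qed.

(** [wker_le_strict] bounds the kernel by a product of Gaussians in z and w. The integral [I k] in w
    is therefore free of z, one dominated convergence handles all z at once, and the Gaussian in z
    goes to [fock_norm_gauss]. *)
Lemma compact_on_Top p : (0 < p)%E -> m < n -> compact_on p (Top s t).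
Proof.
move=> p0 mn; split.
- by move=> c f g Ff Fg; apply: Top_linear => //; exact: fock_wbounded p0 _.
- by apply: Top_bounded => //; exact: ltW.
move=> f_ Ff [M hM] f_0.
have ef k : entire (f_ k) := fock_entire (Ff k).
have [K K0 hK] := fock_pointwise p0.
have wtM k z : wt (f_ k) z <= K * `|M|.
  rewrite -lee_fin; apply: le_trans (hK _ (ef k) z) _; rewrite EFinM.
  apply: lee_wpmul2l; first by rewrite lee_fin ltW.
  by apply: le_trans (hM k) _; rewrite lee_fin ler_norm.
set d := (1 - m / n) / 2.
have d0 : 0 < d by rewrite divr_gt0// subr_gt0 ltr_pdivrMr// mul1r.
have [D D0 hD] := fock_norm_gauss p0 d0.
have kap0 := kernel_cst_gt0 hst.
pose G (w : plane) : R := expR (- (d * modc (C_of w) ^+ 2)).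
have mG : measurable_fun setT G.
  have := measurable_gauss_modc d 0.
  by congr measurable_fun; apply/funext => z; rewrite subr0.
have G0 (w : plane) : 0 <= G w by exact: expR_ge0.
have mwt k : measurable_fun setT (fun w : plane => wt (f_ k) (C_of w)) by exact: measurable_wmod.
pose F k (w : plane) : \bar R := (G w * wt (f_ k) (C_of w))%:E.
have F0 k (w : plane) : (0 <= F k w)%E by rewrite lee_fin mulr_ge0// wmod_ge0.
have mF k : measurable_fun setT (F k).
  by apply/measurable_EFinP; exact: measurable_funM.
pose I k : \bar R := (\int[dA]_u F k u)%E.
have dom : dA.-integrable setT (fun w : plane => (K * `|M| * G w)%:E).
  have KM0 : 0 <= K * `|M| by rewrite mulr_ge0// ltW.
  have mKG : measurable_fun setT (fun w : plane => K * `|M| * G w) by exact: measurable_funM.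
  apply: (le_integrable_dA mKG mKG) => [w|]; first by rewrite ger0_norm// mulr_ge0.
  under eq_integral do rewrite EFinM.
  rewrite (@ge0_integralZl_EFin _ _ _ dA setT measurableT (fun w : plane => (G w)%:E)).
  - by apply: lte_mul_pinfty; [rewrite lee_fin| |exact: gauss2_lty].
  - by move=> w _; rewrite lee_fin.
  - exact/measurable_EFinP.
  - exact: KM0.
have I0 : I k @[k --> \oo] --> 0%E.
  have := @dominated_cvg _ _ _ dA setT measurableT F (cst 0%E) (fun w : plane => (K * `|M| * G w)%:E) mF.
  rewrite integral0; apply; last 3 first.
  - by [].
  - exact: dom.
  - move=> k w _; rewrite gee0_abs// lee_fin mulrC.
    by apply: ler_wpM2r => //; exact: wtM.
  move=> w _; apply/cvg_EFin; first exact: nearW.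
  have cw : modc (f_ k (C_of w)) @[k --> \oo] --> (0 : R).
    apply/cvgr0Pnorm_lt => e e0.
    (* Pointwise convergence is uniform convergence on a singleton. *)
    have /uniform_modcP/(_ e e0) := f_0 _ (@compact_set1 C^o (C_of w)).
    by apply: filterS => k /(_ _ erefl); rewrite ger0_norm ?modc_ge0.
  have := @cvgMl_tmp _ _ _ _ _ (G w) _ (@cvgMr_tmp _ _ _ _ _ _ (expR (- (2^-1 * modc (C_of w) ^+ 2))) cw).
  rewrite mul0r mulr0 => h; exact: h.
have Ifin k : I k \is a fin_num.
  rewrite ge0_fin_numE; last exact: integral_ge0.
  have [_] := integrableP _ _ _ dom; apply: le_lt_trans.
  apply: (@ge0_le_integral _ _ _ dA setT measurableT).
  - by move=> w _; exact: F0.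
  - exact: mF.
  - by apply: measurableT_comp => //; exact: measurable_int dom.
  - move=> w _; rewrite /F gee0_abs lee_fin; last by rewrite mulr_ge0// mulr_ge0// ltW.
    by rewrite mulrC; apply: ler_wpM2r => //; exact: wtM.
have wtT k z : wt (Top s t (f_ k)) z <= expR (- (d * modc z ^+ 2)) * (2 * kernel_cst * fine (I k)).
  have bf := fock_wbounded p0 (Ff k).
  rewrite -lee_fin; apply: le_trans (wt_Top_le hst z bf) _.
  rewrite [expR _ * _]mulrCA [leRHS]EFinM; apply: lee_wpmul2l; first by rewrite lee_fin mulr_ge0// ltW.
  rewrite EFinM (fineK (Ifin k)).
  rewrite -(@ge0_integralZl_EFin _ _ _ dA setT measurableT (F k)).
  - apply: (@ge0_le_integral _ _ _ dA setT measurableT).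
    + by move=> w _; rewrite lee_fin mulr_ge0 ?wker_ge0 ?wmod_ge0.
    + apply/measurable_EFinP; apply: measurable_funM => //.
      by apply: measurable_wker; [exact: measC_cst|exact: measC_id].
    + exact: measurable_funeM.
    + move=> w _; rewrite /F -EFinM lee_fin [leRHS]mulrA; apply: ler_wpM2r; first exact: wmod_ge0.
      apply: le_trans (wker_le_strict _ _ _ _) _ => //.
      by rewrite -/d -expRD mulrDr opprD.
  - by move=> w _; exact: F0.
  - exact: mF.
  - exact: expR_ge0.
apply: (@squeeze_cvge _ _ _ _ (fun=> 0%E) _ (fun k => ((D * (2 * kernel_cst))%:E * I k)%E)).
- apply: nearW => k; rewrite fock_norm_ge0//.
  have := hD _ _ (entire_Top hst (fock_wbounded p0 (Ff k))) _ (wtT k).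
  rewrite mulrA [(_ * fine _)%:E]EFinM fineK//; apply.
by apply: mulr_ge0; [apply: mulr_ge0 => //; exact: ltW|apply: fine_ge0; exact: integral_ge0].
- exact: cvg_cst.
- by have := cvgeZl (ltac:(by []) : (D * (2 * kernel_cst))%:E \is a fin_num) I0; rewrite mule0.
Qed.

End Compactness.

Theorem theoremB (R : realType) (s t : R[i]) (p : \bar R)
    (hst : modc t < modc s) (hp : (0 < p)%E) :
  (bounded_on p (Top s t) <-> modc t ^+ 2 + 1 <= modc s ^+ 2) /\
  (compact_on p (Top s t) <-> modc t ^+ 2 + 1 < modc s ^+ 2).
Proof.
have t1 : 0 <= modc t ^+ 2 + 1 by rewrite addr_ge0// sqr_ge0.
have le_sqr : (modc t ^+ 2 + 1 <= modc s ^+ 2) = (Num.sqrt (modc t ^+ 2 + 1) <= modc s).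
  by rewrite -{1}(sqr_sqrtr t1) ler_pXn2r// nnegrE ?sqrtr_ge0 ?modc_ge0.
have lt_sqr : (modc t ^+ 2 + 1 < modc s ^+ 2) = (Num.sqrt (modc t ^+ 2 + 1) < modc s).
  by rewrite -{1}(sqr_sqrtr t1) ltr_pXn2r// nnegrE ?sqrtr_ge0 ?modc_ge0.
rewrite le_sqr lt_sqr; split; split.
- exact: bounded_on_le.
- by move=> le_ts; exact: Top_bounded.
- exact: compact_on_lt.
- by move=> lt_ts; exact: compact_on_Top.
Qed.
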